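(* Let $r\ge 1$ and let $F$ be an $r$-regular graph. Then for each $\varepsilon > 0$ there exist an $n_0 = n_0(\varepsilon,F)$ and an $\eta = \eta(\varepsilon, F)>0$ such that every $F$-divisible graph $G$ on $n\geq n_0$ vertices with minimum degree $\delta(G) \geq (\delta+\varepsilon)n$, where $\delta := \max \{ \delta^{\eta}_F ,\, 1-\frac{1}{3r} \}$, has an $F$-decomposition.
   Context: All graphs are finite and simple; $e(G)$ is the number of edges of $G$. A graph $G$ has an $F$-decomposition if $E(G)$ can be partitioned into edge sets of copies of $F$ in $G$. $\gcd(G)$ is the largest integer dividing the degree of every vertex of $G$. $G$ is $F$-divisible if $e(F)$ divides $e(G)$ and $\gcd(F)$ divides $\gcd(G)$ (i.e. $\gcd(F)$ divides every vertex degree of $G$). For $\eta > 0$, an $\eta$-approximate $F$-decomposition of a graph $G$ on $n$ vertices is a set of edge-disjoint copies of $F$ in $G$ covering all but at most $\eta n^2$ edges of $G$. For $n\in\mathbb{N}$, $\delta^{\eta}_F(n)$ is the infimum over all $\delta$ such that every graph $G$ on $n$ vertices with $\delta(G)\ge \delta n$ has an $\eta$-approximate $F$-decomposition, and $\delta^\eta_F := \limsup_{n\to\infty}\delta^\eta_F(n)$. *)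

(* Defs.v *)
From HB Require Import structures.
From mathcomp Require Import all_boot all_order all_algebra.

Set Implicit Arguments.
Unset Strict Implicit.
Unset Printing Implicit Defensive.
Import Order.TTheory GRing.Theory Num.Theory.
Local Open Scope ring_scope.

Record sgraph := SGraph {
  vertex :> finType;
  adj : rel vertex;
  adj_sym : symmetric adj;
  adj_irr : irreflexive adj }.

Section Graphs.
Local Open Scope nat_scope.
Implicit Types F G : sgraph.

Definition neighbors G (x : G) : {set G} := [set y | adj x y].

(* An edge is an unordered pair, i.e. a two-element set of vertices. *)
Definition edges G : {set {set G}} :=
  [set [set x; y] | x : G, y : G in neighbors x].

Definition num_edges G : nat := #|edges G|.

Definition degree G (x : G) : nat := #|neighbors x|.

(* Every degree is less than #|G|, so this neutral element only matters for
   the graph with no vertices, whose minimum degree is then 0. *)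
Definition min_degree G : nat := \big[minn/#|G|]_(x : G) degree x.

Definition regular (r : nat) G : Prop := forall x : G, degree x = r.

(* For an edgeless graph this is 0, which every integer divides. *)
Definition degree_gcd G : nat := \big[gcdn/0]_(x : G) degree x.

Definition divisible F G : Prop :=
  (num_edges F %| num_edges G) /\ (degree_gcd F %| degree_gcd G).

(* Copies are not required to be induced subgraphs. *)
Definition is_embedding F G (f : F -> G) : Prop :=
  injective f /\ forall x y : F, adj x y -> adj (f x) (f y).

(* C is the edge set of some copy of F in G. *)
Definition copy_edges F G (C : {set {set G}}) : Prop :=
  exists2 f : F -> G, is_embedding f & C = [set f @: e | e : {set F} in edges F].

Definition has_decomposition F G : Prop :=
  exists2 P : {set {set {set G}}},
    partition P (edges G) & forall C, C \in P -> copy_edges F C.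

End Graphs.

From mathcomp Require Import all_classical all_reals all_analysis.

Section Thresholds.
Local Open Scope classical_set_scope.
Variable R : realType.
Implicit Types (F G : sgraph) (eta d : R).

(* Copies are recorded by their edge sets, hence a set of edge-disjoint copies
   is a family P of pairwise disjoint edge sets. *)
Definition has_approx_decomposition eta F G : Prop :=
  exists P : {set {set {set G}}},
    [/\ finset.trivIset P,
        forall C, C \in P -> copy_edges F C &
        #|edges G :\: finset.cover P|%:R <= eta * #|G|%:R ^+ 2].

(* The infimum is taken in the extended reals: it is -oo when every graph on n
   vertices has an approximate decomposition (e.g. n = 0 or eta >= 1/2). *)
Definition approx_threshold_at eta F (n : nat) : \bar R :=
  ereal_inf [set d%:E | d in [set d : R |
    forall G : sgraph, #|G| = n -> d * n%:R <= (min_degree G)%:R ->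
      has_approx_decomposition eta F G]].

Definition approx_threshold eta F : \bar R :=
  limn_esup (approx_threshold_at eta F).

End Thresholds.

(* Main.v *)
(* Iterative absorption. Fix nested vertex sets V = U_0, U_1, ..., U_l, each a constant
   fraction of the previous one and inheriting the relative degrees, with |U_l| bounded. Set
   aside, outside U_1, an F-decomposable edge set A such that A with H has an F-decomposition
   for every F-divisible H on U_l; there are boundedly many H. Then, for i = 0, ..., l-1,
   remove edge-disjoint copies of F covering all remaining edges not inside U_(i+1), while
   using few edges inside U_(i+1). What is left at the end lies inside U_l and is F-divisible,
   hence it can be decomposed together with A.

   In one step, the approximate decompositions given by the threshold are turned, by applying
   them to the blocks of a design, into one whose leftover is sparse at every vertex. Edges
   from w to U are covered by splitting the neighbourhood of w into r-cliques, which is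
   possible because r divides the degree, and extending each of them, with w, to a copy of F
   in which the clique is the neighbourhood of w. These cliques need a density of about
   1 - 1/(2r) and the absorbers one of 1 - 1/(3r). *)

Require Import Defs.
From mathcomp Require Import all_boot all_order all_algebra perm.
From mathcomp Require Import reals sequences exp.
From mathcomp Require Import ring lra zify.

Set Implicit Arguments.
Unset Strict Implicit.
Unset Printing Implicit Defensive.

(** * Edge sets and decompositions *)

(** Density is measured by what is missing: [k] bounds the proportion of non-neighbours, so common
    neighbours come from union bounds, and the hypothesis reads [3r(k + e) <= 1]. In absorbers each
    new vertex is adjacent to at most [max(2r, 3)] given ones. For stars, an exchange argument tiles
    [L] by r-cliques if [2r] times the number of non-neighbours is at most [|L|]; as [L] lies in a
    neighbourhood, of proportion about [1 - k], this asks for [(2r + 1)k <= 1] up to error terms.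
    Both [max(2r, 3)] and [2r + 1] are at most [3r].

    The obstacle with stars is that different centres compete for the same clique edges. The sets to
    be tiled are therefore cut down to lines over a prime field: distinct lines share a single
    point, so centres on different lines compete only within one small class, and few centres share
    a line. Randomness enters only through balanced colourings.

    The threshold depends on [eta], so [eta] is fixed before [k] is known: apart from bounds on the
    sizes of vertex sets, the constants come from [eps] and [F] alone. *)

Definition pr (T : finType) (x y : T) : {set T} := [set x; y].

Definition nb (T : finType) (E : {set {set T}}) (x : T) : {set T} :=
  [set y | pr x y \in E].

Definition dg (T : finType) (E : {set {set T}}) (x : T) : nat := #|nb E x|.

Definition inside (T : finType) (E : {set {set T}}) (U : {set T}) :=
  [set e in E | e \subset U].

Definition simple (T : finType) (E : {set {set T}}) :=
  forall e, e \in E -> #|e| = 2.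

Definition img (F : sgraph) (T : finType) (f : F -> T) : {set {set T}} :=
  [set f @: e | e : {set F} in edges F].

(** A copy in the complete graph on [T]: in a decomposition of [D] its edges lie in [D] anyway,
    since the copies cover exactly [D]. *)
Definition iscopy (F : sgraph) (T : finType) (C : {set {set T}}) :=
  exists2 f : F -> T, injective f & C = img f.

Definition dec (F : sgraph) (T : finType) (D : {set {set T}}) :=
  exists2 P : {set {set {set T}}},
    partition P D & forall C, C \in P -> iscopy F C.

Section Basics.
Variable T : finType.
Implicit Types (E D : {set {set T}}) (x y : T) (X U : {set T}).

Lemma prC x y : pr x y = pr y x.
Proof. by rewrite /pr setUC. Qed.

Lemma in_pr z x y : (z \in pr x y) = (z == x) || (z == y).
Proof. by rewrite in_set2. Qed.

Lemma pr_eq x y x' y' :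
  pr x y = pr x' y' -> (x = x' /\ y = y') \/ (x = y' /\ y = x').
Proof.
move=> e.
have h (z a b : T) : z \in pr a b -> z = a \/ z = b.
  by rewrite in_pr => /orP [/eqP|/eqP]; auto.
have h1 : x \in pr x' y' by rewrite -e in_pr eqxx.
have h2 : y \in pr x' y' by rewrite -e in_pr eqxx orbT.
have h3 : x' \in pr x y by rewrite e in_pr eqxx.
have h4 : y' \in pr x y by rewrite e in_pr eqxx orbT.
by case/h: h1; case/h: h2; case/h: h3; case/h: h4 => *; intuition congruence.
Qed.

Lemma pr_injl x y z : pr x y = pr x z -> y = z.
Proof. by case/pr_eq => [[_ ->]|[-> ->]]. Qed.

Lemma pr_sub x y X : (pr x y \subset X) = (x \in X) && (y \in X).
Proof. by rewrite subUset !sub1set. Qed.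

Lemma card_pr x y : x != y -> #|pr x y| = 2.
Proof. by move=> nxy; rewrite cards2 nxy. Qed.

Lemma card_pr2 x y : #|pr x y| = 2 -> x != y.
Proof. by rewrite cards2; case: (x == y). Qed.

Lemma simple_pr E e : simple E -> e \in E ->
  exists x y, x != y /\ e = pr x y.
Proof.
move=> sE eE; have /eqP/cards2P := sE _ eE.
by move=> [x [y [nxy ->]]]; exists x, y.
Qed.

Lemma simple_neq E x y : simple E -> pr x y \in E -> x != y.
Proof. by move=> sE /sE/card_pr2. Qed.

Lemma simpleS E D : D \subset E -> simple E -> simple D.
Proof. by move=> /subsetP s h e /s/h. Qed.

Lemma simpleU E D : simple E -> simple D -> simple (E :|: D).
Proof. by move=> h1 h2 e /setUP [/h1|/h2]. Qed.

Lemma in_nb E x y : (y \in nb E x) = (pr x y \in E).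
Proof. by rewrite inE. Qed.

Lemma nb0 x : nb set0 x = set0.
Proof. by apply/setP=> y; rewrite !inE. Qed.

Lemma dg0 x : dg set0 x = 0.
Proof. by rewrite /dg nb0 cards0. Qed.

Lemma nbU E D x : nb (E :|: D) x = nb E x :|: nb D x.
Proof. by apply/setP=> y; rewrite !inE. Qed.

Lemma nbD E D x : nb (E :\: D) x = nb E x :\: nb D x.
Proof. by apply/setP=> y; rewrite !inE. Qed.

Lemma nbS E D x : E \subset D -> nb E x \subset nb D x.
Proof. by move=> /subsetP s; apply/subsetP=> y; rewrite !in_nb; apply: s. Qed.

Lemma dgS E D x : E \subset D -> dg E x <= dg D x.
Proof. by move=> s; apply/subset_leq_card/nbS. Qed.

Lemma dgU E D x : dg (E :|: D) x <= dg E x + dg D x.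
Proof. by rewrite /dg nbU cardsU leq_subr. Qed.

Lemma dgU_disj E D x : [disjoint E & D] -> dg (E :|: D) x = dg E x + dg D x.
Proof.
move=> dis; rewrite /dg nbU cardsU.
suff -> : nb E x :&: nb D x = set0 by rewrite cards0 subn0.
apply/setP=> y; rewrite !inE; apply/negP => /andP [h1 h2].
by rewrite (disjointFr dis h1) in h2.
Qed.

Lemma dgD E D x : D \subset E -> dg (E :\: D) x = dg E x - dg D x.
Proof.
move=> s; rewrite /dg nbD cardsD.
by have /setIidPr -> := nbS x s.
Qed.

Lemma nb_bigcup (I : finType) (J : {set I}) (B : I -> {set {set T}}) x :
  nb (\bigcup_(i in J) B i) x = \bigcup_(i in J) nb (B i) x.
Proof.
apply/setP=> y; rewrite in_nb.
by apply/bigcupP/bigcupP => -[i iJ h]; exists i => //; move: h; rewrite in_nb.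
Qed.

Lemma leq_card_bigcup (S : finType) (I : finType) (J : {set I}) (B : I -> {set S}) :
  #|\bigcup_(i in J) B i| <= \sum_(i in J) #|B i|.
Proof.
elim/big_rec2: _ => [|i m A _ le]; first by rewrite cards0.
by apply: leq_trans (leq_card_setU _ _) _; rewrite leq_add2l.
Qed.

Lemma dg_bigcup (I : finType) (J : {set I}) (B : I -> {set {set T}}) x :
  dg (\bigcup_(i in J) B i) x <= \sum_(i in J) dg (B i) x.
Proof. by rewrite /dg nb_bigcup leq_card_bigcup. Qed.

Lemma insideP E U e : (e \in inside E U) = (e \in E) && (e \subset U).
Proof. by rewrite inE. Qed.

Lemma inside_sub E U : inside E U \subset E.
Proof. by apply/subsetP=> e; rewrite inE => /andP []. Qed.

Lemma missD E D X x : #|X :\: nb (E :\: D) x| <= #|X :\: nb E x| + dg D x.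
Proof.
apply: leq_trans (_ : #|(X :\: nb E x) :|: nb D x| <= _); last exact: leq_card_setU.
apply/subset_leq_card/subsetP => y; rewrite !inE.
by case: (pr x y \in D); rewrite ?orbT ?orbF.
Qed.

Lemma miss_setS E X U x : X \subset U -> #|X :\: nb E x| <= #|U :\: nb E x|.
Proof. by move=> s; apply/subset_leq_card/setSD. Qed.

(** Double counting of incidences. The edges at [x] are matched with the neighbours of [x] by
    removing [x] from each edge, which leaves singletons. *)
Lemma sum_dg E : simple E -> \sum_x dg E x = 2 * #|E|.
Proof.
move=> sE; rewrite mulnC -sum1_card big_distrl /=.
rewrite (eq_bigr (fun e : {set T} => \sum_(x in e) 1)); last first.
  by move=> e /sE h; rewrite sum1_card h mul1n.
rewrite (exchange_big_dep predT) //=; apply: eq_bigr => x _.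
rewrite /dg sum1dep_card -[RHS](@card_in_imset _ _ (fun e : {set T} => [set y in e | y != x])); last first.
  move=> e e'; rewrite !inE => /andP [eE xe] /andP [e'E xe'] /setP h.
  by apply/setP=> y; have := h y; rewrite !inE; case: eqVneq => [->|_]; rewrite ?xe ?xe' ?andbT.
rewrite -(card_imset (nb E x) (@set1_inj T)).
congr #|pred_of_set _|; apply/setP=> A; apply/imsetP/imsetP.
  move=> [y]; rewrite in_nb => h ->; have nxy := simple_neq sE h.
  exists (pr x y); first by rewrite inE h in_pr eqxx.
  apply/setP=> z; rewrite !inE.
  by case: (eqVneq z y) => [->|_]; rewrite ?orbT ?orbF ?(eq_sym y) ?nxy //=; case: eqP.
move=> [e]; rewrite inE => /andP [eE xe] ->.
have [a [b [nab ee]]] := simple_pr sE eE.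
move: xe; rewrite ee in_pr => /orP [/eqP e1|/eqP e1].
  exists b; first by rewrite in_nb e1 -ee.
  apply/setP=> z; rewrite !inE e1.
  by case: (eqVneq z b) => [->|_]; rewrite ?orbT ?orbF ?(eq_sym b) ?nab //=; case: eqP.
exists a; first by rewrite in_nb e1 prC -ee.
apply/setP=> z; rewrite !inE e1.
by case: (eqVneq z a) => [->|_]; rewrite ?orbT ?orbF ?nab //=; case: eqP.
Qed.

End Basics.

Lemma edgesP (F : sgraph) (e : {set F}) :
  reflect (exists x y : F, adj x y /\ e = pr x y) (e \in edges F).
Proof.
apply: (iffP imset2P) => [[x y _]|[x [y [a ->]]]].
  by rewrite inE => a ->; exists x, y.
by exists x y => //; rewrite inE.
Qed.

Lemma imset_pr (S T : finType) (f : S -> T) x y : f @: pr x y = pr (f x) (f y).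
Proof. by rewrite /pr imsetU !imset_set1. Qed.

Lemma imgP (F : sgraph) (T : finType) (f : F -> T) (e : {set T}) :
  reflect (exists x y : F, adj x y /\ e = pr (f x) (f y)) (e \in img f).
Proof.
apply: (iffP imsetP) => [[e' /edgesP [x [y [a ->]]] ->]|[x [y [a ->]]]].
  by exists x, y; rewrite imset_pr.
by exists (pr x y); [apply/edgesP; exists x, y|rewrite imset_pr].
Qed.

Lemma mem_img (F : sgraph) (T : finType) (f : F -> T) (x y : F) :
  adj x y -> pr (f x) (f y) \in img f.
Proof. by move=> a; apply/imgP; exists x, y. Qed.

Lemma in_edges (G : sgraph) (x y : G) : (pr x y \in edges G) = adj x y.
Proof.
apply/edgesP/idP => [[a [b [ab /pr_eq [[-> ->]|[-> ->]]]]]|h] //.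
  by rewrite adj_sym.
by exists x, y.
Qed.

Lemma adj_neq (G : sgraph) (x y : G) : adj x y -> x != y.
Proof. by apply: contraTneq => ->; rewrite adj_irr. Qed.

Lemma simple_edges (G : sgraph) : simple (edges G).
Proof. by move=> e /edgesP [x [y [/adj_neq h ->]]]; apply: card_pr. Qed.

Lemma nb_edges (G : sgraph) (x : G) : nb (edges G) x = neighbors x.
Proof. by apply/setP=> y; rewrite in_nb in_edges inE. Qed.

Section Dec.
Variables (F : sgraph) (T : finType).
Implicit Types (E D C : {set {set T}}).

Lemma simple_img (f : F -> T) : injective f -> simple (img f).
Proof.
move=> fi e /imgP [x [y [/adj_neq h ->]]]; apply: card_pr.
by rewrite (inj_eq fi).
Qed.

Lemma nb_img (f : F -> T) x : injective f -> nb (img f) (f x) = f @: neighbors x.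
Proof.
move=> fi; apply/setP=> y; rewrite in_nb; apply/imgP/imsetP.
  move=> [a [b [ab /pr_eq [[/fi e1 ->]|[/fi e1 ->]]]]].
    by exists b => //; rewrite inE e1.
  by exists a => //; rewrite inE e1 adj_sym.
by move=> [b]; rewrite inE => h ->; exists x, b.
Qed.

Lemma nb_img_out (f : F -> T) y : (forall x, f x <> y) -> nb (img f) y = set0.
Proof.
move=> h; apply/setP=> z; rewrite in_nb in_set0; apply/negP => /imgP [a [b [_ ]]].
by case/pr_eq => [[e _]|[e _]]; [exact: (h a)|exact: (h b)].
Qed.

Lemma dec0 : dec F (set0 : {set {set T}}).
Proof.
exists set0; last by move=> C; rewrite inE.
apply/and3P; split; rewrite ?inE // /cover ?big_set0 //.
by apply/trivIsetP => A B; rewrite inE.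
Qed.

Lemma decU D E : [disjoint D & E] -> dec F D -> dec F E -> dec F (D :|: E).
Proof.
move=> dis [P /and3P [/eqP cP tP nP] hP] [Q /and3P [/eqP cQ tQ nQ] hQ].
exists (P :|: Q); last by move=> C /setUP [/hP|/hQ].
apply/and3P; split.
- by rewrite /cover bigcup_setU -/(cover P) -/(cover Q) cP cQ.
- apply/trivIsetP => A B /setUP [AP|AQ] /setUP [BP|BQ] nAB.
  + by move/trivIsetP: tP; apply.
  + apply: disjointWl (_ : A \subset D) (disjointWr (_ : B \subset E) dis).
      by rewrite -cP (bigcup_max A).
    by rewrite -cQ (bigcup_max B).
  + rewrite disjoint_sym.
    apply: disjointWl (_ : B \subset D) (disjointWr (_ : A \subset E) dis).
      by rewrite -cP (bigcup_max B).
    by rewrite -cQ (bigcup_max A).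
  + by move/trivIsetP: tQ; apply.
- by rewrite inE negb_or nP.
Qed.

Lemma dec_copy C : 0 < #|edges F| -> iscopy F C -> dec F C.
Proof.
move=> ne hC; exists [set C]; last by move=> B /set1P ->.
apply/and3P; split.
- by rewrite /cover big_set1.
- by apply/trivIsetP=> A B /set1P -> /set1P ->; rewrite eqxx.
- rewrite inE eq_sym; case: hC => f _ ->.
  by rewrite -card_gt0 card_gt0 imset_eq0 -card_gt0.
Qed.

Lemma dec_img (f : F -> T) : 0 < #|edges F| -> injective f -> dec F (img f).
Proof. by move=> h fi; apply: dec_copy => //; exists f. Qed.

(** A decomposition is peeled off copy by copy. Simplicity and the divisibility of degrees and of
    the number of edges are derived from this. *)
Lemma dec_ind (Q : {set {set T}} -> Prop) :
  Q set0 ->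
  (forall C D, iscopy F C -> [disjoint C & D] -> Q D -> Q (C :|: D)) ->
  forall D, dec F D -> Q D.
Proof.
move=> Q0 QU D [P pP hP]; move: D pP hP.
have [n] := ubnP #|P|; elim: n P => // n IH P sP D /and3P [/eqP <- tP nP] hP.
case: (set_0Vmem P) => [->|[C CP]]; first by rewrite /cover big_set0.
rewrite /cover (big_setD1 C) //=; apply: QU; first exact: hP.
  rewrite -setI_eq0 big_distrr /= big1 // => B /setD1P [nBC BP].
  by apply/eqP; rewrite setI_eq0; move/trivIsetP: tP => -> //; rewrite eq_sym.
apply: (IH (P :\ C)).
- by move: sP; rewrite (cardsD1 C) CP.
- apply/and3P; split=> //.
    by apply/trivIsetP=> A B /setD1P [_ AP] /setD1P [_ BP]; move/trivIsetP: tP; apply.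
  by rewrite !inE negb_and nP orbT.
- by move=> B /setD1P [_ /hP].
Qed.

Lemma dec_simple D : dec F D -> simple D.
Proof.
apply: (dec_ind (Q := @simple T)) => [e|C E [f fi ->] _ h]; first by rewrite inE.
by apply: simpleU => //; apply: simple_img.
Qed.

Lemma dec_dg r D x : regular r F -> dec F D -> r %| dg D x.
Proof.
move=> rF; apply: (dec_ind (Q := fun D => r %| dg D x)); first by rewrite dg0 dvdn0.
move=> C E [f fi ->] dis h; rewrite dgU_disj // dvdn_add //.
case: (boolP [exists a, f a == x]) => [/existsP [a /eqP <-]|].
  by rewrite /dg nb_img // card_imset // -/(degree a) rF.
rewrite negb_exists => /forallP h'; rewrite /dg nb_img_out ?cards0 ?dvdn0 // => a.
exact/eqP/h'.
Qed.

Lemma card_img (f : F -> T) : injective f -> #|img f| = #|edges F|.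
Proof. by move=> fi; rewrite card_imset //; apply: imset_inj. Qed.

Lemma dec_card D : dec F D -> #|edges F| %| #|D|.
Proof.
apply: (dec_ind (Q := fun D => #|edges F| %| #|D|)); first by rewrite cards0 dvdn0.
move=> C E [f fi ->] dis h; rewrite cardsU.
have /eqP -> : img f :&: E == set0 by rewrite setI_eq0.
by rewrite cards0 subn0 dvdn_add // card_img.
Qed.

Lemma dec_bigcup (I : finType) (J : {set I}) (B : I -> {set {set T}}) :
  (forall i, i \in J -> dec F (B i)) ->
  (forall i j, i \in J -> j \in J -> i != j -> [disjoint B i & B j]) ->
  dec F (\bigcup_(i in J) B i).
Proof.
have [n] := ubnP #|J|; elim: n J => // n IH J sJ h1 h2.
case: (set_0Vmem J) => [->|[i iJ]]; first by rewrite big_set0; apply: dec0.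
rewrite (big_setD1 i) //=; apply: decU; last 1 first.
- apply: IH => [|j /setD1P [_ /h1] //|j k /setD1P [_ jJ] /setD1P [_ kJ]]; last exact: h2.
  by move: sJ; rewrite (cardsD1 i) iJ.
- rewrite -setI_eq0 big_distrr /= big1 // => j /setD1P [nji jJ].
  by apply/eqP; rewrite setI_eq0 h2 // eq_sym.
- exact: h1.
Qed.

End Dec.

Lemma disjoint_bigcupr (S I : finType) (J : {set I}) (B : I -> {set S}) (A : {set S}) :
  (forall i, i \in J -> [disjoint A & B i]) -> [disjoint A & \bigcup_(i in J) B i].
Proof.
move=> h; rewrite -setI_eq0 big_distrr /= big1 // => i iJ.
by apply/eqP; rewrite setI_eq0 h.
Qed.

Lemma disjoint_bigcupl (S I : finType) (J : {set I}) (B : I -> {set S}) (A : {set S}) :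
  (forall i, i \in J -> [disjoint B i & A]) -> [disjoint \bigcup_(i in J) B i & A].
Proof.
by move=> h; rewrite disjoint_sym; apply: disjoint_bigcupr => i /h; rewrite disjoint_sym.
Qed.

Lemma disjointUr (S : finType) (A B C : {set S}) :
  [disjoint A & B :|: C] = [disjoint A & B] && [disjoint A & C].
Proof. by rewrite -!setI_eq0 setIUr setU_eq0. Qed.

Lemma disjointUl (S : finType) (A B C : {set S}) :
  [disjoint B :|: C & A] = [disjoint B & A] && [disjoint C & A].
Proof. by rewrite disjoint_sym disjointUr !(disjoint_sym A). Qed.

(** * Greedy extension of partial copies *)

(** The vertices of [L] that receive edges when a copy is completed from its part on [L]; among the
    prescribed vertices only these add to the load. *)
Definition bd (F : sgraph) (L : {set F}) : {set F} :=
  [set x in L | [exists w, (w \notin L) && adj w x]].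

(** Edges within [L] are left out: they are given beforehand, and each use of the extension accounts
    for them separately. *)
Definition newE (F : sgraph) (T : finType) (L : {set F}) (f : F -> T) : {set {set T}} :=
  [set f @: e | e : {set F} in edges F & ~~ (e \subset L)].

(** Union bound: each of the at most [k] vertices of [S] rules out at most [c] candidates. *)
Lemma pick_nb (T : finType) (E : {set {set T}}) (X Z S : {set T}) k c :
  #|S| <= k -> (forall t, t \in S -> #|X :\: nb E t| <= c) ->
  k * c + #|Z| < #|X| ->
  exists y, [/\ y \in X, y \notin Z & forall t, t \in S -> pr y t \in E].
Proof.
move=> Sk hS lt.
pose B := \bigcup_(t in S) (X :\: nb E t).
have hB : #|B| <= k * c.
  apply: leq_trans (leq_card_bigcup _ _) _.
  apply: leq_trans (_ : #|S| * c <= _); last by rewrite leq_mul2r Sk orbT.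
  by rewrite -sum_nat_const leq_sum.
case: (set_0Vmem (X :\: (B :|: Z))) => [e0|[y]].
  have : #|X| <= #|B :|: Z| by apply/subset_leq_card; rewrite -setD_eq0 e0.
  have := (leq_card_setU B Z).1; lia.
rewrite !inE negb_or -andbA => /and3P [yB yZ yX]; exists y; split=> // t tS.
apply: contraNT yB => h; apply/bigcupP; exists t => //.
by rewrite inE yX andbT in_nb prC.
Qed.

Section Ext.
Variables (F : sgraph) (r : nat).
Hypothesis rF : regular r F.

Lemma newEP (T : finType) (L : {set F}) (f : F -> T) e :
  reflect (exists x y, [/\ adj x y, x \notin L & e = pr (f x) (f y)]) (e \in newE L f).
Proof.
apply: (iffP imsetP) => [[e']|[x [y [a xL ->]]]].
  rewrite inE => /andP [/edgesP [x [y [a ->]]]].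
  rewrite pr_sub negb_and => /orP [h|h] ->; rewrite imset_pr; first by exists x, y.
  by exists y, x; rewrite adj_sym prC.
exists (pr x y); last by rewrite imset_pr.
by rewrite inE in_edges a pr_sub negb_and xL.
Qed.

Lemma newE_img (T : finType) (L : {set F}) (f : F -> T) : newE L f \subset img f.
Proof. by apply/subsetP => e /newEP [x [y [a _ ->]]]; apply: mem_img. Qed.

(** The vertices outside [L] are placed one after another. By regularity a vertex has at most [r]
    neighbours already placed, and [ex] asks for at most [k] further ones, so [pick_nb] applies with
    [r + k] constraints. [Z] is forbidden, and the term [#|F|] keeps the map injective. *)
Lemma ext_copy (T : finType) (E : {set {set T}}) (L : {set F}) (g : F -> T)
    (ex : F -> {set T}) (X Z : {set T}) k c :
  {in L &, injective g} ->
  (forall w, w \notin L -> #|ex w| <= k) ->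
  (forall x w, x \in L -> w \notin L -> adj w x -> #|X :\: nb E (g x)| <= c) ->
  (forall w t, w \notin L -> t \in ex w -> #|X :\: nb E t| <= c) ->
  (forall t, t \in X -> #|X :\: nb E t| <= c) ->
  (r + k) * c + #|Z| + #|F| <= #|X| ->
  exists f : F -> T,
    [/\ injective f, {in L, f =1 g},
        forall w, w \notin L -> f w \in X :\: Z,
        newE L f \subset E &
        forall w t, w \notin L -> t \in ex w -> pr (f w) t \in E].
Proof.
have [n] := ubnP #|~: L|; elim: n L g => // n IH L g sL gi exk h1 h2 h3 le.
case: (set_0Vmem (~: L)) => [/setP e0|[w wL]].
  have inL x : x \in L by have := e0 x; rewrite !inE => /negbFE.
  exists g; split=> //.
  - by move=> x y; apply: gi.
  - by move=> w; rewrite inL.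
  - by apply/subsetP=> e /newEP [x [y []]]; rewrite inL.
  - by move=> w t; rewrite inL.
have wL' : w \notin L by rewrite inE in wL.
pose S := ex w :|: [set g x | x in L & adj w x].
have [|t||y [yX yZ yS]] := @pick_nb T E X (Z :|: g @: L) S (r + k) c.
- apply: leq_trans (leq_card_setU _ _) _; rewrite addnC leq_add ?exk //.
  apply: leq_trans (leq_imset_card _ _) _; rewrite -(rF w) /degree.
  by apply/subset_leq_card/subsetP => x; rewrite !inE => /andP [].
- by rewrite !inE => /orP [/h2 -> //|/imsetP [x]]; rewrite inE => /andP [xL a] ->; apply: (h1 _ w).
(* The strict inequality demanded by [pick_nb] comes from [w] itself: as it is not yet placed, [L]
   has fewer than [#|F|] elements. *)
- have : #|Z :|: g @: L| < #|Z| + #|F|.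
    apply: leq_ltn_trans (leq_card_setU _ _) _.
    rewrite ltn_add2l; apply: leq_ltn_trans (leq_imset_card _ _) _.
    by rewrite -(cardsC L) -[X in X < _]addn0 ltn_add2l card_gt0; apply/set0Pn; exists w.
  lia.
pose g' x := if x == w then y else g x.
have g'L x : x \in L -> g' x = g x by rewrite /g'; case: eqP => // ->; rewrite (negbTE wL').
have yL x : x \in L -> g x != y.
  by move=> xL; apply: contraNneq yZ => <-; rewrite inE imset_f ?orbT.
have [|||||||f [fi fg fX fE fex]] := IH (w |: L) g'.
- apply: leq_trans (_ : #|~: L| <= n); last by rewrite -ltnS.
  apply: proper_card; apply/properP; split; first by rewrite setCS subsetUr.
  by exists w; rewrite // !inE eqxx.
- move=> x x'; rewrite !inE => /orP [/eqP ->|xL] /orP [/eqP ->|x'L] //.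
  + by rewrite {1}/g' eqxx g'L // => e; have := yL _ x'L; rewrite -e eqxx.
  + by rewrite {2}/g' eqxx g'L // => e; have := yL _ xL; rewrite e eqxx.
  + by rewrite !g'L //; apply: gi.
- by move=> v; rewrite inE negb_or => /andP [_ /exk].
- move=> x v; rewrite !inE negb_or => /orP [/eqP ->|xL] /andP [nv vL] a; first by rewrite /g' eqxx h3.
  by rewrite g'L //; apply: (h1 _ v).
- by move=> v t; rewrite inE negb_or => /andP [_ /h2]; apply.
- exact: h3.
- exact: le.
have fw : f w = y by rewrite fg ?inE ?eqxx // /g' eqxx.
have fL x : x \in L -> f x = g x by move=> xL; rewrite fg ?g'L // inE xL orbT.
exists f; split=> //.
- move=> v vL; case: (eqVneq v w) => [->|nvw]; first by rewrite fw inE yX andbT; apply: contra yZ; rewrite inE => ->.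
  by apply: fX; rewrite !inE negb_or nvw.
- apply/subsetP => e /newEP [a [b [ab aL ->]]].
  case: (boolP (a \in w |: L)) => [|aL']; last first.
    by apply: (subsetP fE); apply/newEP; exists a, b.
  rewrite !inE (negbTE aL) orbF => /eqP ea.
  case: (boolP (b \in w |: L)) => [|bL']; last first.
    by apply: (subsetP fE); apply/newEP; exists b, a; rewrite adj_sym prC.
  rewrite !inE => /orP [/eqP eb|bL]; first by move: ab; rewrite ea eb adj_irr.
  rewrite ea fw fL //; apply: yS; rewrite inE; apply/orP; right; apply/imsetP; exists b => //.
  by rewrite inE bL -ea.
- move=> v t vL tv; case: (eqVneq v w) => [e|nvw].
    by rewrite e fw; apply: yS; rewrite inE -e tv.
  by apply: fex => //; rewrite !inE negb_or nvw.
Qed.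

(** New and boundary vertices are separated because packings control them differently: the latter
    are prescribed, the former can be steered away from crowded places. *)
Lemma dg_newE (T : finType) (L : {set F}) (f : F -> T) t : injective f ->
  dg (newE L f) t <= r * (t \in f @: (~: L) :|: f @: bd L).
Proof.
move=> fi; case: (boolP (t \in _)) => [_|h] /=.
  rewrite muln1; apply: leq_trans (dgS _ (newE_img L f)) _.
  case: (boolP [exists a, f a == t]) => [/existsP [a /eqP <-]|].
    by rewrite /dg nb_img // card_imset // -/(degree a) rF.
  rewrite negb_exists => /forallP h'; rewrite /dg nb_img_out ?cards0 // => a.
  exact/eqP/h'.
rewrite muln0 leqn0 cards_eq0; apply/eqP/setP=> y; rewrite in_nb in_set0.
apply: contraNF h => /newEP [a [b [ab aL /pr_eq [[-> _]|[-> _]]]]]; rewrite inE.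
  by rewrite imset_f // inE.
case: (boolP (b \in L)) => bL; last by rewrite imset_f // inE.
by apply/orP; right; rewrite imset_f // inE bL; apply/existsP; exists a; rewrite aL.
Qed.

(* Vertices used [s] times by the earlier copies are avoided; by double counting there
   are at most [m] of them. *)
Lemma pack (T I : finType) (J : {set I}) (L : I -> {set F}) (g : I -> F -> T)
    (X : I -> {set T}) (E : {set {set T}}) c d s m :
  (forall i, i \in J -> {in L i &, injective (g i)}) ->
  (forall i x, i \in J -> x \in bd (L i) -> #|X i :\: nb E (g i x)| <= c) ->
  (forall i t, i \in J -> t \in X i -> #|X i :\: nb E t| <= c) ->
  (forall t, #|[set i in J | t \in g i @: bd (L i)]| <= d) ->
  0 < s -> #|J| * #|F| <= m * s ->
  (forall i, i \in J -> r * (c + r * (d + s)) + m + #|F| <= #|X i|) ->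
  exists f : I -> F -> T,
    [/\ forall i, i \in J -> [/\ injective (f i), {in L i, f i =1 g i},
          forall w, w \notin L i -> f i w \in X i & newE (L i) (f i) \subset E],
        forall i j, i \in J -> j \in J -> i != j ->
          [disjoint newE (L i) (f i) & newE (L j) (f j)] &
        forall t, dg (\bigcup_(i in J) newE (L i) (f i)) t <= r * (d + s)].
Proof.
move=> gi h1 h2 hd s0 hm hX.
(* Only uses as a newly placed vertex need an invariant; uses as a boundary vertex are bounded by
   [d] in advance. Each use costs at most [r] edges, whence [r * (d + s)]. *)
suff [f [f1 f2 f3]] : exists f : I -> F -> T,
    [/\ forall i, i \in J -> [/\ injective (f i), {in L i, f i =1 g i},
          forall w, w \notin L i -> f i w \in X i & newE (L i) (f i) \subset E],
        forall i j, i \in J -> j \in J -> i != j ->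
          [disjoint newE (L i) (f i) & newE (L j) (f j)] &
        forall t, #|[set i in J | t \in f i @: (~: L i)]| <= s].
  exists f; split=> // t.
  apply: leq_trans (dg_bigcup _ _ _) _.
  apply: leq_trans (_ : \sum_(i in J) r * ((t \in f i @: (~: L i)) + (t \in g i @: bd (L i))) <= _).
    apply: leq_sum => i iJ; have [fi fg _ _] := f1 i iJ.
    apply: leq_trans (dg_newE _ _ fi) _; rewrite leq_mul2l inE; apply/orP; right.
    rewrite (_ : f i @: bd (L i) = g i @: bd (L i)); first by case: (_ \in _); case: (_ \in _).
    by apply: eq_in_imset => x; rewrite inE => /andP [/fg].
  rewrite -big_distrr leq_mul2l; apply/orP; right.
  rewrite big_split /= addnC; apply: leq_add.
    apply: leq_trans (hd t); rewrite -sum1dep_card big_mkcondr /=.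
    by apply: leq_sum => i _; case: (_ \in _).
  apply: leq_trans (f3 t); rewrite -sum1dep_card big_mkcondr /=.
  by apply: leq_sum => i _; case: (_ \in _).
have [n] := ubnP #|J|; elim: n J gi h1 h2 hd hm hX => // n IH J gi h1 h2 hd hm hX sJ.
case: (set_0Vmem J) => [J0|[i0 i0J]].
  exists g; split=> [i|i j|t]; rewrite ?J0 ?inE // (_ : [set i in _ | _] = set0) ?cards0 //.
  by apply/setP=> i; rewrite !inE.
pose J' := J :\ i0.
have J'J i : i \in J' -> i \in J by rewrite !inE => /andP [].
have J'0 i : i \in J' -> i != i0 by rewrite !inE => /andP [].
have sJ' : #|J'| < #|J| by rewrite [X in _ < X](cardsD1 i0) i0J.
have [|||||||f [f1 f2 f3]] := IH J'.
- by move=> i /J'J; apply: gi.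
- by move=> i x /J'J; apply: h1.
- by move=> i x /J'J; apply: h2.
- move=> t; apply: leq_trans (hd t); apply/subset_leq_card/subsetP=> i; rewrite !inE.
  by move=> /andP [/andP [_ ->] ->].
- by apply: leq_trans hm; rewrite leq_mul2r (ltnW sJ') orbT.
- by move=> i /J'J; apply: hX.
- by apply: leq_trans sJ' _; rewrite -ltnS.
pose cnt t := #|[set i in J' | t \in f i @: (~: L i)]|.
pose D := \bigcup_(i in J') newE (L i) (f i).
have dD t : dg D t <= r * (d + s).
  apply: leq_trans (dg_bigcup _ _ _) _.
  apply: leq_trans (_ : \sum_(i in J') r * ((t \in f i @: (~: L i)) + (t \in g i @: bd (L i))) <= _).
    apply: leq_sum => i iJ; have [fi fg _ _] := f1 i iJ.
    apply: leq_trans (dg_newE _ _ fi) _; rewrite leq_mul2l inE; apply/orP; right.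
    rewrite (_ : f i @: bd (L i) = g i @: bd (L i)); first by case: (_ \in _); case: (_ \in _).
    by apply: eq_in_imset => x; rewrite inE => /andP [/fg].
  rewrite -big_distrr leq_mul2l; apply/orP; right.
  rewrite big_split /= addnC; apply: leq_add.
    apply: leq_trans (hd t); rewrite -sum1dep_card big_mkcondr /=.
    rewrite [X in _ <= X](bigD1 i0) //= -[X in X <= _]add0n leq_add //.
    rewrite (eq_bigl (fun i => (i \in J) && (i != i0))); last by move=> i; rewrite !inE andbC.
    by apply: leq_sum => i _; case: (_ \in _).
  apply: leq_trans (f3 t); rewrite -sum1dep_card big_mkcondr /=.
  by apply: leq_sum => i _; case: (_ \in _).
pose Sat := [set t | s <= cnt t].
have hSat : #|Sat| <= m.
  rewrite -(leq_pmul2r s0); apply: leq_trans hm; rewrite -sum_nat_const.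
  apply: leq_trans (_ : \sum_(t in Sat) cnt t <= _).
    by apply: leq_sum => t; rewrite inE.
  apply: leq_trans (_ : \sum_t cnt t <= _).
    by rewrite [X in _ <= X](bigID (mem Sat)) /= leq_addr.
  rewrite (eq_bigr (fun t => \sum_(i in J') (t \in f i @: (~: L i)))); last first.
    move=> t _; rewrite /cnt -sum1dep_card big_mkcondr /=.
    by apply: eq_bigr => i _; case: (_ \in _).
  rewrite exchange_big /=.
  apply: leq_trans (_ : \sum_(i in J') #|F| <= _).
    apply: leq_sum => i _; apply: leq_trans (_ : #|f i @: (~: L i)| <= _).
      rewrite -sum1_card [X in _ <= X]big_mkcond /=.
      by apply: leq_sum => t _; case: (_ \in _).
    by apply: leq_trans (leq_imset_card _ _) (max_card _).
  by rewrite sum_nat_const leq_mul2r (ltnW sJ') orbT.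
(* The edges of the earlier copies are removed from [E], which adds at most [r * (d + s)]
   non-neighbours, and the vertices of [Sat] are forbidden. *)
have [|x w xL wL a|w t _|t tX||h [hi hg hX' hE _]] :=
  @ext_copy T (E :\: D) (L i0) (g i0) (fun _ => set0) (X i0) Sat 0 (c + r * (d + s)) (gi _ i0J).
- by move=> w _; rewrite cards0.
- apply: leq_trans (missD _ _ _ _) _; apply: leq_add => //.
  by apply: h1 => //; rewrite inE xL; apply/existsP; exists w; rewrite wL.
- by rewrite inE.
- by apply: leq_trans (missD _ _ _ _) _; apply: leq_add => //; apply: h2.
- by have := hX _ i0J; rewrite addn0; lia.
pose f' i := if i == i0 then h else f i.
have f'0 : f' i0 = h by rewrite /f' eqxx.
have f'J i : i \in J' -> f' i = f i by rewrite /f' => /J'0/negbTE ->.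
have inJ i : i \in J -> i = i0 \/ i \in J'.
  by move=> iJ; case: (eqVneq i i0) => [|n0]; [left|right; rewrite !inE n0].
have disD i : i \in J' -> [disjoint newE (L i0) h & newE (L i) (f i)].
  move=> iJ; apply: disjointWl hE _; rewrite disjoint_sym disjoints_subset.
  apply/subsetP=> e he; rewrite !inE negb_and negbK; apply/orP; left.
  by apply/bigcupP; exists i.
exists f'; split.
- move=> i /inJ [->|iJ]; last by rewrite f'J //; apply: f1.
  rewrite f'0; split=> // [w /hX'|]; first by rewrite inE => /andP [].
  by apply: subset_trans hE (subsetDl _ _).
- move=> i j /inJ [->|iJ] /inJ [->|jJ]; rewrite ?eqxx // ?f'0 ?f'J //.
  + by move=> _; apply: disD.
  + by move=> _; rewrite disjoint_sym; apply: disD.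
  + exact: f2.
(* A vertex newly used by [h] lies outside [Sat], so it had fewer than [s] uses and may take one
   more. *)
- move=> t; case: (boolP (t \in h @: (~: L i0))) => th.
    have tS : t \notin Sat.
      by case/imsetP: th => w; rewrite inE => /hX'; rewrite inE => /andP [h' _] ->.
    rewrite inE -ltnNge in tS; apply: leq_trans tS.
    rewrite /cnt -add1n -(cards1 i0); apply: leq_trans (leq_card_setU _ _).
    apply/subset_leq_card/subsetP=> i; rewrite !inE.
    by case: eqVneq => //= ni /andP [-> ]; rewrite /f' (negbTE ni).
  apply: leq_trans (f3 t); apply/subset_leq_card/subsetP=> i; rewrite !inE => /andP [iJ].
  rewrite /f'; case: eqP => [->|_ ->]; first by rewrite (negbTE th).
  by rewrite iJ.
Qed.

End Ext.

(** * Tilings by cliques *)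

Section Tiling.
Variable T : finType.
Implicit Types (E : {set {set T}}) (L : {set T}).

(** The parts are encoded as fibres of a map, so that exchanging two vertices becomes composition
    with a transposition. The values are kept in [L] for the induction: the label [a'] of the
    removed part [A] then cannot occur on the rest of [L]. *)
Lemma equal_classes L r : 0 < r -> r %| #|L| ->
  exists c : {ffun T -> T}, forall x, x \in L ->
    c x \in L /\ #|[set y in L | c y == c x]| = r.
Proof.
move=> r0; have [n] := ubnP #|L|; elim: n L => // n IH L sL dv.
case: (set_0Vmem L) => [->|[a aL]]; first by exists [ffun x => x] => x; rewrite inE.
have rL : r <= #|L| by apply: dvdn_leq => //; rewrite card_gt0; apply/set0Pn; exists a.
have [A /setIdP []]: exists A, A \in [set A : {set T} | A \subset L & #|A| == r].
  by apply/set0Pn; rewrite -card_gt0 cards_draws bin_gt0.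
move=> sA /eqP cA.
have [a' a'A] : exists a', a' \in A by apply/set0Pn; rewrite -card_gt0 cA.
have cLA : #|L :\: A| = #|L| - r by rewrite cardsD (setIidPr sA) cA.
have [||c hc] := IH (L :\: A); first by rewrite cLA; lia.
  by rewrite cLA dvdn_sub.
exists [ffun x => if x \in A then a' else c x] => x xL; rewrite ffunE.
case: (boolP (x \in A)) => xA.
  split; first exact: (subsetP sA).
  rewrite -cA; apply: eq_card => y; rewrite !inE ffunE.
  case: (boolP (y \in A)) => yA; first by rewrite (subsetP sA) // eqxx.
  apply/negP => /andP [yL /eqP e].
  have /hc [] : y \in L :\: A by rewrite inE yA yL.
  by rewrite e inE a'A.
have xLA : x \in L :\: A by rewrite inE xA xL.
have [] := hc _ xLA; rewrite inE => /andP [cxA cxL] <-; split=> //.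
apply: eq_card => y; rewrite !inE ffunE.
case: (boolP (y \in A)) => yA //=.
by rewrite andbC; apply/negP => /andP [/eqP e _]; rewrite -e a'A in cxA.
Qed.

Lemma equal_partition L r : 0 < r -> r %| #|L| ->
  exists P : {set {set T}}, partition P L /\ forall A, A \in P -> #|A| = r.
Proof.
move=> r0 dv; have [c hc] := equal_classes r0 dv.
exists (preim_partition c L); split; first exact: preim_partitionP.
move=> A /imsetP [x xL ->]; have [_ <-] := hc x xL.
by apply: eq_card => y; rewrite !inE eq_sym.
Qed.

(* A partition of L into r-sets with the fewest non-adjacent pairs inside its parts has
   none: otherwise exchanging two vertices would lower their number. *)
Lemma tiling E L r : (forall x, pr x x \notin E) -> 0 < r -> r %| #|L| ->
  (forall x, x \in L -> 2 * r * #|L :\: nb E x| <= #|L|) ->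
  exists P : {set {set T}}, partition P L /\
    forall A, A \in P -> #|A| = r /\
      forall x y, x \in A -> y \in A -> x != y -> pr x y \in E.
Proof.
move=> irr r0 dv hE.
pose bad (c : {ffun T -> T}) := [set p : T * T |
  [&& p.1 \in L, p.2 \in L, p.1 != p.2, c p.1 == c p.2 & pr p.1 p.2 \notin E]].
pose ok (c : {ffun T -> T}) :=
  [forall x, (x \in L) ==> (#|[set y in L | c y == c x]| == r)].
have [c0 hc0] : exists c, ok c.
  have [c hc] := equal_classes r0 dv; exists c; apply/forallP => x.
  by apply/implyP => /hc [_ /eqP].
have [c okc minc] := arg_minnP (fun c => #|bad c|) hc0.
have cls x : x \in L -> #|[set y in L | c y == c x]| = r.
  by move=> xL; have /forallP /(_ x) := okc; rewrite xL => /eqP.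
suff b0 : bad c = set0.
  exists (preim_partition c L); split; first exact: preim_partitionP.
  move=> A /imsetP [x xL ->]; split.
    by rewrite -[RHS](cls x xL); apply: eq_card => y; rewrite !inE eq_sym.
  move=> y z; rewrite !inE => /andP [yL /eqP ey] /andP [zL /eqP ez] nyz.
  apply/negPn/negP => h; have : (y, z) \in bad c by rewrite inE /= yL zL nyz -ey -ez eqxx.
  by rewrite b0 inE.
apply/eqP; apply: contraT => /set0Pn [[x z]].
rewrite inE /= => /and5P [xL zL nxz /eqP cxz xzE].
(* The pair [x], [z] is bad. Exchanging [x] with [y] frees both from bad pairs if the class of [y]
   contains no non-neighbour of [x] ([y] outside [Y1]) and [y] has no non-neighbour in the class of
   [x] apart from [x] ([y] outside [Y2]). As [Y1] has at most [|L| / 2] elements and [Y2] at most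
   [(r - 1)|L| / (2r)], such a [y] exists; this is the origin of the factor [2r]. *)
pose N a := L :\: nb E a.
pose Y1 := \bigcup_(b in N x) [set y in L | c y == c b].
pose Y2 := \bigcup_(a in [set y in L | c y == c x] :\ x) N a.
have L0 : 0 < #|L| by rewrite card_gt0; apply/set0Pn; exists x.
have hY1 : 2 * #|Y1| <= #|L|.
  apply: leq_trans (hE _ xL); rewrite -mulnA leq_mul2l /=.
  apply: leq_trans (leq_card_bigcup _ _) _; rewrite mulnC -sum_nat_const.
  by apply: leq_sum => b; rewrite inE => /andP [_ /cls ->].
have hY2 : 2 * r * #|Y2| <= r.-1 * #|L|.
  apply: leq_trans (_ : 2 * r * (\sum_(a in [set y in L | c y == c x] :\ x) #|N a|) <= _).
    by rewrite leq_mul2l leq_card_bigcup orbT.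
  rewrite big_distrr /= (_ : r.-1 = #|[set y in L | c y == c x] :\ x|).
    rewrite -sum_nat_const; apply: leq_sum => a; rewrite !inE => /and3P [_ aL _].
    exact: hE.
  by have := cls x xL; rewrite (cardsD1 x) inE xL eqxx /= => <-.
have [y yL yY] : exists2 y, y \in L & y \notin Y1 :|: Y2.
  apply/exists_inP; apply: contraT => /exists_inPn h.
  have : #|L| <= #|Y1 :|: Y2| by apply/subset_leq_card/subsetP => y /h /negPn.
  have := (leq_card_setU Y1 Y2).1; nia.
move: yY; rewrite inE negb_or => /andP [yY1 yY2].
have xNx : x \in N x by rewrite !inE xL andbT.
have ncyx : c y != c x.
  by apply: contraNneq yY1 => e; apply/bigcupP; exists x => //; rewrite inE yL e eqxx.
have nxy : x != y by apply: contraNneq ncyx => ->.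
have hxq q : q \in L -> c q = c y -> pr x q \in E.
  move=> qL e; apply: contraNT yY1 => h; apply/bigcupP; exists q; first by rewrite !inE h.
  by rewrite inE yL e eqxx.
have hyq q : q \in L -> q != x -> c q = c x -> pr y q \in E.
  move=> qL nq e; apply: contraNT yY2 => h; apply/bigcupP; exists q; first by rewrite !inE nq qL e eqxx.
  by rewrite !inE prC h.
pose c' : {ffun T -> T} := [ffun w => c (tperm x y w)].
have tL w : (tperm x y w \in L) = (w \in L).
  by case: tpermP => [->|->|//]; rewrite ?xL ?yL.
have okc' : ok c'.
  apply/forallP => w; apply/implyP => wL; apply/eqP.
  rewrite -(cls (tperm x y w)) ?tL // -[RHS](card_imset _ (@perm_inj _ (tperm x y))).
  apply: eq_card => v; rewrite inE; apply/idP/imsetP => [/andP [vL]|[v' ]].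
    rewrite !ffunE => h; exists (tperm x y v); last by rewrite tpermK.
    by rewrite inE tL vL.
  by rewrite inE => /andP [vL h] ->; rewrite tL vL /= !ffunE tpermK.
have cx : c' x = c y by rewrite ffunE tpermL.
have cy : c' y = c x by rewrite ffunE tpermR.
have co w : w != x -> w != y -> c' w = c w by move=> h1 h2; rewrite ffunE tpermD // eq_sym.
have nox q : q \in L -> q != x -> c' q = c' x -> pr x q \in E.
  move=> qL nq; rewrite cx; case: (eqVneq q y) => [->|nqy].
    by rewrite cy => e; rewrite e eqxx in ncyx.
  by rewrite co //; apply: hxq.
have noy q : q \in L -> q != y -> c' q = c' y -> pr y q \in E.
  move=> qL nq; case: (eqVneq q x) => [->|nqx].
    by rewrite cx cy => e; rewrite e eqxx in ncyx.
  by rewrite cy co //; apply: hyq.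
(* After the exchange no pair at [x] or [y] is bad, and elsewhere nothing has changed, while the
   pair [(x, z)] has disappeared. *)
have sb : bad c' \proper bad c.
  apply/properP; split; last first.
    exists (x, z); rewrite inE /=; first by rewrite xL zL nxz cxz eqxx.
    apply/negP => /and5P [_ _ _ /eqP e /negP]; apply; apply: nox => //.
    by rewrite eq_sym.
  apply/subsetP => -[p q]; rewrite !inE /= => /and5P [pL qL npq /eqP e nE].
  rewrite pL qL npq nE andbT /=.
  case: (eqVneq p x) => [ep|npx].
    by move/negP: nE; case; rewrite ep; apply: nox; rewrite // -ep // eq_sym.
  case: (eqVneq q x) => [eq|nqx].
    by move/negP: nE; case; rewrite eq prC; apply: nox; rewrite // -eq.
  case: (eqVneq p y) => [ep|npy].
    by move/negP: nE; case; rewrite ep; apply: noy; rewrite // -ep // eq_sym.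
  case: (eqVneq q y) => [eq|nqy].
    by move/negP: nE; case; rewrite eq prC; apply: noy; rewrite // -eq.
  by rewrite -(co p) // -(co q) // e.
have := minc _ okc'; rewrite leqNgt => /negP; case.
exact: proper_card.
Qed.

(* A pair may serve only one centre. A centre similar to w blocks at most r pairs at x;
   a dissimilar one can only block pairs inside the intersection of L w and L w'. *)
Lemma multi_tiling E (C : {set T}) (L : T -> {set T}) (sim : rel T) r :
  (forall x, pr x x \notin E) -> 0 < r -> (forall w, w \in C -> r %| #|L w|) ->
  (forall w x, w \in C -> x \in L w ->
    2 * r * (#|L w :\: nb E x| +
      r * #|[set w' in C | (x \in L w') && sim w w']| +
      #|[set y in L w | [exists w' in C, [&& ~~ sim w w', x \in L w' & y \in L w']]]|)
    <= #|L w|) ->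
  exists P : T -> {set {set T}},
    (forall w, w \in C -> partition (P w) (L w)) /\
    (forall w A, w \in C -> A \in P w -> #|A| = r /\
       forall x y, x \in A -> y \in A -> x != y -> pr x y \in E) /\
    (forall w w' A A' x y, w \in C -> w' \in C -> w != w' -> A \in P w -> A' \in P w' ->
       x != y -> x \in A -> y \in A -> x \in A' -> y \in A' -> False).
Proof.
move=> irr r0.
have [n] := ubnP #|C|; elim: n C => // n IH C sC dv hE.
case: (set_0Vmem C) => [->|[w0 w0C]].
  by exists (fun=> set0); split; [|split] => [w|w A|w w' A A' x y]; rewrite inE.
pose C' := C :\ w0.
have C'C w : w \in C' -> w \in C by rewrite !inE => /andP [].
have [| w /C'C /dv //||P [hP1 [hP2 hP3]]] := IH C'.
- by move: sC; rewrite (cardsD1 w0) w0C.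
- move=> w x /C'C wC xL; apply: leq_trans (hE w x wC xL).
  rewrite leq_mul2l leq_add ?orbT // ?leq_add // ?leq_mul2l.
    apply/orP; right; apply/subset_leq_card/subsetP => w'.
    by rewrite !inE => /andP [/andP [_ ->] ->].
  apply/subset_leq_card/subsetP => y; rewrite !inE => /andP [-> /exists_inP [w' /C'C w'C h]].
  by apply/exists_inP; exists w'.
pose D := [set e : {set T} | (#|e| == 2) &&
  [exists w in C', [exists A in P w, e \subset A]]].
have irrD x : pr x x \notin E :\: D by rewrite inE negb_and irr orbT.
have [|x xL|Q [hQ1 hQ2]] := @tiling (E :\: D) (L w0) r irrD r0.
- exact: dv.
- apply: leq_trans (hE w0 x w0C xL); rewrite leq_mul2l; apply/orP; right.
  pose S := [set w' in C | (x \in L w') && sim w0 w'].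
  pose B := \bigcup_(w in S :&: C') pblock (P w) x.
  have hB : #|B| <= r * #|S|.
    apply: leq_trans (leq_card_bigcup _ _) _.
    apply: leq_trans (_ : \sum_(w in S :&: C') r <= _).
      apply: leq_sum => w; rewrite inE => /andP [wS wC'].
      have wP := hP1 _ wC'.
      have xw : x \in cover (P w).
        by rewrite (cover_partition wP); move: wS; rewrite inE => /and3P [].
      by have [-> _] := hP2 _ _ wC' (pblock_mem xw).
    by rewrite sum_nat_const mulnC leq_mul2l subset_leq_card ?orbT // subsetIl.
  pose Y := [set y in L w0 | [exists w' in C, [&& ~~ sim w0 w', x \in L w' & y \in L w']]].
  apply: leq_trans (_ : #|((L w0 :\: nb E x) :|: B) :|: Y| <= _); last first.
    apply: leq_trans (leq_card_setU _ _) _; rewrite leq_add2r.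
    by apply: leq_trans (leq_card_setU _ _) _; rewrite leq_add2l.
  apply/subset_leq_card/subsetP => y; rewrite !in_setU !in_setD nbD in_setD.
  case/andP; rewrite negb_and => h yL; rewrite yL andbT.
  case: (boolP (y \in nb E x)) h => //=; rewrite orbF negbK => _.
  rewrite in_nb inE => /andP [_ /exists_inP [w wC' /exists_inP [A AP]]].
  rewrite pr_sub => /andP [xA yA].
  have wP := hP1 _ wC'; have /and3P [_ tP _] := wP.
  have AL : A \subset L w by rewrite -(cover_partition wP) (bigcup_max A).
  have xw := subsetP AL _ xA; have yw := subsetP AL _ yA.
  case: (boolP (sim w0 w)) => hs; apply/orP.
    left; apply/bigcupP; exists w; first by rewrite !in_setI inE (C'C _ wC') xw hs wC'.
    by rewrite (def_pblock tP AP xA).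
  right; rewrite inE yL; apply/exists_inP; exists w; first exact: C'C.
  by rewrite hs xw yw.
pose P' w := if w == w0 then Q else P w.
have inC w : w \in C -> w = w0 \/ w \in C'.
  by move=> wC; case: (eqVneq w w0) => [|n0]; [left|right; rewrite !inE n0].
have P'0 : P' w0 = Q by rewrite /P' eqxx.
have P'C w : w \in C' -> P' w = P w.
  by rewrite /P' !inE => /andP [/negbTE ->].
have key w A A' x y : w \in C' -> A \in Q -> A' \in P w -> x != y ->
    x \in A -> y \in A -> x \in A' -> y \in A' -> False.
  move=> wC' AQ A'P nxy xA yA xA' yA'.
  have [_ /(_ x y xA yA nxy)] := hQ2 _ AQ; rewrite inE => /andP [/negP h _]; apply: h.
  rewrite inE card_pr // eqxx; apply/exists_inP; exists w => //.
  by apply/exists_inP; exists A' => //; rewrite pr_sub xA'.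
exists P'; split; [|split].
- by move=> w /inC [->|wC']; rewrite ?P'0 // P'C //; apply: hP1.
- move=> w A /inC [->|wC']; rewrite ?P'0; last by rewrite P'C //; apply: hP2.
  move=> AQ; have [cA hA] := hQ2 _ AQ; split=> // x y xA yA nxy.
  by have := hA x y xA yA nxy; rewrite inE => /andP [].
- move=> w w' A A' x y /inC [->|wC'] /inC [->|w'C']; rewrite ?eqxx //.
  + by move=> _; rewrite P'0 P'C // => h1 h2 h3 h4 h5 h6 h7; apply: (key w' A A' x y).
  + by move=> _; rewrite P'0 P'C // => h1 h2 h3 h4 h5 h6 h7; apply: (key w A' A x y).
  + by rewrite !P'C //; apply: hP3.
Qed.

End Tiling.

(** * Covering stars *)

Definition stars (T : finType) (C : {set T}) (L : T -> {set T}) : {set {set T}} :=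
  \bigcup_(w in C) [set pr w x | x in L w].

Lemma starsP (T : finType) (C : {set T}) (L : T -> {set T}) e :
  reflect (exists w x, [/\ w \in C, x \in L w & e = pr w x]) (e \in stars C L).
Proof.
apply: (iffP bigcupP) => [[w wC /imsetP [x xL ->]]|[w [x [wC xL ->]]]].
  by exists w, x.
by exists w => //; apply: imset_f.
Qed.

Section Star.
Variables (F : sgraph) (r : nat) (u : F).
Hypothesis rF : regular r F.
Hypothesis r0 : 0 < r.

Lemma edges_gt0 : 0 < #|edges F|.
Proof.
have : 0 < degree u by rewrite rF.
rewrite {1}/degree card_gt0 => /set0Pn [v]; rewrite inE => h.
by rewrite card_gt0; apply/set0Pn; exists (pr u v); rewrite in_edges.
Qed.

(** The copy is prescribed on [u] and its neighbours; the latter are matched with the elements of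
    [A] by their positions in two enumerations. *)
Definition star_map (T : finType) (w : T) (A : {set T}) (x : F) : T :=
  if x == u then w else nth w (enum A) (index x (enum (neighbors u))).

Lemma star_map_u (T : finType) (w : T) (A : {set T}) : star_map w A u = w.
Proof. by rewrite /star_map eqxx. Qed.

Lemma star_map_in (T : finType) (w : T) (A : {set T}) x : #|A| = r ->
  x \in neighbors u -> star_map w A x \in A.
Proof.
move=> cA xN; rewrite /star_map; have := xN; rewrite inE => /adj_neq.
rewrite eq_sym => /negbTE ->; rewrite -mem_enum mem_nth // -cardE cA -(rF u) /degree cardE.
by rewrite index_mem mem_enum.
Qed.

Lemma star_map_inj (T : finType) (w : T) (A : {set T}) : #|A| = r -> w \notin A ->
  {in u |: neighbors u &, injective (star_map w A)}.
Proof.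
move=> cA wA x y; rewrite !in_setU1.
case: (eqVneq x u) => [->|nx] /=; case: (eqVneq y u) => [->|ny] //=.
- by move=> _ yN e; move: wA; rewrite -{1}(star_map_u w A) e star_map_in.
- by move=> xN _ e; move: wA; rewrite -{1}(star_map_u w A) -e star_map_in.
move=> xN yN; rewrite /star_map (negbTE nx) (negbTE ny) => /eqP.
have h z : z \in neighbors u -> index z (enum (neighbors u)) < size (enum A).
  by move=> zN; rewrite -cardE cA -(rF u) /degree cardE index_mem mem_enum.
rewrite nth_uniq ?enum_uniq ?h // => /eqP e.
by rewrite -[x](nth_index u (s := enum (neighbors u))) ?mem_enum // e nth_index ?mem_enum.
Qed.

Lemma star_map_onto (T : finType) (w : T) (A : {set T}) y : #|A| = r -> w \notin A ->
  y \in A -> exists2 x, x \in neighbors u & star_map w A x = y.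
Proof.
move=> cA wA yA.
have e : star_map w A @: neighbors u = A.
  apply/eqP; rewrite eqEcard; apply/andP; split.
    by apply/subsetP => z /imsetP [x xN ->]; apply: star_map_in.
  rewrite card_in_imset ?cA -?(rF u) // => a b aN bN.
  by apply: (star_map_inj cA wA); rewrite in_setU1 ?aN ?bN orbT.
by move: yA; rewrite -{1}e => /imsetP [x xN ->]; exists x.
Qed.

(** Each clique [A] of the tiling of [L w], together with [w], contains an image of [u] and its
    neighbours, whatever edges [F] has among these; [pack] completes it. A vertex [t] lies in at
    most [d] cliques, one for each [L w] containing it. In the degree bound [r * d] stands for the
    pairs within cliques and [r * (d + s)] for the completions. *)
Lemma star_cover (T : finType) (E : {set {set T}}) (C : {set T}) (L : T -> {set T})
    (sim : rel T) (X : {set T}) c d s m :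
  simple E ->
  (forall w, w \in C -> r %| #|L w|) ->
  (forall w w', w \in C -> w' \in C -> w \notin L w') ->
  [disjoint stars C L & E] ->
  (forall w x, w \in C -> x \in L w ->
    2 * r * (#|L w :\: nb E x| +
      r * #|[set w' in C | (x \in L w') && sim w w']| +
      #|[set y in L w | [exists w' in C, [&& ~~ sim w w', x \in L w' & y \in L w']]]|)
    <= #|L w|) ->
  (forall t, #|[set w in C | t \in L w]| <= d) ->
  (forall w x, w \in C -> x \in L w -> #|X :\: nb E x| <= c) ->
  (forall t, t \in X -> #|X :\: nb E t| <= c) ->
  0 < s -> (\sum_(w in C) #|L w|) * #|F| <= m * s ->
  r * (c + r * d + r * (d + s)) + m + #|F| <= #|X| ->
  exists D : {set {set T}}, [/\ dec F D, stars C L \subset D, D \subset stars C L :|: E &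
     forall t, dg (D :&: E) t <= r * d + r * (d + s)].
Proof.
move=> sE dvL CL disj hT hd h1 h2 s0 hm hX.
have irr x : pr x x \notin E by apply/negP => /(simple_neq sE); rewrite eqxx.
have [P [hP1 [hP2 hP3]]] := multi_tiling irr r0 dvL hT.
have PL w A : w \in C -> A \in P w -> A \subset L w.
  by move=> wC AP; rewrite -(cover_partition (hP1 _ wC)) (bigcup_max A).
have Pne w A : w \in C -> A \in P w -> exists x, x \in A.
  by move=> wC AP; apply/set0Pn; rewrite -card_gt0; have [-> _] := hP2 _ _ wC AP.
have Peq w A B x : w \in C -> A \in P w -> B \in P w -> x \in A -> x \in B -> A = B.
  move=> wC AP BP xA xB; have /and3P [_ tP _] := hP1 _ wC.
  by rewrite -(def_pblock tP AP xA) (def_pblock tP BP xB).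
pose J : {set T * {set T}} := [set i | (i.1 \in C) && (i.2 \in P i.1)].
pose g (i : T * {set T}) := star_map i.1 i.2.
pose N := u |: neighbors u.
have JP i : i \in J -> i.1 \in C /\ i.2 \in P i.1 by rewrite inE => /andP.
have Jc i : i \in J -> #|i.2| = r by case/JP => iC /(hP2 _ _ iC) [].
have Jw i w : i \in J -> w \in C -> w \notin i.2.
  by case/JP => iC iP wC; apply: contra (CL _ _ wC iC); apply: (subsetP (PL _ _ iC iP)).
(* All pairs inside cliques are withheld from the completions, also those that the copies leave
   free; this adds [r * d] non-neighbours. *)
pose TE := [set e : {set T} | (#|e| == 2) && [exists i in J, e \subset i.2]].
have TEE : TE \subset E.
  apply/subsetP => e; rewrite inE => /andP [/cards2P [x [y [nxy ->]]] /exists_inP [i /JP [iC iP]]].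
  by rewrite pr_sub => /andP [xA yA]; have [_] := hP2 _ _ iC iP; apply.
(* All neighbours of [u] belong to [N], so the centre is no boundary vertex: its whole degree in the
   copy is spent on the star. *)
have bdN i : g i @: bd N \subset g i @: neighbors u.
  apply/imsetS/subsetP => x; rewrite inE => /andP []; rewrite in_setU1 => /orP [/eqP ->|//].
  case/existsP => w /andP []; rewrite in_setU1 negb_or inE => /andP [_ /negP h].
  by rewrite adj_sym => /h.
have bdJ i t : i \in J -> t \in g i @: bd N -> t \in i.2.
  by move=> iJ /(subsetP (bdN i)) /imsetP [x xN ->]; apply: star_map_in; [apply: Jc|].
have dTE t : dg TE t <= r * d.
  apply: leq_trans (_ : #|\bigcup_(w in [set w in C | t \in L w]) pblock (P w) t| <= _).
    apply/subset_leq_card/subsetP => y; rewrite in_nb inE => /andP [_ /exists_inP [i /JP [iC iP]]].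
    rewrite pr_sub => /andP [tA yA]; apply/bigcupP; exists i.1.
      by rewrite inE iC (subsetP (PL _ _ iC iP)).
    by have /and3P [_ tP _] := hP1 _ iC; rewrite (def_pblock tP iP tA).
  apply: leq_trans (leq_card_bigcup _ _) _.
  apply: leq_trans (_ : \sum_(w in [set w in C | t \in L w]) r <= _).
    apply: leq_sum => w; rewrite inE => /andP [wC tL].
    have [|-> //] := hP2 _ (pblock (P w) t) wC.
    by apply: pblock_mem; rewrite (cover_partition (hP1 _ wC)).
  by rewrite sum_nat_const mulnC leq_mul2l hd orbT.
have card_J : #|J| <= \sum_(w in C) #|L w|.
  rewrite -sum1_card (eq_bigl (fun i => (i.1 \in C) && (i.2 \in P i.1))); last by move=> i; rewrite inE.
  rewrite -(pair_big_dep (mem C) (fun w A => A \in P w) (fun _ _ => 1)) /=.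
  apply: leq_sum => w wC; rewrite sum1_card (card_partition (hP1 _ wC)) -sum1_card.
  by apply: leq_sum => A AP; have [-> _] := hP2 _ _ wC AP.
have [i iJ|i x iJ xb|i t iJ tX|t|||f [f1 f2 f3]] :=
    @pack F r rF T _ J (fun _ => N) g (fun _ => X) (E :\: TE) (c + r * d) d s m _ _ _ _ s0.
- by apply: star_map_inj; [apply: Jc|apply: Jw => //; case/JP: iJ].
- have [iC iP] := JP _ iJ; apply: leq_trans (missD _ _ _ _) _; apply: leq_add => //.
  apply: (h1 i.1) => //; apply: (subsetP (PL _ _ iC iP)); apply: bdJ => //.
  exact: imset_f.
- by apply: leq_trans (missD _ _ _ _) _; apply: leq_add; [apply: h2|].
- apply: leq_trans (hd t); rewrite -(@card_in_imset _ _ fst).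
    apply/subset_leq_card/subsetP => w /imsetP [i /setIdP [iJ ti] ->].
    have [iC iP] := JP _ iJ; rewrite inE iC; apply: (subsetP (PL _ _ iC iP)); exact: bdJ.
  move=> [w A] [w' A'] /setIdP [iJ ti] /setIdP [jJ tj] /= e.
  have [/= wC AP] := JP _ iJ; have [/= w'C A'P] := JP _ jJ.
  have tA := bdJ _ _ iJ ti; have tA' := bdJ _ _ jJ tj.
  by rewrite -e in A'P *; congr pair; apply: (Peq w _ _ t).
- by apply: leq_trans hm; rewrite leq_mul2r card_J orbT.
- by move=> i _; exact: hX.
pose D := \bigcup_(i in J) img (f i).
(* An edge of a copy is new, a spoke, or a pair inside a clique. These kinds exclude each other, so
   disjointness of the copies is checked kind by kind. *)
have img_cases i e : i \in J -> e \in img (f i) ->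
    [\/ e \in newE N (f i), exists2 x, x \in i.2 & e = pr i.1 x |
        [/\ e \in TE & e \subset i.2]].
  move=> iJ /imgP [x [y [a ->]]]; have [fi fg fX fE] := f1 i iJ.
  case: (boolP (x \in N)) => xN; last by constructor 1; apply/newEP; exists x, y.
  case: (boolP (y \in N)) => yN; last first.
    by constructor 1; apply/newEP; exists y, x; rewrite adj_sym prC.
  move: xN yN a; rewrite !in_setU1.
  case: (eqVneq x u) => [->|nx] /=; case: (eqVneq y u) => [->|ny] //=.
  - by rewrite adj_irr.
  - move=> _ yN _; constructor 2; exists (f i y).
      by rewrite fg ?in_setU1 ?yN ?orbT // /g star_map_in // Jc.
    by rewrite fg ?in_setU1 ?eqxx // /g star_map_u.
  - move=> xN _ _; constructor 2; exists (f i x).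
      by rewrite fg ?in_setU1 ?xN ?orbT // /g star_map_in // Jc.
    by rewrite prC; congr pr; rewrite fg ?in_setU1 ?eqxx // /g star_map_u.
  - move=> xN yN a; constructor 3.
    have s2 : pr (f i x) (f i y) \subset i.2.
      by rewrite pr_sub !fg ?in_setU1 ?yN ?xN ?orbT // /g !star_map_in // Jc.
    split=> //; rewrite inE card_pr ?eqxx ?(inj_eq fi) ?(adj_neq a) //=.
    by apply/exists_inP; exists i.
have starJ i x : i \in J -> x \in i.2 -> pr i.1 x \in stars C L.
  move=> /JP [iC iP] xA; apply/starsP; exists i.1, x; split=> //.
  exact: (subsetP (PL _ _ iC iP)).
have nes i e : i \in J -> e \in newE N (f i) -> e \notin stars C L /\ e \notin TE.
  move=> iJ he; have [fi fg fX fE] := f1 i iJ.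
  have := subsetP fE _ he; rewrite inE => /andP [h3 h4]; split=> //.
  by apply/negP => h; rewrite (disjointFr disj h) in h4.
have sTE e : e \in stars C L -> e \in TE -> False.
  by move=> h /(subsetP TEE); rewrite (disjointFr disj h).
have star_uniq i j x y : i \in J -> j \in J -> x \in i.2 -> y \in j.2 ->
    pr i.1 x = pr j.1 y -> i = j.
  case: i j => [w A] [w' A'] iJ jJ /= xA yA'.
  have [/= wC AP] := JP _ iJ; have [/= w'C A'P] := JP _ jJ.
  case/pr_eq => [[ew exy]|[ew exy]].
    by rewrite -ew in A'P *; congr pair; apply: (Peq w _ _ x) => //; rewrite exy.
  by have := Jw _ _ jJ wC; rewrite /= ew yA'.
have TE_uniq i j e : i \in J -> j \in J -> e \in TE -> e \subset i.2 -> e \subset j.2 -> i = j.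
  case: i j => [w A] [w' A'] iJ jJ; rewrite inE => /andP [/cards2P [x [y [nxy ->]]] _].
  rewrite !pr_sub /= => /andP [xA yA] /andP [xA' yA'].
  have [/= wC AP] := JP _ iJ; have [/= w'C A'P] := JP _ jJ.
  case: (eqVneq w w') => [ew|nw]; last by case: (hP3 w w' A A' x y).
  by rewrite -ew in A'P *; congr pair; apply: (Peq w _ _ x).
have disD i j : i \in J -> j \in J -> i != j -> [disjoint img (f i) & img (f j)].
  move=> iJ jJ nij; rewrite -setI_eq0; apply/eqP/setP => e; rewrite in_setI in_set0.
  apply/negP => /andP [/(img_cases _ _ iJ) hi /(img_cases _ _ jJ) hj].
  case: hi => [hi|[x xA ei]|[hi hi2]]; case: hj => [hj|[y yA ej]|[hj hj2]].
  - by have := f2 _ _ iJ jJ nij; move/disjointFr => /(_ _ hi); rewrite hj.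
  - by have [/negP + _] := nes _ _ iJ hi; rewrite ej => h; apply/h/starJ.
  - by have [_ /negP] := nes _ _ iJ hi.
  - by have [/negP + _] := nes _ _ jJ hj; rewrite ei => h; apply/h/starJ.
  - by move/eqP: nij; apply; apply: (star_uniq _ _ x y) => //; rewrite -ei -ej.
  - by apply: (sTE e) => //; rewrite ei; apply: starJ.
  - by have [_ /negP] := nes _ _ jJ hj.
  - by apply: (sTE e) => //; rewrite ej; apply: starJ.
  - by move/eqP: nij; apply; apply: (TE_uniq _ _ e).
exists D; split.
- apply: dec_bigcup => // i iJ; have [fi _ _ _] := f1 i iJ.
  by apply: dec_img => //; apply: edges_gt0.
- apply/subsetP => e /starsP [w [x [wC xL ->]]].
  have xc : x \in cover (P w) by rewrite (cover_partition (hP1 _ wC)).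
  have AP := pblock_mem xc; set A := pblock (P w) x in AP.
  have iJ : (w, A) \in J by rewrite inE /= wC.
  have [z zN ez] := star_map_onto (Jc _ iJ) (Jw _ _ iJ wC) (etrans (mem_pblock _ _) xc).
  have [fi fg fX fE] := f1 _ iJ.
  apply/bigcupP; exists (w, A) => //; apply/imgP; exists u, z.
  split; first by rewrite inE in zN.
  by rewrite !fg ?in_setU1 ?eqxx ?zN ?orbT // /g ez star_map_u.
- apply/subsetP => e /bigcupP [i iJ]; have [fi fg fX fE] := f1 _ iJ; rewrite in_setU.
  case/(img_cases _ _ iJ) => [/(subsetP fE)|[x xA ->]|[h _]].
  + by rewrite inE => /andP [_ ->]; rewrite orbT.
  + by rewrite starJ.
  + by rewrite (subsetP TEE) ?orbT.
- move=> t; apply: leq_trans (leq_trans (dgU TE (\bigcup_(i in J) newE N (f i)) t) _).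
    apply/dgS/subsetP => e; rewrite !in_setI in_setU => /andP [/bigcupP [i iJ]].
    case/(img_cases _ _ iJ) => [h|[x xA ->]|[-> _] //].
      by move=> _; apply/orP; right; apply/bigcupP; exists i.
    by move=> h; have := starJ _ _ iJ xA => /(disjointFr disj); rewrite h.
  exact: leq_add.
Qed.

End Star.

(** * Absorbers *)

Definition spokes (T : finType) (x : T) (S : {set T}) : {set {set T}} :=
  [set pr x y | y in S].

(* Such a Q is disjoint from every edge set chosen within Z. *)
Definition fresh (T : finType) (Q : {set {set T}}) (Z Z' : {set T}) :=
  forall e, e \in Q -> e \subset Z' /\ ~~ (e \subset Z).

Section Mover.
Variables (F : sgraph) (r : nat) (u v : F).
Hypothesis rF : regular r F.
Hypothesis r0 : 0 < r.
Hypothesis uv : adj u v.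

Let L2 : {set F} := [set u; v].
Let N' := neighbors u :\ v.

(** Besides the edges of [F], adjacencies for later copies are arranged: for each [w] in [N'] the
    vertices [f i w] form a clique and see [x'], so that [u] can be put at [x'] with these as its
    neighbourhood. A vertex has at most [r] neighbours from its own copy and at most [1 + k <= r]
    extra ones, which gives [2 * r * c]. *)
Lemma mover_phase1 (T : finType) (E : {set {set T}}) (X Z : {set T}) c
    (x x' : T) (s : 'I_r -> T) k :
  injective s -> x \in Z -> x' \in Z -> (forall i, s i \in Z) ->
  (forall i, s i != x) ->
  (forall t, #|X :\: nb E t| <= c) ->
  2 * r * c + #|Z| + r * #|F| + #|F| <= #|X| -> k <= r ->
  exists f : 'I_r -> F -> T, exists Zk : {set T},
    [/\ Z \subset Zk, #|Zk| <= #|Z| + k * #|F|,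
     forall i : 'I_r, i < k ->
       [/\ injective (f i), f i u = x, f i v = s i,
          forall w, w \notin L2 -> f i w \in Zk :\: Z &
          newE L2 (f i) \subset E],
     forall (i : 'I_r) w, i < k -> w \in N' -> pr (f i w) x' \in E &
     forall (i j : 'I_r) w, i < j -> j < k ->
       (forall w', w \notin L2 -> w' \notin L2 -> f i w != f j w') /\
       (w \in N' -> pr (f j w) (f i w) \in E)].
Proof.
move=> si xZ x'Z sZ nsx hc hX; elim: k => [_|k IH kr].
  by exists (fun _ _ => x), Z; split=> //; rewrite ?mul0n ?addn0.
have [|f [Zk [ZZk cZk f1 f2 f3]]] := IH; first exact: ltnW.
pose ik := Ordinal kr.
pose g y := if y == u then x else s ik.
pose ex w := if w \in N' then x' |: [set f i w | i : 'I_r in [set i : 'I_r | i < k]] else set0.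
have nuv : u != v := adj_neq uv.
have [|w|||||h [hi hg hX' hE hex]] := @ext_copy F r rF T E L2 g ex X Zk r c.
- move=> a b; rewrite !in_set2 /g => /orP [/eqP ->|/eqP ->] /orP [/eqP ->|/eqP ->] //;
    rewrite ?eqxx ?(eq_sym v) ?(negbTE nuv) ?eqxx // => /eqP.
    by rewrite eq_sym (negbTE (nsx _)).
  by rewrite (negbTE (nsx _)).
- move=> _; rewrite /ex; case: ifP => _; last by rewrite cards0.
  apply: leq_trans (leq_card_setU _ _) _; rewrite cards1.
  apply: leq_trans (_ : 1 + k <= _) => //; rewrite leq_add2l.
  apply: leq_trans (leq_imset_card _ _) _.
  apply: leq_trans (_ : #|[set widen_ord (ltnW kr) j | j : 'I_k]| <= _).
    apply/subset_leq_card/subsetP => i; rewrite inE => ik'.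
    by apply/imsetP; exists (Ordinal ik') => //; apply: val_inj.
  by apply: leq_trans (leq_imset_card _ _) _; rewrite card_ord.
- by [].
- by [].
- by [].
- by nia.
have hu : h u = x by rewrite hg ?in_set2 ?eqxx // /g eqxx.
have hv : h v = s ik by rewrite hg ?in_set2 ?eqxx ?orbT // /g eq_sym (negbTE nuv).
have ltS (i : 'I_r) : i < k.+1 -> i = ik \/ i < k.
  rewrite ltnS leq_eqVlt => /orP [/eqP e|]; last by right.
  by left; apply: val_inj.
pose f' i := if i == ik then h else f i.
have f'k : f' ik = h by rewrite /f' eqxx.
have f'l (i : 'I_r) : i < k -> f' i = f i.
  by move=> lt; rewrite /f'; case: eqP => // e; rewrite e /= ltnn in lt.
exists f', (Zk :|: h @: setT); split.
- exact: subset_trans ZZk (subsetUl _ _).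
- apply: leq_trans (leq_card_setU _ _) _; rewrite mulSn addnCA addnC leq_add //.
  by apply: leq_trans (leq_imset_card _ _) _; rewrite cardsT.
- move=> i /ltS [->|lt].
    rewrite f'k; split=> // w wL; have := hX' w wL; rewrite !inE => /andP [h1 h2].
    rewrite imset_f ?orbT // andbT; apply: contra h1; exact: (subsetP ZZk).
  rewrite f'l //; have [h1 h2 h3 h4 h5] := f1 i lt; split=> // w wL.
  by have := h4 w wL; rewrite !inE => /andP [-> ->].
- move=> i w /ltS [->|lt] wN; last by rewrite f'l // f2.
  rewrite f'k; apply: hex; first by move: wN; rewrite !inE negb_or => /andP [-> /adj_neq]; rewrite eq_sym => ->.
  by rewrite /ex wN !inE eqxx.
- move=> i j w ij /ltS [ej|lt]; last by rewrite !f'l //; [apply: f3|apply: ltn_trans lt].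
  rewrite ej in ij *; rewrite f'k (f'l i) //; split=> [w' wL w'L|wN].
    have [_ _ _ /(_ w wL) h1 _] := f1 i ij; have := hX' w' w'L.
    rewrite inE => /andP [h2 _]; apply: contraNneq h2 => <-.
    by move: h1; rewrite inE => /andP [].
  apply: hex; first by move: wN; rewrite !inE negb_or => /andP [-> /adj_neq]; rewrite eq_sym => ->.
  by rewrite /ex wN inE; apply/orP; right; apply/imsetP; exists i; rewrite ?inE.
Qed.

(* The copies f_i send u v to x s_i; for every other neighbour w of u, the copy g_w joins
   u to the r vertices f_i w. Sending u to x in all f_i and to x' in all g_w, or
   conversely, uses the same edges except for the spokes. *)
Lemma mover : exists C, forall (T : finType) (E : {set {set T}}) (X Z : {set T}) c
    (x x' : T) (s : 'I_r -> T),
  injective s -> x \in Z -> x' \in Z -> (forall i, s i \in Z) ->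
  x != x' -> (forall i, s i != x) -> (forall i, s i != x') ->
  (forall t, #|X :\: nb E t| <= c) ->
  2 * r * c + #|Z| + C <= #|X| ->
  exists (Q : {set {set T}}) (Z' : {set T}),
    [/\ Q \subset E, Z \subset Z', #|Z'| <= #|Z| + C, fresh Q Z Z' &
      dec F (spokes x (s @: setT) :|: Q) /\ dec F (spokes x' (s @: setT) :|: Q)].
Proof.
(* The copies [f_i] take at most [r * #|F|] vertices and the copies [g_w] as many again; the other
   terms generously cover the edges and vertices blocked while the copies [g_w] are packed. *)
exists (3 * r * #|F| + r * (r * (#|F| + 1)) + 3 * #|F| * #|F| + #|F|).
move=> T E X Z c x x' s si xZ x'Z sZ nxx' nsx nsx' hc hX.
have F1 : 0 < #|F| by apply/card_gt0P; exists u.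
have [|f [Zk [ZZk cZk f1 f2 f3]]] := mover_phase1 si xZ x'Z sZ nsx hc _ (leqnn r).
  by nia.
have nuv : u != v := adj_neq uv.
have N'L w : w \in N' -> w \notin L2.
  by rewrite !inE negb_or => /andP [-> /adj_neq]; rewrite eq_sym => ->.
have N'adj w : w \in N' -> adj u w by rewrite !inE => /andP [].
have L2P w : w \notin L2 -> w != u /\ w != v by rewrite in_set2 negb_or => /andP.
have newP i w : w \notin L2 -> f i w \in Zk /\ f i w \notin Z.
  by move=> wL; have [_ _ _ /(_ w wL) + _] := f1 i (ltn_ord i); rewrite inE => /andP [].
have fneq i j w w' : w \notin L2 -> w' \notin L2 -> f i w = f j w' -> i = j /\ w = w'.
  move=> wL w'L e; have [fi _ _ _ _] := f1 i (ltn_ord i).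
  case: (ltngtP i j) => [lt|lt|/val_inj ij].
  - by have [/(_ w' wL w'L)] := f3 i j w lt (ltn_ord j); rewrite e eqxx.
  - by have [/(_ w w'L wL)] := f3 j i w' lt (ltn_ord i); rewrite e eqxx.
  - by split=> //; rewrite ij in fi e; apply: fi.
pose A w := [set f i w | i : 'I_r].
have cA w : w \notin L2 -> #|A w| = r.
  move=> wL; rewrite card_imset ?card_ord // => i j /(fneq _ _ _ _ wL wL) [].
  by [].
pose N := u |: neighbors u.
pose g0 w := star_map u x (A w).
have xA w : w \notin L2 -> x \notin A w.
  by move=> wL; apply/imsetP => -[i _ e]; have [_ /negP] := newP i w wL; rewrite -e.
have bdN w : w \in N' -> {in bd N, forall y, g0 w y \in A w}.
  move=> wN y; rewrite inE => /andP []; rewrite in_setU1 => /orP [/eqP ->|yN _].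
    case/existsP => w' /andP []; rewrite in_setU1 negb_or inE => /andP [_ /negP h].
    by rewrite adj_sym => /h.
  by apply: (star_map_in rF) => //; rewrite cA // N'L.
have [w wN|w t _ _|w t _ _|t|||g [g1 g2 _]] :=
   @pack F r rF T F N' (fun _ => N) g0 (fun _ => X :\: Zk) E c #|F| 1 (#|F| * #|F|) _ _ _ _ isT.
- by apply: (star_map_inj rF); rewrite ?cA ?xA // N'L.
- by apply: leq_trans (hc (g0 w t)); apply: miss_setS; apply: subsetDl.
- by apply: leq_trans (hc t); apply: miss_setS; apply: subsetDl.
- exact: max_card.
- by rewrite muln1 leq_mul2r max_card orbT.
- move=> w _; have := subsetDl X Zk; rewrite cardsD.
  have : #|X :&: Zk| <= #|Zk| by rewrite subset_leq_card // subsetIr.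
  by nia.
have gA w y : w \in N' -> y \in neighbors u -> g w y \in A w.
  move=> wN yN; have [_ gg _ _] := g1 w wN.
  by rewrite gg ?in_setU1 ?yN ?orbT //; apply: (star_map_in rF) => //; rewrite cA // N'L.
have gu w : w \in N' -> g w u = x.
  by move=> wN; have [_ gg _ _] := g1 w wN; rewrite gg ?in_setU1 ?eqxx // /g0 star_map_u.
have gonto w i : w \in N' -> exists2 y, y \in neighbors u & g w y = f i w.
  move=> wN; have [_ gg _ _] := g1 w wN; have wL := N'L _ wN.
  have [|y yN e] := star_map_onto u rF (cA w wL) (xA w wL) (y := f i w); first exact: imset_f.
  by exists y => //; rewrite gg ?in_setU1 ?yN ?orbT.
have gnew w y : w \in N' -> y \notin N -> g w y \in X /\ g w y \notin Zk.
  by move=> wN yN; have [_ _ /(_ y yN) + _] := g1 w wN; rewrite inE => /andP [].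
have AZ w t : w \in N' -> t \in A w -> t \in Zk /\ t \notin Z.
  by move=> wN /imsetP [i _ ->]; apply: newP; apply: N'L.
(* The two families with the image of [u] replaced by [t]. One arrangement is [AA x] with [BB x'],
   the other [AA x'] with [BB x]. *)
pose fc t i y := if y == u then t else f i y.
pose gc t w y := if y == u then t else g w y.
pose AA t := \bigcup_(i in [set: 'I_r]) img (fc t i).
pose BB t := \bigcup_(w in N') img (gc t w).
have fcu t i : fc t i u = t by rewrite /fc eqxx.
have fco t i y : y != u -> fc t i y = f i y by rewrite /fc => /negbTE ->.
have gcu t i : gc t i u = t by rewrite /gc eqxx.
have gco t i y : y != u -> gc t i y = g i y by rewrite /gc => /negbTE ->.
have fv i : f i v = s i by have [_ _ -> _ _] := f1 i (ltn_ord i).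
have nadj y : y \in neighbors u -> y != u by rewrite inE => /adj_neq; rewrite eq_sym.
have fsup i y : y != u -> f i y = s i \/ exists2 w, w \notin L2 & f i y = f i w.
  move=> ny; case: (eqVneq y v) => [->|nv]; first by left.
  by right; exists y => //; rewrite in_set2 negb_or ny.
have xx'P t t' : ((t, t') == (x, x')) || ((t, t') == (x', x)) ->
    [/\ t \in Z, t' \in Z, t != t', forall i, s i != t & forall i, s i != t'].
  by case/orP => /eqP [-> ->]; split=> //; rewrite eq_sym.
have fci t i : t \in Z -> (forall i, s i != t) -> injective (fc t i).
  move=> tZ nst a b; have [fi _ _ _ _] := f1 i (ltn_ord i); rewrite /fc.
  have key y : y != u -> f i y != t.
    move=> ny; case: (fsup i y ny) => [->|[w wL ->]] //.
    by have [_] := newP i w wL; apply: contraNneq => ->.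
  case: (eqVneq a u) => [->|na]; case: (eqVneq b u) => [->|nb] // e.
  - by have := key b nb; rewrite -e eqxx.
  - by have := key a na; rewrite e eqxx.
  - exact: fi.
have gZ w y : w \in N' -> y != u -> g w y \notin Z.
  move=> wN ny; case: (boolP (y \in N)) => yN; last first.
    by have [_] := gnew w y wN yN; apply: contra; apply: (subsetP ZZk).
  move: yN; rewrite in_setU1 (negbTE ny) /= => yN.
  by have [_] := AZ w _ wN (gA w y wN yN).
have gci t w : t \in Z -> w \in N' -> injective (gc t w).
  move=> tZ wN a b; have [gi _ _ _] := g1 w wN; rewrite /gc.
  case: (eqVneq a u) => [->|na]; case: (eqVneq b u) => [->|nb] // e.
  - by have := gZ w b wN nb; rewrite -e tZ.
  - by have := gZ w a wN na; rewrite e tZ.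
  - exact: gi.
have nadjO y : y \notin N -> adj u y = false.
  by rewrite in_setU1 negb_or inE => /andP [_ /negbTE].
have gcases t w e : w \in N' -> e \in img (gc t w) ->
    [\/ e \in newE N (g w), exists i, e = pr t (f i w) |
       exists i j, i != j /\ e = pr (f i w) (f j w)].
  move=> wN /imgP [a [b [ab ->]]]; have [gi gg _ _] := g1 w wN.
  have key y : y != u -> y \in N -> exists i, g w y = f i w.
    move=> ny; rewrite in_setU1 (negbTE ny) /= => /(gA w _ wN) /imsetP [i _ ->]; by exists i.
  case: (boolP (a \in N)) => aN; last first.
    constructor 1; apply/newEP; exists a, b; split=> //.
    have na : a != u by apply: contraNneq aN => ->; rewrite in_setU1 eqxx.
    by rewrite !gco //; apply: contraTneq ab => ->; rewrite adj_sym nadjO.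
  case: (boolP (b \in N)) => bN; last first.
    constructor 1; apply/newEP; exists b, a; split; rewrite // 1?adj_sym // prC.
    have nb : b != u by apply: contraNneq bN => ->; rewrite in_setU1 eqxx.
    by rewrite !gco //; apply: contraTneq ab => ->; rewrite nadjO.
  case: (eqVneq a u) => [ea|na].
    have nb : b != u by rewrite -ea eq_sym adj_neq.
    by have [i e1] := key b nb bN; constructor 2; exists i; rewrite ea gcu gco // e1.
  case: (eqVneq b u) => [eb|nb].
    by have [i e1] := key a na aN; constructor 2; exists i; rewrite eb gcu gco // e1 prC.
  have [i e1] := key a na aN; have [j e2] := key b nb bN.
  constructor 3; exists i, j; rewrite !gco // e1 e2; split=> //.
  apply: contraTneq ab => eij; have : a = b by apply: gi; rewrite e1 e2 eij.
  by move=> ->; rewrite adj_irr.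
have fcv t i : fc t i v = s i by rewrite fco ?fv // eq_sym.
have fcases t i e : e \in img (fc t i) -> e = pr t (s i) \/
   exists w y, [/\ w \notin L2, y != w & e = pr (f i w) (fc t i y)].
  move=> /imgP [a [b [ab ->]]].
  case: (boolP (a \in L2)) => aL; last first.
    right; exists a, b; split=> //; first by rewrite eq_sym adj_neq.
    by rewrite (fco _ _ a) //; have [] := L2P a aL.
  case: (boolP (b \in L2)) => bL; last first.
    right; exists b, a; split=> //; first by rewrite adj_neq.
    by rewrite prC (fco _ _ b) //; have [] := L2P b bL.
  move: aL bL ab; rewrite !in_set2 => /orP [/eqP ->|/eqP ->] /orP [/eqP ->|/eqP ->];
    rewrite ?adj_irr // => _; left; first by rewrite fcu fcv.
  by rewrite fcu fcv prC.
have newEo w e : w \in N' -> e \in newE N (g w) -> exists2 y, y \in e & y \notin Zk.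
  move=> wN /newEP [a [b [_ aN ->]]]; exists (g w a); first by rewrite in_pr eqxx.
  by have [] := gnew w a wN aN.
have fcZk t i y : t \in Z -> fc t i y \in Zk.
  move=> tZ; rewrite /fc; case: eqVneq => [_|ny]; first exact: (subsetP ZZk).
  case: (fsup i y ny) => [->|[w wL ->]]; first exact: (subsetP ZZk).
  by have [] := newP i w wL.
have fin t i w y : t \in Z -> (forall j, s j != t) -> w \notin L2 -> forall j,
    f j w = fc t i y -> i = j /\ w = y.
  move=> tZ nst wL j; rewrite /fc; have [_ h] := newP j w wL.
  case: eqVneq => [_|ny] e; first by rewrite e tZ in h.
  case: (eqVneq y v) => [ey|nv]; first by rewrite e ey fv sZ in h.
  have [] := @fneq j i w y wL _ e => //.
  by rewrite in_set2 negb_or ny.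
(* Symmetric in the two arrangements. Each is decomposed by its copies, and every edge other than a
   spoke belongs to the other arrangement too; it is not inside [Z] because it contains a newly
   chosen vertex. *)
have main t t' : ((t, t') == (x, x')) || ((t, t') == (x', x)) ->
    dec F (AA t :|: BB t') /\
    (forall e, e \in AA t :|: BB t' -> e \notin spokes t (s @: setT) ->
       [/\ e \in AA t' :|: BB t, e \notin spokes t' (s @: setT) & ~~ (e \subset Z)]).
  case/xx'P => tZ t'Z ntt' nst nst'; split.
    apply: decU.
    - apply: disjoint_bigcupl => i _; apply: disjoint_bigcupr => w wN.
      rewrite -setI_eq0; apply/eqP/setP => e; rewrite in_setI in_set0.
      apply/negP => /andP [he hg]; have wL := N'L w wN.
      have eZk : e \subset Zk.
        by case/imgP: he => a [b [_ ->]]; rewrite pr_sub !fcZk.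
      case: (gcases t' w e wN hg) => [hn|[j ej]|[j [k [njk ej]]]].
      - by have [y ye yZ] := newEo w e wN hn; rewrite (subsetP eZk) in yZ.
      - have t'e : t' \in e by rewrite ej in_pr eqxx.
        case/imgP: he => a [b [_ ee]]; move: t'e; rewrite ee in_pr.
        have key y : t' != fc t i y.
          rewrite /fc; case: (eqVneq y u) => [_|ny]; first by rewrite eq_sym.
          case: (fsup i y ny) => [->|[w' w'L ->]]; first by rewrite eq_sym.
          by have [_] := newP i w' w'L; apply: contraNneq => <-.
        by rewrite (negbTE (key a)) (negbTE (key b)).
      - case/imgP: he => a [b [_ ee]].
        have h1 : f j w \in e by rewrite ej in_pr eqxx.
        have h2 : f k w \in e by rewrite ej in_pr eqxx orbT.
        have key l : f l w \in e -> i = l.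
          rewrite ee in_pr => /orP [/eqP /(fin t i w _ tZ nst wL) []|/eqP /(fin t i w _ tZ nst wL) []] //.
        by rewrite -(key j h1) -(key k h2) eqxx in njk.
    - apply: dec_bigcup => [i _|i j _ _ nij].
        by apply: dec_img; [apply: (edges_gt0 u rF r0)|apply: fci].
      rewrite -setI_eq0; apply/eqP/setP => e; rewrite in_setI in_set0.
      apply/negP => /andP [hi hj].
      case: (fcases t i e hi) => [ei|[w [y [wL _ ei]]]].
        case: (fcases t j e hj) => [ej|[w [y [wL _ ej]]]].
          by move: ei; rewrite ej => /pr_injl /si e2; rewrite e2 eqxx in nij.
        have : f j w \in e by rewrite ej in_pr eqxx.
        have [_] := newP j w wL; rewrite ei in_pr.
        by case: eqP => [->|_] /=; [rewrite tZ|case: eqP => // ->; rewrite sZ].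
      case/imgP: hj => a [b [_ ej]].
      have : f i w \in e by rewrite ei in_pr eqxx.
      rewrite ej in_pr => /orP [/eqP /(fin t j w _ tZ nst wL) [e1 _]|/eqP /(fin t j w _ tZ nst wL) [e1 _]].
        by rewrite e1 eqxx in nij.
      by rewrite e1 eqxx in nij.
    - apply: dec_bigcup => [w wN|w w' wN w'N nww'].
        by apply: dec_img; [apply: (edges_gt0 u rF r0)|apply: gci].
      rewrite -setI_eq0; apply/eqP/setP => e; rewrite in_setI in_set0.
      apply/negP => /andP [hi hj].
      have key w1 : w1 \in N' -> e \in img (gc t' w1) -> e \notin newE N (g w1) ->
          e \subset Zk /\ exists2 i, f i w1 \in e & forall y, y \in e -> y = t' \/ exists j, y = f j w1.
        move=> w1N he hne; case: (gcases t' w1 e w1N he) => [hn|[j ej]|[j [k [njk ej]]]].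
        - by rewrite hn in hne.
        - have [h1 h2] := newP j w1 (N'L _ w1N); split.
            by rewrite ej pr_sub h1 (subsetP ZZk).
          exists j; first by rewrite ej in_pr eqxx orbT.
          by move=> y; rewrite ej in_pr => /orP [/eqP|/eqP]; [left|right; exists j].
        - have [h1 h2] := newP j w1 (N'L _ w1N); have [h3 h4] := newP k w1 (N'L _ w1N).
          split; first by rewrite ej pr_sub h1.
          exists j; first by rewrite ej in_pr eqxx.
          by move=> y; rewrite ej in_pr => /orP [/eqP|/eqP] ->; right; [exists j|exists k].
      case: (boolP (e \in newE N (g w))) => hn.
        case: (boolP (e \in newE N (g w'))) => hn'.
          by have := g2 w w' wN w'N nww' => /disjointFr /(_ hn); rewrite hn'.
        have [eZ _] := key w' w'N hj hn'.
        by have [y /(subsetP eZ) -> ] := newEo w e wN hn.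
      have [eZ [i fe _]] := key w wN hi hn.
      case: (boolP (e \in newE N (g w'))) => hn'.
        by have [y /(subsetP eZ) -> ] := newEo w' e w'N hn'.
      have [_ [_ _ /(_ _ fe) h]] := key w' w'N hj hn'.
      have [_ h2] := newP i w (N'L _ wN).
      case: h => [e1|[j e1]]; first by rewrite e1 t'Z in h2.
      by have [_ e2] := fneq i j w w' (N'L _ wN) (N'L _ w'N) e1; rewrite e2 eqxx in nww'.
  move=> e; rewrite in_setU => /orP [/bigcupP [i _ hi]|/bigcupP [w wN hw]] hsp.
    have /imgP [a [b [ab ee]]] := hi.
    wlog nb : a b ab ee / b != u.
      move=> W; case: (eqVneq b u) => [eb|]; last exact: (W a b).
      apply: (W b a); rewrite 1?adj_sym 1?prC //.
      by rewrite -eb adj_neq.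
    have inZ y : y != u -> y != v -> f i y \notin Z.
      by move=> h1 h2; have [] := newP i y; rewrite // in_set2 negb_or h1.
    have nt'f y : y != u -> f i y != t'.
      move=> ny; case: (fsup i y ny) => [->|[w wL ->]] //.
      by have [_] := newP i w wL; apply: contraNneq => ->.
    have nsp' : e \notin spokes t' (s @: setT).
      apply/negP => /imsetP [y _ e1]; have : t' \in e by rewrite e1 in_pr eqxx.
      rewrite ee in_pr (fco t i b nb) [t' == f i b]eq_sym (negbTE (nt'f b nb)) orbF.
      rewrite /fc; case: (eqVneq a u) => [_|na]; first by rewrite eq_sym (negbTE ntt').
      by rewrite eq_sym (negbTE (nt'f a na)).
    case: (eqVneq a u) => [ea|na].
      have nbv : b != v.
        apply: contraNneq hsp => ev; apply/imsetP; exists (s i); first exact: imset_f.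
        by rewrite ee ea fcu fco // ev fv.
      have bN : b \in N' by rewrite !inE nbv -ea.
      split=> //.
        have [y yN ey] := gonto b i bN.
        rewrite in_setU; apply/orP; right; apply/bigcupP; exists b => //.
        rewrite ee ea fcu fco // -ey -(gco t) ?nadj // -{1}(gcu t b).
        by apply: mem_img; rewrite inE in yN.
      by rewrite ee pr_sub negb_and (fco _ _ b nb) (inZ b nb nbv) orbT.
    split=> //.
      rewrite in_setU; apply/orP; left; apply/bigcupP; exists i; rewrite ?inE //.
      by rewrite ee !fco // -(fco t' i a) // -(fco t' i b) //; apply: mem_img.
    rewrite ee pr_sub negb_and !fco //.
    case: (eqVneq a v) => [ea|nav]; last by rewrite (inZ a na nav).
    by rewrite (inZ b nb) ?orbT // -ea eq_sym adj_neq.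
  have /imgP [a [b [ab ee]]] := hw.
  wlog nb : a b ab ee / b != u.
    move=> W; case: (eqVneq b u) => [eb|]; last exact: (W a b).
    apply: (W b a); rewrite 1?adj_sym 1?prC //.
    by rewrite -eb adj_neq.
  have nsp' : e \notin spokes t' (s @: setT).
    apply/negP => /imsetP [y /imsetP [i _ ->] e1].
    have h : s i \in e by rewrite e1 in_pr eqxx orbT.
    have h2 : gc t' w b \in e by rewrite ee in_pr eqxx orbT.
    move: h2; rewrite gco // e1 in_pr => /orP [/eqP e2|/eqP e2].
      by have := gZ w b wN nb; rewrite e2 t'Z.
    by have := gZ w b wN nb; rewrite e2 sZ.
  have nZ : ~~ (e \subset Z) by rewrite ee pr_sub negb_and (gco _ _ b) // gZ ?orbT.
  split=> //; rewrite in_setU; apply/orP.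
  case: (eqVneq a u) => [ea|na].
    have bN : b \in neighbors u by rewrite inE -ea.
    left; have /imsetP [i _ ei] := gA w b wN bN.
    have wL := N'L _ wN; have [nwu _] := L2P w wL.
    apply/bigcupP; exists i; rewrite ?inE //.
    rewrite ee ea gcu gco // ei -(fco t' i w) // -{1}(fcu t' i).
    by apply: mem_img; apply: N'adj.
  right; apply/bigcupP; exists w => //.
  by rewrite ee !gco // -(gco t w a) // -(gco t w b) //; apply: mem_img.
have [|dx hx] := main x x'; first by rewrite eqxx.
have [|dx' hx'] := main x' x; first by rewrite eqxx orbT.
have spA t : spokes t (s @: setT) \subset AA t.
  apply/subsetP => e /imsetP [y /imsetP [i _ ->] ->]; apply/bigcupP; exists i; rewrite ?inE //.
  rewrite -(fv i) -(fco t i v) 1?eq_sym // -{1}(fcu t i); exact: mem_img.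
pose Q := (AA x :|: BB x') :\: spokes x (s @: setT).
have eQ : Q = (AA x' :|: BB x) :\: spokes x' (s @: setT).
  apply/setP => e; rewrite !in_setD; apply/andP/andP => -[h1 h2].
    by have [h3 h4 _] := hx e h2 h1.
  by have [h3 h4 _] := hx' e h2 h1.
pose Z' := Zk :|: \bigcup_(w in N') (g w @: setT).
have ZkZ' : Zk \subset Z' by apply: subsetUl.
have ZZ' : Z \subset Z' by apply: subset_trans ZkZ'.
exists Q, Z'; split=> //.
- apply/subsetP => e; rewrite in_setD => /andP [hsp]; rewrite in_setU.
  case/orP => [/bigcupP [i _ hi]|/bigcupP [w wN hw]].
    have [fi fu fv' _ fE] := f1 i (ltn_ord i).
    have efc : fc x i =1 f i by move=> y; rewrite /fc; case: eqP => // ->.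
    have /imgP [a [b [ab ee]]] := hi; rewrite !efc in ee.
    apply: (subsetP fE); apply/newEP.
    case: (boolP (a \in L2)) => aL; last by exists a, b.
    case: (boolP (b \in L2)) => bL; last by exists b, a; rewrite adj_sym prC.
    move/negP: hsp; case; apply/imsetP; exists (s i); first exact: imset_f.
    move: aL bL ab ee; rewrite !in_set2 => /orP [/eqP ->|/eqP ->] /orP [/eqP ->|/eqP ->];
      by rewrite ?adj_irr // fu fv' // prC.
  have [_ _ _ gE] := g1 w wN.
  case: (gcases x' w e wN hw) => [/(subsetP gE) //|[i ->]|[i [j [nij ->]]]].
    by rewrite prC; apply: f2.
  case: (ltngtP i j) => [lt|lt|/val_inj eij]; last by rewrite eij eqxx in nij.
    by rewrite prC; have [_] := f3 i j w lt (ltn_ord j); apply.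
  by have [_] := f3 j i w lt (ltn_ord i); apply.
- apply: leq_trans (leq_card_setU _ _) _.
  have : #|\bigcup_(w in N') g w @: setT| <= r * #|F|.
    apply: leq_trans (leq_card_bigcup _ _) _.
    apply: leq_trans (_ : \sum_(w in N') #|F| <= _).
      by apply: leq_sum => w _; rewrite -cardsT leq_imset_card.
    rewrite sum_nat_const leq_mul2r -(rF u) /degree subset_leq_card ?orbT //.
    exact: subsetDl.
  by nia.
- move=> e eQ'; split; last first.
    by move: eQ'; rewrite in_setD => /andP [h1 h2]; have [_ _] := hx e h2 h1.
  move: eQ'; rewrite in_setD => /andP [_]; rewrite in_setU.
  case/orP => [/bigcupP [i _ /imgP [a [b [_ ->]]]]|/bigcupP [w wN /imgP [a [b [_ ->]]]]].
    by rewrite pr_sub !(subsetP ZkZ') ?fcZk.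
  have key y : gc x' w y \in Z'.
    rewrite /gc; case: eqP => _; first exact: (subsetP ZZ').
    by rewrite inE; apply/orP; right; apply/bigcupP; exists w => //; apply: imset_f.
  by rewrite pr_sub !key.
- split.
    suff -> : spokes x (s @: setT) :|: Q = AA x :|: BB x' by [].
    rewrite /Q setDE setUIr setUCr setIT; apply/setUidPr.
    by apply: subset_trans (spA x) (subsetUl _ _).
  suff -> : spokes x' (s @: setT) :|: Q = AA x' :|: BB x by [].
  rewrite eQ setDE setUIr setUCr setIT; apply/setUidPr.
  by apply: subset_trans (spA x') (subsetUl _ _).
Qed.

End Mover.

(** * Swaps and their composition *)

Definition within (T : finType) (A : {set {set T}}) (Z : {set T}) :=
  forall e, e \in A -> e \subset Z.

Lemma withinS (T : finType) (A : {set {set T}}) (Z Z' : {set T}) :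
  Z \subset Z' -> within A Z -> within A Z'.
Proof. by move=> s h e /h se; apply: subset_trans se s. Qed.

Lemma withinU (T : finType) (A B : {set {set T}}) (Z : {set T}) :
  within A Z -> within B Z -> within (A :|: B) Z.
Proof. by move=> h1 h2 e /setUP [/h1|/h2]. Qed.

Lemma within_spokes (T : finType) (x : T) (S Z : {set T}) :
  x \in Z -> S \subset Z -> within (spokes x S) Z.
Proof. by move=> xZ sZ e /imsetP [y yS ->]; rewrite pr_sub xZ (subsetP sZ). Qed.

Lemma fresh_within (T : finType) (Q : {set {set T}}) (Z Z' : {set T}) :
  fresh Q Z Z' -> within Q Z'.
Proof. by move=> h e /h []. Qed.

Lemma fresh_disj (T : finType) (A Q : {set {set T}}) (Z Z' : {set T}) :
  within A Z -> fresh Q Z Z' -> [disjoint A & Q].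
Proof.
move=> hA hQ; rewrite -setI_eq0; apply/eqP/setP => e; rewrite in_setI in_set0.
by apply/negP => /andP [/hA h1 /hQ [_]]; rewrite h1.
Qed.

Lemma freshU (T : finType) (Q Q' : {set {set T}}) (Z Z1 Z2 : {set T}) :
  Z \subset Z1 -> Z1 \subset Z2 -> fresh Q Z Z1 -> fresh Q' Z1 Z2 ->
  fresh (Q :|: Q') Z Z2.
Proof.
move=> s1 s2 h1 h2 e /setUP [/h1 [h3 h4]|/h2 [h3 h4]]; split=> //.
  exact: subset_trans h3 s2.
by apply: contra h4 => h; apply: subset_trans h s1.
Qed.

Lemma freshS (T : finType) (Q : {set {set T}}) (Z Z1 Z' : {set T}) :
  Z \subset Z1 -> fresh Q Z1 Z' -> fresh Q Z Z'.
Proof.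
move=> s h e /h [h1 h2]; split=> //; apply: contra h2 => h2; exact: subset_trans h2 s.
Qed.

Lemma spokes_disj (T : finType) (x y : T) (S S' : {set T}) :
  x \notin S' -> (x != y) || [disjoint S & S'] -> [disjoint spokes x S & spokes y S'].
Proof.
move=> xS' h; rewrite -setI_eq0; apply/eqP/setP => e; rewrite in_setI in_set0.
apply/negP => /andP [/imsetP [a aS ->] /imsetP [b bS] /pr_eq [[e1 e2]|[e1 e2]]].
  move: h; rewrite e1 eqxx /= => /disjointFr /(_ aS); by rewrite e2 bS.
by rewrite e1 bS in xS'.
Qed.

Section Swaps.
Variables (F : sgraph) (r : nat).

(** [A] and [B] are exchanged through a common remainder [Q]. Quantifying over [Z1] allows several
    swaps with disjoint remainders: each takes for [Z1] the vertices consumed so far. The term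
    [3 * r * c] is a common budget for all constructions. *)
Definition swappable (T : finType) (E : {set {set T}}) (X : {set T}) (c : nat)
    (Z : {set T}) (C : nat) (A B : {set {set T}}) :=
  forall Z1 : {set T}, Z \subset Z1 -> 3 * r * c + #|Z1| + C <= #|X| ->
  exists (Q : {set {set T}}) (Z2 : {set T}),
    [/\ Q \subset E, Z1 \subset Z2, #|Z2| <= #|Z1| + C, fresh Q Z1 Z2 &
        dec F (A :|: Q) /\ dec F (B :|: Q)].

Lemma swap_mono (T : finType) (E : {set {set T}}) X c Z C C' A B :
  C <= C' -> swappable E X c Z C A B -> swappable E X c Z C' A B.
Proof.
move=> CC h Z1 s1 hX; have [|Q [Z2 [h1 h2 h3 h4 h5]]] := h Z1 s1; first by lia.
by exists Q, Z2; split=> //; lia.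
Qed.

(** The swaps are performed successively. Freshness makes each remainder disjoint from the sets
    [A i], [B i], which lie in [Z], and from the earlier remainders. *)
Lemma swap_big (T : finType) (E : {set {set T}}) X c Z C (I : finType) (J : {set I})
    (A B : I -> {set {set T}}) :
  (forall i, i \in J -> swappable E X c Z C (A i) (B i)) ->
  (forall i, i \in J -> within (A i) Z) -> (forall i, i \in J -> within (B i) Z) ->
  (forall i j, i \in J -> j \in J -> i != j -> [disjoint A i & A j]) ->
  (forall i j, i \in J -> j \in J -> i != j -> [disjoint B i & B j]) ->
  swappable E X c Z (#|J| * C) (\bigcup_(i in J) A i) (\bigcup_(i in J) B i).
Proof.
have [n] := ubnP #|J|; elim: n J => // n IH J sJ sw wA wB dA dB.
case: (set_0Vmem J) => [->|[i iJ]].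
  move=> Z1 _ _; exists set0, Z1; rewrite !big_set0 sub0set subxx leq_addr setU0; split=> //.
    by move=> e; rewrite inE.
  by split; apply: dec0.
have J'J j : j \in J :\ i -> j \in J by rewrite inE => /andP [].
have cJ : #|J| = #|J :\ i|.+1 by rewrite (cardsD1 i) iJ.
move=> Z1 s1; rewrite cJ mulSn => hX.
have [|||||||Q1 [Z2 [q1 q2 q3 q4 [q5 q6]]]] := IH (J :\ i) _ _ _ _ _ _ Z1 s1.
- by rewrite -ltnS -cJ.
- by move=> j /J'J; apply: sw.
- by move=> j /J'J; apply: wA.
- by move=> j /J'J; apply: wB.
- by move=> j k /J'J jJ /J'J; apply: dA.
- by move=> j k /J'J jJ /J'J; apply: dB.
- by lia.
have s2 : Z \subset Z2 by apply: subset_trans q2.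
have [|Q2 [Z3 [p1 p2 p3 p4 [p5 p6]]]] := sw i iJ Z2 s2; first by lia.
exists (Q1 :|: Q2), Z3; split.
- by rewrite subUset q1.
- exact: subset_trans p2.
- by lia.
- exact: freshU p4.
have key (D : I -> {set {set T}}) : (forall j, j \in J -> within (D j) Z) ->
    (forall j k, j \in J -> k \in J -> j != k -> [disjoint D j & D k]) ->
    dec F ((\bigcup_(j in J :\ i) D j) :|: Q1) -> dec F (D i :|: Q2) ->
    dec F ((\bigcup_(j in J) D j) :|: (Q1 :|: Q2)).
  move=> wD dD h1 h2; rewrite (big_setD1 i) //= (setUC (D i)) setUACA; apply: decU => //.
  rewrite !disjointUl !disjointUr; apply/andP; split; apply/andP; split.
  - apply: disjoint_bigcupl => j; rewrite !inE => /andP [nj jJ]; exact: dD.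
  - apply: fresh_disj p4; apply: withinS s2 _.
    by move=> e /bigcupP [j /J'J jJ]; apply: wD.
  - rewrite disjoint_sym; apply: fresh_disj q4; apply: withinS s1 _; exact: wD.
  - apply: fresh_disj p4; exact: fresh_within q4.
by split; apply: key.
Qed.

Variables (u v : F).
Hypothesis rF : regular r F.
Hypothesis r0 : 0 < r.
Hypothesis uv : adj u v.

Lemma enum_inj_set (T : finType) (S : {set T}) : #|S| = r ->
  exists2 s : 'I_r -> T, injective s & s @: setT = S.
Proof.
move=> cS; exists (fun i => enum_val (cast_ord (esym cS) i)).
  by move=> i j /enum_val_inj /cast_ord_inj.
apply/setP => y; apply/imsetP/idP => [[i _ ->]|yS]; first exact: enum_valP.
by exists (cast_ord cS (enum_rank_in yS y)); rewrite // cast_ordK enum_rankK_in.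
Qed.

Lemma swap_spokes : exists C, forall (T : finType) (E : {set {set T}}) (X Z : {set T}) c
    (x x' : T) (S : {set T}),
  (forall t, #|X :\: nb E t| <= c) -> x \in Z -> x' \in Z -> S \subset Z ->
  x != x' -> x \notin S -> x' \notin S -> r %| #|S| ->
  swappable E X c Z (#|S| * C) (spokes x S) (spokes x' S).
Proof.
have [C hC] := mover rF r0 uv; exists C => T E X Z c x x' S hc xZ x'Z SZ nxx' xS x'S dv.
have [P [hP1 hP2]] := equal_partition r0 dv.
have PS A : A \in P -> A \subset S by move=> AP; rewrite -(cover_partition hP1) (bigcup_max A).
have eS y : spokes y S = \bigcup_(A in P) spokes y A.
  apply/setP => e; apply/imsetP/bigcupP => [[z zS ->]|[A AP /imsetP [z zA ->]]].
    have zc : z \in cover P by rewrite (cover_partition hP1).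
    by exists (pblock P z); [exact: pblock_mem|apply: imset_f; rewrite mem_pblock].
  by exists z => //; apply: (subsetP (PS A AP)).
have cP : #|P| <= #|S|.
  rewrite (card_partition hP1) -sum1_card; apply: leq_sum => A /hP2 ->; exact: r0.
rewrite !eS; apply: swap_mono (_ : #|P| * C <= _) _; first by rewrite leq_mul2r cP orbT.
have dis y : y \notin S -> forall A B, A \in P -> B \in P -> A != B ->
    [disjoint spokes y A & spokes y B].
  move=> yS A B AP BP nAB; apply: spokes_disj.
    by apply: contra yS; apply: (subsetP (PS B BP)).
  by have /and3P [_ /trivIsetP tP _] := hP1; rewrite tP ?orbT.
apply: swap_big.
- move=> A AP Z1 s1 hX; have [s si eA] := enum_inj_set (hP2 _ AP).
  have sS i : s i \in S by apply: (subsetP (PS A AP)); rewrite -eA imset_f.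
  rewrite -eA; apply: (hC T E X Z1 c x x' s) => //.
  + exact: (subsetP s1).
  + exact: (subsetP s1).
  + by move=> i; apply: (subsetP s1); apply: (subsetP SZ).
  + by move=> i; apply: contraNneq xS => <-.
  + by move=> i; apply: contraNneq x'S => <-.
  + by apply: leq_trans hX; rewrite !leq_add2r !leq_mul2r; lia.
- by move=> A AP; apply: within_spokes => //; apply: subset_trans SZ; apply: PS.
- by move=> A AP; apply: within_spokes => //; apply: subset_trans SZ; apply: PS.
- exact: dis.
- exact: dis.
Qed.

Lemma pick_many (T : finType) (E : {set {set T}}) (X Z : {set T}) c x a k :
  (forall t, #|X :\: nb E t| <= c) -> 2 * c + #|Z| + k <= #|X| ->
  exists S : {set T}, [/\ #|S| = k, [disjoint S & Z] &
    forall t, t \in S -> pr x t \in E /\ pr a t \in E].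
Proof.
move=> hc; elim: k => [|k IH] hX.
  exists set0; split; rewrite ?cards0 // ?disjoints_subset ?sub0set // => t.
  by rewrite inE.
have [|S [cS dS hS]] := IH; first by lia.
have [|t _||y [yX yZ yE]] := @pick_nb T E X (Z :|: S) [set x; a] 2 c.
- by rewrite cards2; case: (x != a).
- exact: hc.
- have := (leq_card_setU Z S).1; lia.
move: yZ; rewrite inE negb_or => /andP [yZ yS].
exists (y |: S); split.
- by rewrite cardsU1 yS cS.
- by rewrite disjointUl dS andbT -setI_eq0; apply/eqP/setP => z; rewrite !inE; case: eqVneq => // ->; rewrite (negbTE yZ).
- move=> t /setU1P [->|/hS //]; rewrite !(prC _ y).
  by rewrite !yE ?in_set2 ?eqxx ?orbT.
Qed.

Lemma spokesU1 (T : finType) (x y : T) (S : {set T}) :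
  spokes x (y |: S) = pr x y |: spokes x S.
Proof. by rewrite /spokes imsetU1. Qed.

Lemma switch_arith c z C n :
  3 * r * c + z + (r + 2 * (r * C)) <= n -> 2 * c + z + r.-1 <= n.
Proof.
move=> h; apply: leq_trans h.
have h : 2 * c <= 3 * r * c.
  by rewrite leq_mul2r; apply/orP; right; case: r r0 => // k _; rewrite mulnS.
rewrite -addnA -[_ + _ + (_ + _)]addnA leq_add // leq_add2l.
exact: leq_trans (leq_pred _) (leq_addr _ _).
Qed.

(* Move the spokes from x to y |: S over to a, and those from a to b |: S over to x. *)
Lemma swap_switch : exists C, forall (T : finType) (E : {set {set T}}) (X Z : {set T}) c
    (x y a b : T),
  (forall t, #|X :\: nb E t| <= c) -> x \in Z -> y \in Z -> a \in Z -> b \in Z ->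
  x != y -> x != a -> x != b -> y != a -> y != b -> a != b ->
  swappable E X c Z C [set pr x y; pr a b] [set pr x b; pr a y].
Proof.
have [C hC] := swap_spokes; exists (r + 2 * (r * C)).
move=> T E X Z c x y a b hc xZ yZ aZ bZ nxy nxa nxb nya nyb nab Z1 s1 hX.
(* With [r - 1] vertices in [S], the sets [y |: S] and [b |: S] have size [r] and can be moved as
   stars. *)
have [|S [cS dS hS]] := @pick_many T E X Z1 c x a r.-1 hc.
  exact: switch_arith hX.
have nS t : t \in Z -> t \notin S.
  by move=> /(subsetP s1) tZ; apply/negP => /(disjointFr dS); rewrite tZ.
pose Z2 := Z1 :|: S.
have cZ2 : #|Z2| = #|Z1| + r.-1.
  rewrite cardsU cS (_ : Z1 :&: S = set0) ?cards0 ?subn0 //.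
  by apply/eqP; rewrite setI_eq0 disjoint_sym.
have s2 : Z1 \subset Z2 by apply: subsetUl.
have SZ2 : S \subset Z2 by apply: subsetUr.
have ZZ2 : Z \subset Z2 by apply: subset_trans s2.
have cyS t : t \in Z -> #|t |: S| = r by move=> tZ; rewrite cardsU1 nS // cS add1n prednK.
have tS t s : t \in Z -> t != s -> t \notin s |: S.
  by move=> tZ nts; rewrite in_setU1 negb_or nts nS.
have sub t : t \in Z -> t |: S \subset Z2.
  by move=> tZ; rewrite subUset sub1set SZ2 (subsetP ZZ2).
have Z2P t : t \in Z -> t \in Z2 by apply: (subsetP ZZ2).
have sw1 : swappable E X c Z2 (r * C) (spokes x (y |: S)) (spokes a (y |: S)).
  have := hC T E X Z2 c x a (y |: S) hc (Z2P x xZ) (Z2P a aZ) (sub y yZ) nxa.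
  by rewrite (cyS y yZ); apply; rewrite ?tS // eq_sym.
have sw2 : swappable E X c Z2 (r * C) (spokes a (b |: S)) (spokes x (b |: S)).
  have := hC T E X Z2 c a x (b |: S) hc (Z2P a aZ) (Z2P x xZ) (sub b bZ).
  by rewrite (cyS b bZ); apply; rewrite ?tS // eq_sym.
have [|Q1 [Z3 [p1 p2 p3 p4 [p5 p6]]]] := sw1 Z2 (subxx _).
  by move: hX; rewrite cZ2; have := leq_pred r; move: (3 * r * c) (r * C) => p q; clear; lia.
have [|Q2 [Z4 [q1 q2 q3 q4 [q5 q6]]]] := sw2 Z3 p2.
  by move: hX p3; rewrite cZ2; have := leq_pred r; move: (3 * r * c) (r * C) => p q; clear; lia.
have ws t s : t \in Z -> s \in Z -> within (spokes t (s |: S)) Z2.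
  by move=> tZ sZ; apply: within_spokes; rewrite ?sub // (subsetP ZZ2).
have dec2 x1 a1 y1 b1 : x1 \in Z -> a1 \in Z -> y1 \in Z -> b1 \in Z ->
    x1 != a1 -> x1 != b1 ->
    dec F (spokes x1 (y1 |: S) :|: Q1) -> dec F (spokes a1 (b1 |: S) :|: Q2) ->
    dec F ((spokes x1 (y1 |: S) :|: Q1) :|: (spokes a1 (b1 |: S) :|: Q2)).
  move=> x1Z a1Z y1Z b1Z nxa1 nxb1 h1 h2; apply: decU => //.
  rewrite !disjointUl !disjointUr; apply/andP; split; apply/andP; split.
  - by apply: spokes_disj; rewrite ?nxa1 // tS.
  - by apply: fresh_disj q4; apply: withinS p2 _; apply: ws.
  - by rewrite disjoint_sym; apply: fresh_disj p4; apply: ws.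
  - by apply: fresh_disj q4; apply: fresh_within p4.
(* The spokes from [x] and [a] to [S] are present before and after the moves, hence belong to the
   remainder. *)
exists (spokes x S :|: spokes a S :|: (Q1 :|: Q2)), Z4; split.
- rewrite !subUset p1 q1 !andbT; apply/andP; split; apply/subsetP => e /imsetP [t tS' ->];
    by have [] := hS t tS'.
- by apply: subset_trans s2 (subset_trans p2 q2).
- by move: p3 q3; rewrite cZ2; have := leq_pred r; clear hX; move: (r * C) => q; clear; lia.
- apply: (freshU (Z1 := Z2)) => //; first exact: subset_trans q2.
    move=> e /setUP [] /imsetP [t tS' ->];
      rewrite !pr_sub !(subsetP SZ2 t tS') !(subsetP ZZ2) // negb_and;
      by rewrite (negbT (disjointFr dS tS')) orbT.
  exact: freshU q4.
- have e1 : [set pr x y; pr a b] :|: (spokes x S :|: spokes a S :|: (Q1 :|: Q2)) =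
      (spokes x (y |: S) :|: Q1) :|: (spokes a (b |: S) :|: Q2).
    rewrite !spokesU1; apply/setP => e; rewrite !inE.
    by case: (e == pr x y); case: (e == pr a b); case: (e \in spokes x S);
       case: (e \in spokes a S); case: (e \in Q1); case: (e \in Q2).
  have e2 : [set pr x b; pr a y] :|: (spokes x S :|: spokes a S :|: (Q1 :|: Q2)) =
      (spokes a (y |: S) :|: Q1) :|: (spokes x (b |: S) :|: Q2).
    rewrite !spokesU1; apply/setP => e; rewrite !inE.
    by case: (e == pr x b); case: (e == pr a y); case: (e \in spokes x S);
       case: (e \in spokes a S); case: (e \in Q1); case: (e \in Q2).
  by rewrite e1 e2; split; apply: dec2; rewrite // eq_sym.
Qed.

End Swaps.

(** * Turning a graph into a star *)

Section Connect.
Variables (F : sgraph) (r : nat) (u v : F).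
Hypothesis rF : regular r F.
Hypothesis r0 : 0 < r.
Hypothesis uv : adj u v.

Section Ends.
Variables (T I : finType) (x y a b : I -> T).
Hypothesis ai : injective a.
Hypothesis bi : injective b.
Hypothesis nab : forall i j, a i != b j.
Hypothesis nxy : forall i, x i != y i.
Hypothesis ei : injective (fun i => pr (x i) (y i)).

(** After the switch [x i] sees [b i] and [y i] sees [a i] instead of each other; these are the
    auxiliary neighbours acquired by [t]. *)
Definition ends (t : T) : {set T} :=
  [set b i | i in [set i | x i == t]] :|: [set a i | i in [set i | y i == t]].

(** Each edge at [t] contributes exactly one auxiliary neighbour. Hence the stars produced by the
    switch inherit divisibility by [r], which moving them to another centre requires. *)
Lemma card_ends t : #|ends t| = dg [set pr (x i) (y i) | i : I] t.
Proof.
pose J := [set i | t \in pr (x i) (y i)].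
have nyx i : (y i == x i) = false by rewrite eq_sym (negbTE (nxy i)).
have -> : ends t = [set (if x i == t then b i else a i) | i in J].
  apply/setP => w; rewrite inE; apply/orP/imsetP.
    case=> /imsetP [i]; rewrite inE => /eqP e ->; exists i;
      rewrite ?inE ?in_pr ?e ?eqxx ?orbT //.
    by rewrite -e (negbTE (nxy i)).
  move=> [i]; rewrite inE in_pr => h ->; case: (eqVneq (x i) t) h => [e _|ne].
    by left; apply/imsetP; exists i; rewrite ?inE ?e ?eqxx.
  move=> /= /eqP e.
  by right; apply/imsetP; exists i; rewrite ?inE -?e ?eqxx.
rewrite card_in_imset; last first.
  move=> i j _ _; case: eqP => _; case: eqP => _.
  - by apply: bi.
  - by move/esym => e; have := nab j i; rewrite e eqxx.
  - by move=> e; have := nab i j; rewrite e eqxx.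
  - by apply: ai.
rewrite /dg -[LHS](@card_in_imset _ _ (fun i => if x i == t then y i else x i)).
  congr #|pred_of_set _|; apply/setP => w; apply/imsetP/idP.
    move=> [i]; rewrite inE in_pr => h ->; rewrite in_nb; apply/imsetP; exists i => //.
    case: (eqVneq (x i) t) h => [<- _|ne]; first by [].
    by move=> /= /eqP ->; rewrite prC.
  rewrite in_nb => /imsetP [i _ /pr_eq [[e1 e2]|[e1 e2]]].
    by exists i; rewrite ?inE ?in_pr e1 ?eqxx.
  by exists i; rewrite ?inE ?in_pr e1 ?eqxx ?orbT // (negbTE (nxy i)).
move=> i j; rewrite !inE => hi hj e; apply: ei; move: hi hj e.
case: (eqVneq (x i) t) => [<-|ni] /=.
  by case: (eqVneq (x j) (x i)) => [-> _ _ ->|nj] //= _ /eqP -> ->; rewrite prC.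
move=> /eqP ->; case: (eqVneq (x j) (y i)) => [-> _ ->|nj] /=; first by rewrite prC.
by move=> /eqP -> ->.
Qed.

Lemma ends_sub (Z : {set T}) t : (forall i, a i \in Z) -> (forall i, b i \in Z) ->
  ends t \subset Z.
Proof. by move=> aZ bZ; apply/subsetP => w /setUP [] /imsetP [i _ ->]. Qed.

End Ends.

(** Two swaps are composed. [Q1] exchanges [x_i y_i], [a_i b_i] with [x_i b_i], [a_i y_i]; then [Q2]
    moves the star of auxiliary edges at every end [t] to [z]. The intermediate edges stand on both
    sides of the statement: on one side they are decomposed with [Q2], on the other with [Q1]. *)
Lemma swap_connect : forall m, exists C, forall (T : finType) (E : {set {set T}})
    (X Z : {set T}) c (I : finType) (x y a b : I -> T) (z : T),
  #|I| <= m ->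
  (forall t, #|X :\: nb E t| <= c) ->
  (forall i, x i \in Z) -> (forall i, y i \in Z) -> (forall i, a i \in Z) ->
  (forall i, b i \in Z) -> z \in Z ->
  injective a -> injective b -> (forall i j, a i != b j) -> (forall i, x i != y i) ->
  injective (fun i => pr (x i) (y i)) ->
  (forall i j, a i != x j) -> (forall i j, a i != y j) ->
  (forall i j, b i != x j) -> (forall i j, b i != y j) ->
  (forall i, z != x i) -> (forall i, z != y i) -> (forall i, z != a i) ->
  (forall i, z != b i) ->
  (forall t, r %| dg [set pr (x i) (y i) | i : I] t) ->
  swappable F r E X c Z C
    (([set pr (x i) (y i) | i : I] :|: [set pr (a i) (b i) | i : I]) :|:
      ([set pr (x i) (b i) | i : I] :|: [set pr (a i) (y i) | i : I]))
    (([set pr (x i) (b i) | i : I] :|: [set pr (a i) (y i) | i : I]) :|: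
      ([set pr z (b i) | i : I] :|: [set pr z (a i) | i : I])).
Proof.
have [C1 hC1] := swap_switch rF r0 uv; have [C2 hC2] := swap_spokes rF r0 uv.
move=> m; exists (m * C1 + (2 * m) * (2 * m * C2)).
move=> T E X Z c I x y a b z Im hc xZ yZ aZ bZ zZ ai bi nab nxy ei nax nay nbx nby
  nzx nzy nza nzb dv.
pose H := [set pr (x i) (y i) | i : I]; pose M := [set pr (a i) (b i) | i : I].
pose J1 := [set pr (x i) (b i) | i : I]; pose J2 := [set pr (a i) (y i) | i : I].
pose S1 := [set pr z (b i) | i : I]; pose S2 := [set pr z (a i) | i : I].
have pairU (p q : I -> {set T}) :
    \bigcup_(i in [set: I]) [set p i; q i] = [set p i | i : I] :|: [set q i | i : I].
  apply/setP => e; rewrite inE; apply/bigcupP/orP.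
    by move=> [i _]; rewrite !inE => /orP [/eqP ->|/eqP ->]; [left|right]; apply: imset_f.
  by case=> /imsetP [i _ ->]; exists i; rewrite ?inE ?eqxx ?orbT.
have sw1 : swappable F r E X c Z (m * C1) (H :|: M) (J1 :|: J2).
  rewrite /H /M /J1 /J2 -!pairU; apply: swap_mono (_ : #|[set: I]| * C1 <= _) _.
    by rewrite cardsT leq_mul2r Im orbT.
  apply: swap_big => //.
  - by move=> i _; apply: hC1; rewrite // 1?eq_sym.
  - by move=> i _ e; rewrite !inE => /orP [/eqP ->|/eqP ->]; rewrite pr_sub ?xZ ?yZ ?aZ ?bZ.
  - by move=> i _ e; rewrite !inE => /orP [/eqP ->|/eqP ->]; rewrite pr_sub ?xZ ?yZ ?aZ ?bZ.
  - move=> i j _ _ nij; rewrite -setI_eq0; apply/eqP/setP => e; rewrite !inE.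
    apply/negP => /andP [/orP [/eqP ->|/eqP ->] /orP [/eqP h|/eqP h]].
    + by move/ei: h nij => ->; rewrite eqxx.
    + case/pr_eq: h => [[h1 h2]|[h1 h2]]; first by have := nax j i; rewrite h1 eqxx.
      by have := nay j i; rewrite h2 eqxx.
    + case/pr_eq: h => [[h1 h2]|[h1 h2]]; first by have := nax i j; rewrite h1 eqxx.
      by have := nay i j; rewrite h1 eqxx.
    + case/pr_eq: h => [[/ai h1 h2]|[h1 h2]]; first by rewrite h1 eqxx in nij.
      by have := nab i j; rewrite h1 eqxx.
  - move=> i j _ _ nij; rewrite -setI_eq0; apply/eqP/setP => e; rewrite !inE.
    apply/negP => /andP [/orP [/eqP ->|/eqP ->] /orP [/eqP h|/eqP h]].
    + case/pr_eq: h => [[h1 /bi h2]|[h1 h2]]; first by rewrite h2 eqxx in nij.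
      by have := nbx j i; rewrite h1 eqxx.
    + case/pr_eq: h => [[h1 h2]|[h1 h2]]; first by have := nax j i; rewrite h1 eqxx.
      by have := nab j i; rewrite h2 eqxx.
    + case/pr_eq: h => [[h1 h2]|[h1 h2]]; first by have := nax i j; rewrite h1 eqxx.
      by have := nab i j; rewrite h1 eqxx.
    + case/pr_eq: h => [[/ai h1 h2]|[h1 h2]]; first by rewrite h1 eqxx in nij.
      by have := nay i j; rewrite h1 eqxx.
pose K := [set x i | i : I] :|: [set y i | i : I].
pose S t := ends x y a b t.
have SP t s : s \in S t -> exists i, (s = a i /\ t = y i) \/ (s = b i /\ t = x i).
  by case/setUP => /imsetP [i]; rewrite inE => /eqP <- ->; exists i; [right|left].
have SZ t : S t \subset Z by apply: ends_sub.
have spS (f : T -> T) : \bigcup_(t in K) spokes (f t) (S t) =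
    [set pr (f (x i)) (b i) | i : I] :|: [set pr (f (y i)) (a i) | i : I].
  apply/setP => e; rewrite inE; apply/bigcupP/orP.
    move=> [t _ /imsetP [s /SP [i [[-> ->]|[-> ->]]] ->]]; last by left; apply: imset_f.
    by right; apply: imset_f.
  case=> /imsetP [i _ ->].
    exists (x i); first by rewrite inE imset_f.
    by apply: imset_f; rewrite inE; apply/orP; left; apply: imset_f; rewrite inE.
  exists (y i); first by rewrite inE orbC imset_f.
  by apply: imset_f; rewrite inE; apply/orP; right; apply: imset_f; rewrite inE.
have J2e : [set pr (y i) (a i) | i : I] = J2.
  by apply: eq_imset => i; rewrite prC.
have Sdis t s : t != s -> [disjoint S t & S s].
  move=> nts; rewrite -setI_eq0; apply/eqP/setP => w; rewrite in_setI in_set0.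
  apply/negP => /andP [/SP [i [[-> et]|[-> et]]] /SP [j [[h es]|[h es]]]].
  - by move/ai: h => h; rewrite et es h eqxx in nts.
  - by have := nab i j; rewrite h eqxx.
  - by have := nab j i; rewrite h eqxx.
  - by move/bi: h => h; rewrite et es h eqxx in nts.
have zS t : z \notin S t.
  by apply/negP => /SP [i [[h _]|[h _]]]; [have := nza i|have := nzb i]; rewrite h eqxx.
have KS t s : t \in K -> t \notin S s.
  case/setUP => /imsetP [i _ ->]; apply/negP => /SP [j [[h _]|[h _]]].
  - by have := nax j i; rewrite h eqxx.
  - by have := nbx j i; rewrite h eqxx.
  - by have := nay j i; rewrite h eqxx.
  - by have := nby j i; rewrite h eqxx.
have KZ t : t \in K -> t \in Z by case/setUP => /imsetP [i _ ->].
have cK : #|K| <= 2 * m.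
  apply: leq_trans (leq_card_setU _ _) _; rewrite mul2n -addnn.
  by apply: leq_add; apply: leq_trans (leq_imset_card _ _) Im.
have cS t : #|S t| <= 2 * m.
  apply: leq_trans (leq_card_setU _ _) _; rewrite mul2n -addnn.
  by apply: leq_add; apply: leq_trans (leq_imset_card _ _) (leq_trans (max_card _) Im).
have sw2 : swappable F r E X c Z ((2 * m) * (2 * m * C2)) (J1 :|: J2) (S1 :|: S2).
  rewrite -J2e -(spS id) -(spS (fun=> z)).
  apply: swap_mono (_ : #|K| * (2 * m * C2) <= _) _; first by rewrite leq_mul2r cK orbT.
  apply: swap_big.
  - move=> t tK; apply: swap_mono (_ : #|S t| * C2 <= _) _; first by rewrite leq_mul2r cS orbT.
    apply: hC2 => //; rewrite ?KS ?KZ //.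
      by case/setUP: tK => /imsetP [i _ ->]; rewrite eq_sym.
    by rewrite card_ends.
  - by move=> t tK; apply: within_spokes => //; apply: KZ.
  - by move=> t tK; apply: within_spokes.
  - by move=> t s tK sK nts; apply: spokes_disj; rewrite ?nts // KS.
  - by move=> t s tK sK nts; apply: spokes_disj; rewrite ?Sdis ?orbT // zS.
move=> Z1 s1 hX.
have [|Q1 [Z2 [p1 p2 p3 p4 [p5 p6]]]] := sw1 Z1 s1; first by lia.
have [|Q2 [Z3 [q1 q2 q3 q4 [q5 q6]]]] := sw2 Z2 (subset_trans s1 p2); first by lia.
have wH : within H Z by move=> e /imsetP [i _ ->]; rewrite pr_sub xZ yZ.
have wM : within M Z by move=> e /imsetP [i _ ->]; rewrite pr_sub aZ bZ.
have wJ1 : within J1 Z by move=> e /imsetP [i _ ->]; rewrite pr_sub xZ bZ.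
have wJ2 : within J2 Z by move=> e /imsetP [i _ ->]; rewrite pr_sub aZ yZ.
have wS1 : within S1 Z by move=> e /imsetP [i _ ->]; rewrite pr_sub zZ bZ.
have wS2 : within S2 Z by move=> e /imsetP [i _ ->]; rewrite pr_sub zZ aZ.
exists (Q1 :|: Q2), Z3; split.
- by rewrite subUset p1.
- exact: subset_trans q2.
- by lia.
- exact: freshU q4.
have key (A B : {set {set T}}) : within A Z -> within B Z -> [disjoint A & B] ->
    dec F (A :|: Q1) -> dec F (B :|: Q2) -> dec F ((A :|: B) :|: (Q1 :|: Q2)).
  move=> wA wB dAB h1 h2; rewrite setUACA; apply: decU => //.
  rewrite !disjointUl !disjointUr dAB /=; apply/and3P; split.
  - by apply: fresh_disj q4; apply: withinS wA; apply: subset_trans p2.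
  - by rewrite disjoint_sym; apply: fresh_disj p4; apply: withinS wB.
  - by apply: fresh_disj q4; apply: fresh_within p4.
have dis (A B : {set {set T}}) : (forall e, e \in A -> e \in B -> False) -> [disjoint A & B].
  move=> h; rewrite -setI_eq0; apply/eqP/setP => e; rewrite in_setI in_set0.
  by apply/negP => /andP [/h].
split.
  apply: key => //; try exact: withinU; apply: dis => e.
  case/setUP => /imsetP [i _ ->] /setUP [] /imsetP [j _] /pr_eq [[h1 h2]|[h1 h2]].
  - by have := nby j i; rewrite h2 eqxx.
  - by have := nbx j i; rewrite h1 eqxx.
  - by have := nax j i; rewrite h1 eqxx.
  - by have := nay j i; rewrite -h2 eqxx.
  - by have := nax i j; rewrite h1 eqxx.
  - by have := nab i j; rewrite h1 eqxx.
  - by have := nby i j; rewrite h2 eqxx.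
  - by have := nay i j; rewrite h1 eqxx.
apply: key => //; try exact: withinU; apply: dis => e.
case/setUP => /imsetP [i _ ->] /setUP [] /imsetP [j _] /pr_eq [[h1 h2]|[h1 h2]].
- by have := nzx i; rewrite h1 eqxx.
- by have := nbx j i; rewrite h1 eqxx.
- by have := nzx i; rewrite h1 eqxx.
- by have := nax j i; rewrite h1 eqxx.
- by have := nza i; rewrite h1 eqxx.
- by have := nab i j; rewrite h1 eqxx.
- by have := nza i; rewrite h1 eqxx.
- by have := nzy i; rewrite h2 eqxx.
Qed.

End Connect.

(** The most constrained choice is [b i], which has to see [z], [x i] and [a i]; this gives
    [3 * c]. *)
Lemma pick_pairs (T I : finType) (E : {set {set T}}) (X Z : {set T}) c
    (x y : I -> T) (z : T) (J : {set I}) :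
  (forall t, #|X :\: nb E t| <= c) -> 3 * c + #|Z| + 2 * #|J| <= #|X| ->
  exists (a b : I -> T) (Z' : {set T}),
    [/\ Z \subset Z', #|Z'| <= #|Z| + 2 * #|J|,
     forall i, i \in J -> [/\ a i \in Z' :\: Z, b i \in Z' :\: Z &
       [/\ pr (a i) z \in E, pr (a i) (y i) \in E, pr (b i) z \in E, pr (b i) (x i) \in E &
           pr (b i) (a i) \in E]] &
     [/\ {in J &, injective a}, {in J &, injective b} &
         {in J &, forall i j, a i != b j}]].
Proof.
move=> hc; have [n] := ubnP #|J|; elim: n J => // n IH J sJ hX.
case: (set_0Vmem J) => [->|[i0 iJ]].
  exists (fun=> z), (fun=> z), Z; rewrite subxx leq_addr; split=> //.
    by move=> i; rewrite inE.
  by split=> [i j|i j|i j]; rewrite inE.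
have cJ : #|J| = #|J :\ i0|.+1 by rewrite (cardsD1 i0) iJ.
have [||a [b [Z1 [ZZ1 cZ1 h1 [h2 h3 h4]]]]] := IH (J :\ i0).
- by rewrite -ltnS -cJ.
- by rewrite cJ in hX; lia.
have [|t _||a0 [a0X a0Z a0E]] := @pick_nb T E X Z1 [set z; y i0] 3 c.
- by rewrite cards2; case: (z != _).
- exact: hc.
- by rewrite cJ in hX; lia.
have [|t _||b0 [b0X b0Z b0E]] := @pick_nb T E X (a0 |: Z1) [set z; x i0; a0] 3 c.
- by apply: leq_trans (leq_card_setU _ _) _; rewrite cards1 cards2; case: (z != _).
- exact: hc.
- by rewrite cardsU1 a0Z; rewrite cJ in hX; lia.
move: b0Z; rewrite in_setU1 negb_or => /andP [nb0 b0Z].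
have Jc i : i \in J -> i = i0 \/ i \in J :\ i0.
  by move=> h; case: (eqVneq i i0) => [|ni]; [left|right; rewrite !inE ni].
pose a' i := if i == i0 then a0 else a i; pose b' i := if i == i0 then b0 else b i.
have a'0 : a' i0 = a0 by rewrite /a' eqxx.
have b'0 : b' i0 = b0 by rewrite /b' eqxx.
have a'J i : i \in J :\ i0 -> a' i = a i by rewrite /a' !inE => /andP [/negbTE ->].
have b'J i : i \in J :\ i0 -> b' i = b i by rewrite /b' !inE => /andP [/negbTE ->].
have aZ1 i : i \in J :\ i0 -> a i \in Z1 by case/h1; rewrite inE => /andP [].
have bZ1 i : i \in J :\ i0 -> b i \in Z1 by case/h1 => _; rewrite inE => /andP [].
have nZ t : t \notin Z1 -> t \notin Z by apply: contra; apply: (subsetP ZZ1).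
exists a', b', (b0 |: (a0 |: Z1)); split.
- by apply: subset_trans ZZ1 _; apply/subsetP => t h; rewrite !inE h !orbT.
- by rewrite !cardsU1 in_setU1 negb_or nb0 a0Z b0Z /=; rewrite cJ; lia.
- move=> i /Jc [->|iJ']; last first.
    rewrite a'J // b'J //; have [p1 p2 p3] := h1 i iJ'; split=> //.
      by move: p1; rewrite !inE => /andP [-> ->]; rewrite !orbT.
    by move: p2; rewrite !inE => /andP [-> ->]; rewrite !orbT.
  rewrite a'0 b'0; split; [| |split].
  + by rewrite !inE eqxx (nZ _ a0Z) !orbT.
  + by rewrite !inE eqxx (nZ _ b0Z).
  + by apply: a0E; rewrite !inE eqxx.
  + by apply: a0E; rewrite !inE eqxx orbT.
  + by apply: b0E; rewrite !inE eqxx.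
  + by apply: b0E; rewrite !inE eqxx orbT.
  + by apply: b0E; rewrite !inE eqxx orbT.
- split.
  + move=> i j /Jc [->|iJ'] /Jc [->|jJ'] //; rewrite ?a'0 ?a'J //; last exact: h2.
      by move=> e; move: a0Z; rewrite e aZ1.
    by move=> e; move: a0Z; rewrite -e aZ1.
  + move=> i j /Jc [->|iJ'] /Jc [->|jJ'] //; rewrite ?b'0 ?b'J //; last exact: h3.
      by move=> e; move: b0Z; rewrite e bZ1.
    by move=> e; move: b0Z; rewrite -e bZ1.
  + move=> i j /Jc [->|iJ'] /Jc [->|jJ']; rewrite ?a'0 ?b'0 ?a'J ?b'J //.
    * by rewrite eq_sym.
    * by apply: contraNneq a0Z => ->; apply: bZ1.
    * by apply: contraNneq b0Z => <-; apply: aZ1.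
    * exact: h4.
Qed.

(** * The absorber of a single graph *)

Section Absorber.
Variables (F : sgraph) (r : nat) (u v : F).
Hypothesis rF : regular r F.
Hypothesis r0 : 0 < r.
Hypothesis uv : adj u v.

(** Provides the reference graph of an absorber, whose vertices must also see the auxiliary vertices
    listed in [ex]: at most [r] constraints come from the own copy and [r] from [ex]. *)
Lemma pick_copies (T I : finType) (t0 : T) (E : {set {set T}}) (X Z : {set T}) c
    (ex : I -> F -> {set T}) (J : {set I}) :
  (forall t, #|X :\: nb E t| <= c) -> (forall i w, #|ex i w| <= r) ->
  2 * r * c + #|Z| + #|J| * #|F| <= #|X| ->
  exists (f : I -> F -> T) (Z' : {set T}),
    [/\ Z \subset Z', #|Z'| <= #|Z| + #|J| * #|F|,
     forall i, i \in J -> [/\ injective (f i), forall w, f i w \in Z' :\: Z,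
       img (f i) \subset E & forall w t, t \in ex i w -> pr (f i w) t \in E] &
     forall i j w w', i \in J -> j \in J -> f i w = f j w' -> i = j /\ w = w'].
Proof.
move=> hc hex; have [n] := ubnP #|J|; elim: n J => // n IH J sJ hX.
case: (set_0Vmem J) => [->|[i0 iJ]].
  exists (fun _ _ => t0), Z; rewrite subxx leq_addr; split=> //.
    by move=> i; rewrite inE.
  by move=> i j w w'; rewrite inE.
have cJ : #|J| = #|J :\ i0|.+1 by rewrite (cardsD1 i0) iJ.
have [||f [Z1 [ZZ1 cZ1 h1 h2]]] := IH (J :\ i0).
- by rewrite -ltnS -cJ.
- by rewrite cJ mulSn in hX; lia.
have [||||||h [hi _ hX' hE hh]] :=
  @ext_copy F r rF T E set0 (fun=> t0) (ex i0) X Z1 r c.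
- by move=> x y; rewrite inE.
- by move=> w _.
- by move=> x w; rewrite inE.
- by [].
- by [].
- by rewrite cJ mulSn in hX; rewrite addnn -mul2n; lia.
have hX2 w : h w \in X /\ h w \notin Z1.
  by have := hX' w; rewrite !inE => /(_ isT) /andP [].
pose f' i := if i == i0 then h else f i.
have f'0 : f' i0 = h by rewrite /f' eqxx.
have f'J i : i \in J :\ i0 -> f' i = f i by rewrite /f' !inE => /andP [/negbTE ->].
have Jc i : i \in J -> i = i0 \/ i \in J :\ i0.
  by move=> h'; case: (eqVneq i i0) => [|ni]; [left|right; rewrite !inE ni].
have fZ1 i w : i \in J :\ i0 -> f i w \in Z1.
  by case/h1 => _ /(_ w); rewrite inE => /andP [].
exists f', (Z1 :|: h @: setT); split.
- by apply: subset_trans ZZ1 (subsetUl _ _).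
- apply: leq_trans (leq_card_setU _ _) _; rewrite cJ mulSn.
  have := leq_imset_card h setT; rewrite cardsT; lia.
- move=> i /Jc [->|iJ']; last first.
    rewrite f'J //; have [p1 p2 p3 p4] := h1 i iJ'; split=> // w.
    by have := p2 w; rewrite !inE => /andP [-> ->].
  rewrite f'0; split=> //.
  + move=> w; have [q1 q2] := hX2 w; rewrite inE in_setU imset_f // orbT andbT.
    by apply: contra q2; apply: (subsetP ZZ1).
  + by apply: subset_trans hE; apply/subsetP => e /imgP [x [y [a ->]]]; apply/newEP;
      exists x, y; rewrite inE.
  + by move=> w t; apply: hh; rewrite inE.
- move=> i j w w' /Jc [->|iJ'] /Jc [->|jJ']; rewrite ?f'0 ?f'J //.
  + by move=> /hi ->.
  + by move=> e; have [_] := hX2 w; rewrite e fZ1.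
  + by move=> e; have [_] := hX2 w'; rewrite -e fZ1.
  + by have J'J k : k \in J :\ i0 -> k \in J :\ i0 by []; apply: h2.
Qed.

Lemma edge_ends (S : finType) (I : finType) (e : I -> {set S}) :
  (forall i, #|e i| = 2) ->
  exists p q : I -> S, forall i, p i != q i /\ e i = pr (p i) (q i).
Proof.
move=> h.
have : forall i, exists pq : S * S, pq.1 != pq.2 /\ e i = pr pq.1 pq.2.
  by move=> i; have /eqP/cards2P [x [y [n ->]]] := h i; exists (x, y).
case/fin_all_exists => pq hpq; exists (fun i => (pq i).1), (fun i => (pq i).2).
exact: hpq.
Qed.

Lemma enum_set (S I : finType) (A : {set S}) : #|I| = #|A| ->
  exists2 e : I -> S, injective e & [set e i | i : I] = A.
Proof.
move=> cI; exists (fun i => enum_val (cast_ord cI (enum_rank i))).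
  by move=> i j /enum_val_inj /cast_ord_inj /enum_rank_inj.
apply/setP => y; apply/imsetP/idP => [[i _ ->]|yS]; first exact: enum_valP.
exists (enum_val (cast_ord (esym cI) (enum_rank_in yS y))) => //.
by rewrite enum_valK cast_ordKV enum_rankK_in.
Qed.

(* The edges x_i y_i of H, with auxiliary edges a_i b_i, are switched to x_i b_i, a_i y_i,
   and these stars are moved to a common centre z. The result does not depend on H, hence
   connects H to a disjoint union of copies of F with as many edges. *)
Lemma absorber : forall h, exists C, forall (T : finType) (E : {set {set T}})
    (X Z : {set T}) c (H : {set {set T}}),
  (forall t, #|X :\: nb E t| <= c) -> simple H -> within H Z -> #|H| = h ->
  #|edges F| %| h -> (forall t, r %| dg H t) -> 3 * r * c + #|Z| + C <= #|X| ->
  exists (A : {set {set T}}) (Z' : {set T}),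
    [/\ A \subset E, Z \subset Z', #|Z'| <= #|Z| + C, fresh A Z Z' &
        dec F A /\ dec F (H :|: A)].
Proof.
move=> h; have [C1 hC1] := swap_connect rF r0 uv h.
pose m := #|edges F|; pose k := h %/ m.
exists (1 + 2 * h + k * #|F| + (C1 + C1)).
move=> T E X Z c H hc sH wH cH dvH dgH hX.
have rc2 : 2 * c <= 3 * r * c by rewrite leq_mul2r; apply/orP; right; clear -r0; lia.
have rc3 : 3 * c <= 3 * r * c by rewrite leq_mul2r; apply/orP; right; clear -r0; lia.
have rc4 : 2 * r * c <= 3 * r * c by rewrite leq_mul2r; apply/orP; right; clear; lia.
have ekm : k * m = h by rewrite divnK.
set R3 := 3 * r * c in hX rc2 rc3 rc4.
(* An index set shared by the edges of [H] and those of [k] copies of [F]; divisibility of [h] by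
   [m] makes the two numbers equal. *)
pose I := ('I_k * 'I_m)%type.
have cI : #|{: I}| = h by rewrite card_prod !card_ord.
have [z [zX zZ _]] : exists z, [/\ z \in X, z \notin Z & forall t, t \in set0 -> pr z t \in E].
  apply: (pick_nb (k := 0) (c := c)); first by rewrite cards0.
    by move=> t; rewrite inE.
  by move: hX; clear; lia.
have [eF eFi eFF] := enum_set (S := {set F}) (I := 'I_m) (A := edges F) (card_ord _).
have eFe l : eF l \in edges F by rewrite -eFF imset_f.
have [p [q pq]] := edge_ends (fun l => simple_edges (eFe l)).
have apq l : adj (p l) (q l) by rewrite -in_edges -(pq l).2.
have [eH eHi eHH] := enum_set (S := {set T}) (I := I) (A := H) (etrans cI (esym cH)).
have eHe i : eH i \in H by rewrite -eHH imset_f.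
have [x [y xy]] := edge_ends (fun i => sH _ (eHe i)).
have xyH i : pr (x i) (y i) \in H by rewrite -(xy i).2.
have [xZ yZ] : (forall i, x i \in Z) /\ (forall i, y i \in Z).
  by split=> i; have := wH _ (xyH i); rewrite pr_sub => /andP [].
have cZ0 : #|z |: Z| = #|Z| + 1 by rewrite cardsU1 zZ addnC.
have [|a [b [Z1 [ZZ1 cZ1 hab [ai bi nab]]]]] :=
    @pick_pairs T I E X (z |: Z) c x y z setT hc.
  by rewrite cZ0 cardsT cI; move: hX rc3; clear; lia.
rewrite cZ0 cardsT cI in cZ1.
have {}ai : injective a by move=> i j; apply: ai; rewrite inE.
have {}bi : injective b by move=> i j; apply: bi; rewrite inE.
have {}nab i j : a i != b j by apply: nab; rewrite inE.
have aZ i : a i \in Z1 /\ a i \notin z |: Z.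
  by have [+ _ _] := hab i (in_setT _); rewrite inE => /andP [].
have bZ i : b i \in Z1 /\ b i \notin z |: Z.
  by have [_ + _] := hab i (in_setT _); rewrite inE => /andP [].
(* In the later switch the first end of the edge [l] in copy [j] is joined to [b (j, l)] and the
   second to [a (j, l)]. A vertex of [F] lies on at most [r] edges, which bounds [ex]. *)
pose ex j w := [set (if p l == w then b (j, l) else a (j, l)) | l in [set l | w \in eF l]].
have cex w : #|[set l | w \in eF l]| <= r.
  rewrite -(rF w) /degree -(@card_in_imset _ _ (fun l => if p l == w then q l else p l)).
    apply/subset_leq_card/subsetP => w' /imsetP [l]; rewrite inE (pq l).2 in_pr => hl ->.
    case: (eqVneq (p l) w) hl => [<- _|nl] /=; first by rewrite inE.
    by move=> /eqP ->; rewrite inE adj_sym.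
  move=> l l'; rewrite !inE => hl hl' e; apply: eFi; move: hl hl' e.
  rewrite (pq l).2 (pq l').2 !in_pr.
  case: (eqVneq (p l) w) => [<-|nl] /=.
    by case: (eqVneq (p l') (p l)) => [-> _ _ ->|nj] //= _ /eqP -> ->; rewrite prC.
  move=> /eqP ->; case: (eqVneq (p l') (q l)) => [-> _ ->|nj] /=; first by rewrite prC.
  by move=> /eqP -> ->.
have [||f [Z2 [Z1Z2 cZ2 hf finj]]] :=
    @pick_copies T 'I_k z E X Z1 c ex setT hc.
- by move=> j w; apply: leq_trans (leq_imset_card _ _) _.
- by rewrite cardsT card_ord; move: hX rc4 cZ1; clear; lia.
rewrite cardsT card_ord in cZ2.
have fZ j w : f j w \in Z2 /\ f j w \notin Z1.
  by have [_ /(_ w) + _ _] := hf j (in_setT _); rewrite inE => /andP [].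
have zZ1 : z \in Z1 by apply: (subsetP ZZ1); rewrite !inE eqxx.
have ZZ1' : Z \subset Z1 by apply: subset_trans ZZ1; apply: subsetUr.
have ZZ2 : Z \subset Z2 by apply: subset_trans Z1Z2.
pose x' (i : I) := f i.1 (p i.2); pose y' (i : I) := f i.1 (q i.2).
pose K := [set pr (x' i) (y' i) | i : I].
have eK : K = \bigcup_(j in [set: 'I_k]) img (f j).
  apply/setP => e; apply/imsetP/bigcupP => [[[j l] _ ->]|[j _ /imgP [w [w' [aww ->]]]]].
    by exists j; rewrite ?inE //; apply: mem_img; apply: apq.
  have : pr w w' \in edges F by rewrite in_edges.
  rewrite -eFF => /imsetP [l _ el]; exists (j, l) => //=.
  by rewrite /x' /y' -!imset_pr el (pq l).2.
have decK : dec F K.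
  rewrite eK; apply: dec_bigcup => [j _|i j _ _ nij].
    by have [fi _ _ _] := hf j (in_setT _); apply: dec_img => //; apply: (edges_gt0 u rF r0).
  rewrite -setI_eq0; apply/eqP/setP => e; rewrite in_setI in_set0; apply/negP.
  move=> /andP [/imgP [w [w' [_ ->]]] /imgP [w1 [w1' [_ ]]]].
  case/pr_eq => [[/finj e1 _]|[/finj e1 _]].
    by have [] := e1 (in_setT _) (in_setT _) => e2; rewrite e2 eqxx in nij.
  by have [] := e1 (in_setT _) (in_setT _) => e2; rewrite e2 eqxx in nij.
have pqn i : x' i != y' i.
  have [fi _ _ _] := hf i.1 (in_setT _).
  by rewrite /x' /y' (inj_eq fi) (pq i.2).1.
have x'yi : injective (fun i => pr (x' i) (y' i)).
  move=> [j l] [j' l'] /=; rewrite /x' /y' /= => e.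
  have ej : j = j'.
    by case/pr_eq: e => [[/finj e1 _]|[/finj e1 _]]; have [] := e1 (in_setT _) (in_setT _).
  have [fi _ _ _] := hf j (in_setT _).
  rewrite -ej in e *; congr pair; apply: eFi; rewrite (pq l).2 (pq l').2.
  by move: e; rewrite -!imset_pr; apply: imset_inj.
have nZf t j w : t \in Z1 -> t != f j w.
  by move=> tZ; have [_] := fZ j w; apply: contraNneq => <-.
have aZ2 i : a i \in Z2 by apply: (subsetP Z1Z2); have [] := aZ i.
have bZ2 i : b i \in Z2 by apply: (subsetP Z1Z2); have [] := bZ i.
have zZ2 : z \in Z2 by apply: (subsetP Z1Z2).
have aNZ i t : t \in Z -> a i != t.
  by move=> tZ; have [_] := aZ i; apply: contraNneq => ->; rewrite in_setU1 tZ orbT.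
have bNZ i t : t \in Z -> b i != t.
  by move=> tZ; have [_] := bZ i; apply: contraNneq => ->; rewrite in_setU1 tZ orbT.
have zNa i : z != a i.
  by have [_] := aZ i; apply: contraNneq => <-; rewrite in_setU1 eqxx.
have zNb i : z != b i.
  by have [_] := bZ i; apply: contraNneq => <-; rewrite in_setU1 eqxx.
have zNZ t : t \in Z -> z != t by move=> tZ; apply: contraNneq zZ => ->.
pose M := [set pr (a i) (b i) | i : I].
pose S1 := [set pr z (b i) | i : I]; pose S2 := [set pr z (a i) | i : I].
pose J1 := [set pr (x i) (b i) | i : I]; pose J2 := [set pr (a i) (y i) | i : I].
pose L1 := [set pr (x' i) (b i) | i : I]; pose L2 := [set pr (a i) (y' i) | i : I].
have eHxy : [set pr (x i) (y i) | i : I] = H.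
  by rewrite -eHH; apply: eq_imset => i; rewrite (xy i).2.
have sw1 : swappable F r E X c Z2 C1 ((H :|: M) :|: (J1 :|: J2)) ((J1 :|: J2) :|: (S1 :|: S2)).
  rewrite -eHxy; apply: hC1 => //.
  - by rewrite cI.
  - by move=> i; apply: (subsetP ZZ2).
  - by move=> i; apply: (subsetP ZZ2).
  - by move=> i; case: (xy i).
  - by move=> i j; rewrite -(xy i).2 -(xy j).2; apply: eHi.
  - by move=> i j; apply: aNZ.
  - by move=> i j; apply: aNZ.
  - by move=> i j; apply: bNZ.
  - by move=> i j; apply: bNZ.
  - by move=> i; apply: zNZ.
  - by move=> i; apply: zNZ.
  - by move=> t; rewrite eHxy.
have [|Q1 [Z3 [q1 q2 q3 q4 [q5 q6]]]] := sw1 Z2 (subxx _).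
  by rewrite -/R3; move: hX cZ1 cZ2; clear; lia.
have Z23 : Z2 \subset Z3 := q2.
have sw2 : swappable F r E X c Z3 C1 ((K :|: M) :|: (L1 :|: L2)) ((L1 :|: L2) :|: (S1 :|: S2)).
  apply: hC1 => //.
  - by rewrite cI.
  - by move=> i; apply: (subsetP Z23); have [] := fZ i.1 (p i.2).
  - by move=> i; apply: (subsetP Z23); have [] := fZ i.1 (q i.2).
  - by move=> i; apply: (subsetP Z23).
  - by move=> i; apply: (subsetP Z23).
  - by apply: (subsetP Z23).
  - by move=> i j; apply: nZf; have [] := aZ i.
  - by move=> i j; apply: nZf; have [] := aZ i.
  - by move=> i j; apply: nZf; have [] := bZ i.
  - by move=> i j; apply: nZf; have [] := bZ i.
  - by move=> i; apply: nZf.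
  - by move=> i; apply: nZf.
  - by move=> t; apply: (dec_dg t rF decK).
have [|Q2 [Z4 [p1 p2 p3 p4 [p5 p6]]]] := sw2 Z3 (subxx _).
  by rewrite -/R3; move: hX cZ1 cZ2 q3; clear; lia.
(* Edges are sorted by the kinds of their two ends; [ty] records these kinds. *)
pose wt t := if t \in Z then 1 else if t == z then 8
  else if t \in [set a i | i : I] then 64 else if t \in [set b i | i : I] then 512 else 4096.
pose ty (e : {set T}) := \sum_(t in e) wt t.
have typ s t : s != t -> ty (pr s t) = wt s + wt t.
  by move=> nst; rewrite /ty /pr big_setU1 ?big_set1 // inE.
have wtx t : t \in Z -> wt t = 1 by rewrite /wt => ->.
have wtz : wt z = 8 by rewrite /wt (negbTE zZ) eqxx.
have wta i : wt (a i) = 64.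
  have [_] := aZ i; rewrite /wt in_setU1 negb_or => /andP [/negbTE -> /negbTE ->].
  by rewrite imset_f.
have wtb i : wt (b i) = 512.
  have [_] := bZ i; rewrite /wt in_setU1 negb_or => /andP [/negbTE -> /negbTE ->].
  rewrite imset_f // ifF //; apply/imsetP => -[j _ e].
  by have := nab j i; rewrite e eqxx.
have wtf j w : wt (f j w) = 4096.
  have [_ h1] := fZ j w; rewrite /wt.
  have h2 t : t \in Z1 -> (f j w == t) = false.
    by move=> tZ; apply: contraNF h1 => /eqP ->.
  rewrite (negbTE (contra (subsetP ZZ1' _) h1)) (h2 z) //.
  by rewrite !ifF //; apply/imsetP => -[i _ e];
    [have := h2 (b i)|have := h2 (a i)]; rewrite e eqxx => h3;
    have //: false; rewrite -h3 //; [have [] := bZ i|have [] := aZ i].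
have tyH e : e \in H -> ty e = 2.
  by rewrite -eHxy => /imsetP [i _ ->]; rewrite typ ?(xy i).1 // !wtx.
have tyM e : e \in M -> ty e = 576 by case/imsetP => i _ ->; rewrite typ // wta wtb.
have tyS1 e : e \in S1 -> ty e = 520 by case/imsetP => i _ ->; rewrite typ // wtz wtb.
have tyS2 e : e \in S2 -> ty e = 72 by case/imsetP => i _ ->; rewrite typ // wtz wta.
have tyJ1 e : e \in J1 -> ty e = 513.
  by case/imsetP => i _ ->; rewrite typ ?wtb ?wtx // eq_sym bNZ.
have tyJ2 e : e \in J2 -> ty e = 65.
  by case/imsetP => i _ ->; rewrite typ ?wta ?wtx // aNZ.
have tyL1 e : e \in L1 -> ty e = 4608.
  by case/imsetP => i _ ->; rewrite typ ?wtb ?wtf // eq_sym nZf //; have [] := bZ i.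
have tyL2 e : e \in L2 -> ty e = 4160.
  by case/imsetP => i _ ->; rewrite typ ?wta ?wtf // nZf //; have [] := aZ i.
have tyK e : e \in K -> ty e = 8192.
  by case/imsetP => i _ ->; rewrite typ // !wtf.
have tdis (A B : {set {set T}}) n1 n2 : (forall e, e \in A -> ty e = n1) ->
    (forall e, e \in B -> ty e = n2) -> n1 != n2 -> [disjoint A & B].
  move=> hA hB nn; rewrite -setI_eq0; apply/eqP/setP => e; rewrite in_setI in_set0.
  by apply/negP => /andP [/hA h1 /hB h2]; rewrite -h1 -h2 eqxx in nn.
have fZ2 j w : f j w \in Z2 by have [] := fZ j w.
have wH2 : within H Z2 by apply: withinS wH.
have wM : within M Z2 by move=> e /imsetP [i _ ->]; rewrite pr_sub aZ2 bZ2.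
have wS1 : within S1 Z2 by move=> e /imsetP [i _ ->]; rewrite pr_sub zZ2 bZ2.
have wS2 : within S2 Z2 by move=> e /imsetP [i _ ->]; rewrite pr_sub zZ2 aZ2.
have wJ1 : within J1 Z2 by move=> e /imsetP [i _ ->]; rewrite pr_sub bZ2 (subsetP ZZ2).
have wJ2 : within J2 Z2 by move=> e /imsetP [i _ ->]; rewrite pr_sub aZ2 (subsetP ZZ2).
have wL1 : within L1 Z2 by move=> e /imsetP [i _ ->]; rewrite pr_sub bZ2 fZ2.
have wL2 : within L2 Z2 by move=> e /imsetP [i _ ->]; rewrite pr_sub aZ2 fZ2.
have wK : within K Z2 by move=> e /imsetP [i _ ->]; rewrite pr_sub !fZ2.
have dQ1 (A : {set {set T}}) : within A Z2 -> [disjoint A & Q1] by move=> w; apply: fresh_disj w q4.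
have dQ2 (A : {set {set T}}) : within A Z2 -> [disjoint A & Q2].
  by move=> w; apply: fresh_disj (withinS Z23 w) p4.
have dQ12 : [disjoint Q1 & Q2] by apply: fresh_disj (fresh_within q4) p4.
have dQ1' (A : {set {set T}}) : within A Z2 -> [disjoint Q1 & A].
  by move=> w; rewrite disjoint_sym dQ1.
(* Without [H], the first swap is taken in the form [J1, J2, S1, S2] and the second as
   [K, M, L1, L2]. With [H], the first is taken as [H, M, J1, J2] and the second as
   [L1, L2, S1, S2], while [K] is decomposed by itself. The edges other than [H] are the same both
   times. *)
pose A := ((M :|: (S1 :|: S2)) :|: K) :|: (((J1 :|: J2) :|: Q1) :|: ((L1 :|: L2) :|: Q2)).
exists A, Z4; split.
- rewrite !subUset q1 p1 /= ?andbT.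
  have sub (p0 q0 : I -> T) : (forall i, pr (p0 i) (q0 i) \in E) -> [set pr (p0 i) (q0 i) | i : I] \subset E.
    by move=> hs; apply/subsetP => e /imsetP [i _ ->].
  have KE : K \subset E.
    by rewrite eK; apply/bigcupsP => j _; have [] := hf j (in_setT _).
  rewrite KE andbT !sub // => [i|i|i|i|i|i|i].
  + case: i => j l; have [fi _ _ hex'] := hf j (in_setT _).
    rewrite prC; apply: hex'; apply/imsetP; exists l.
      by rewrite inE (pq l).2 in_pr eqxx orbT.
    by rewrite (negbTE (pq l).1).
  + case: i => j l; have [fi _ _ hex'] := hf j (in_setT _).
    apply: hex'; apply/imsetP; exists l.
      by rewrite inE (pq l).2 in_pr eqxx.
    by rewrite eqxx.
  + by have [_ _ []] := hab i (in_setT _).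
  + by have [_ _ [? ? ? ? ?]] := hab i (in_setT _); rewrite prC.
  + by have [_ _ [? ? ? ? ?]] := hab i (in_setT _); rewrite prC.
  + by have [_ _ [? ? ? ? ?]] := hab i (in_setT _); rewrite prC.
  + by have [_ _ [? ? ? ? ?]] := hab i (in_setT _); rewrite prC.
- by apply: subset_trans p2; apply: subset_trans Z23.
- by move: p3 q3 cZ2 cZ1; clear; lia.
- have Z24 : Z2 \subset Z4 by apply: subset_trans p2.
  have w4 (B : {set {set T}}) n : simple B -> within B Z2 -> (forall e, e \in B -> ty e = n) ->
      n != 2 -> fresh B Z Z4.
    move=> sB wB tB n2 e eB; split; first exact: withinS Z24 wB _ eB.
    apply: contra n2 => eZ; rewrite -(tB e eB) /ty (eq_bigr (fun=> 1)); last first.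
      by move=> t te; apply: wtx; apply: (subsetP eZ).
    by rewrite sum1_card (sB e eB).
  have h1 := dec_simple q5; have h2 := dec_simple q6; have h3 := dec_simple p5.
  have sub3 (B : {set {set T}}) (D : {set {set T}}) : simple D -> (forall e, e \in B -> e \in D) -> simple B.
    by move=> sD hB e /hB /sD.
  have fQ1 : fresh Q1 Z Z4.
    move=> e eQ; have [g1 g2] := freshS ZZ2 q4 eQ; split=> //.
    by apply: subset_trans g1 p2.
  have fQ2 : fresh Q2 Z Z4 by apply: freshS p4; apply: subset_trans Z23.
  have fU (B D : {set {set T}}) : fresh B Z Z4 -> fresh D Z Z4 -> fresh (B :|: D) Z Z4.
    by move=> g1 g2 e /setUP [/g1|/g2].
  have gM : fresh M Z Z4.
    by apply: (w4 _ _ _ wM tyM) => //; apply: (sub3 _ _ h1) => e eB; rewrite !in_setU eB ?orbT.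
  have gS1 : fresh S1 Z Z4.
    by apply: (w4 _ _ _ wS1 tyS1) => //; apply: (sub3 _ _ h2) => e eB; rewrite !in_setU eB ?orbT.
  have gS2 : fresh S2 Z Z4.
    by apply: (w4 _ _ _ wS2 tyS2) => //; apply: (sub3 _ _ h2) => e eB; rewrite !in_setU eB ?orbT.
  have gK : fresh K Z Z4.
    by apply: (w4 _ _ _ wK tyK) => //; apply: (sub3 _ _ h3) => e eB; rewrite !in_setU eB ?orbT.
  have gJ1 : fresh J1 Z Z4.
    by apply: (w4 _ _ _ wJ1 tyJ1) => //; apply: (sub3 _ _ h1) => e eB; rewrite !in_setU eB ?orbT.
  have gJ2 : fresh J2 Z Z4.
    by apply: (w4 _ _ _ wJ2 tyJ2) => //; apply: (sub3 _ _ h1) => e eB; rewrite !in_setU eB ?orbT.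
  have gL1 : fresh L1 Z Z4.
    by apply: (w4 _ _ _ wL1 tyL1) => //; apply: (sub3 _ _ h3) => e eB; rewrite !in_setU eB ?orbT.
  have gL2 : fresh L2 Z Z4.
    by apply: (w4 _ _ _ wL2 tyL2) => //; apply: (sub3 _ _ h3) => e eB; rewrite !in_setU eB ?orbT.
  apply: (fU _ _ (fU _ _ (fU _ _ gM (fU _ _ gS1 gS2)) gK)).
  exact: (fU _ _ (fU _ _ (fU _ _ gJ1 gJ2) fQ1) (fU _ _ (fU _ _ gL1 gL2) fQ2)).
- have eA : A = (((J1 :|: J2) :|: (S1 :|: S2)) :|: Q1) :|: (((K :|: M) :|: (L1 :|: L2)) :|: Q2).
    apply/setP => e; rewrite !in_setU.
    by apply/idP/idP; do ![case/orP]; move=> ->; rewrite ?orbT.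
  have eHA : H :|: A = ((((H :|: M) :|: (J1 :|: J2)) :|: Q1) :|: K) :|: (((L1 :|: L2) :|: (S1 :|: S2)) :|: Q2).
    apply/setP => e; rewrite !in_setU.
    by apply/idP/idP; do ![case/orP]; move=> ->; rewrite ?orbT.
  split.
    rewrite eA; apply: decU => //; rewrite !disjointUl !disjointUr.
    rewrite (tdis _ _ _ _ tyJ1 tyK) // (tdis _ _ _ _ tyJ1 tyM) // (tdis _ _ _ _ tyJ1 tyL1) //.
    rewrite (tdis _ _ _ _ tyJ1 tyL2) // (tdis _ _ _ _ tyJ2 tyK) // (tdis _ _ _ _ tyJ2 tyM) //.
    rewrite (tdis _ _ _ _ tyJ2 tyL1) // (tdis _ _ _ _ tyJ2 tyL2) // (tdis _ _ _ _ tyS1 tyK) //.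
    rewrite (tdis _ _ _ _ tyS1 tyM) // (tdis _ _ _ _ tyS1 tyL1) // (tdis _ _ _ _ tyS1 tyL2) //.
    rewrite (tdis _ _ _ _ tyS2 tyK) // (tdis _ _ _ _ tyS2 tyM) // (tdis _ _ _ _ tyS2 tyL1) //.
    rewrite (tdis _ _ _ _ tyS2 tyL2) // (dQ2 _ wJ1) (dQ2 _ wJ2) (dQ2 _ wS1) (dQ2 _ wS2) dQ12.
    by rewrite (dQ1' _ wK) (dQ1' _ wM) (dQ1' _ wL1) (dQ1' _ wL2).
  rewrite eHA; apply: decU => //; last apply: decU => //; rewrite !disjointUl ?disjointUr.
    rewrite (tdis _ _ _ _ tyH tyL1) // (tdis _ _ _ _ tyH tyL2) // (tdis _ _ _ _ tyH tyS1) //.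
    rewrite (tdis _ _ _ _ tyH tyS2) // (tdis _ _ _ _ tyM tyL1) // (tdis _ _ _ _ tyM tyL2) //.
    rewrite (tdis _ _ _ _ tyM tyS1) // (tdis _ _ _ _ tyM tyS2) // (tdis _ _ _ _ tyJ1 tyL1) //.
    rewrite (tdis _ _ _ _ tyJ1 tyL2) // (tdis _ _ _ _ tyJ1 tyS1) // (tdis _ _ _ _ tyJ1 tyS2) //.
    rewrite (tdis _ _ _ _ tyJ2 tyL1) // (tdis _ _ _ _ tyJ2 tyL2) // (tdis _ _ _ _ tyJ2 tyS1) //.
    rewrite (tdis _ _ _ _ tyJ2 tyS2) // (tdis _ _ _ _ tyK tyL1) // (tdis _ _ _ _ tyK tyL2) //.
    rewrite (tdis _ _ _ _ tyK tyS1) // (tdis _ _ _ _ tyK tyS2) //.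
    rewrite (dQ2 _ wH2) (dQ2 _ wM) (dQ2 _ wJ1) (dQ2 _ wJ2) (dQ2 _ wK) dQ12.
    by rewrite (dQ1' _ wL1) (dQ1' _ wL2) (dQ1' _ wS1) (dQ1' _ wS2).
  rewrite (tdis _ _ _ _ tyH tyK) // (tdis _ _ _ _ tyM tyK) // (tdis _ _ _ _ tyJ1 tyK) //.
  by rewrite (tdis _ _ _ _ tyJ2 tyK) // (dQ1' _ wK).
Qed.

End Absorber.

(** * One absorber for all possible leftovers *)

Section AbsorbAll.
Variables (F : sgraph) (r : nat) (u v : F).
Hypothesis rF : regular r F.
Hypothesis r0 : 0 < r.
Hypothesis uv : adj u v.

(** The constant of [absorber] depends on [h]; adding up the constants for all [h <= n] gives a
    common one. *)
Lemma absorber_upto : forall n, exists C, forall h, h <= n ->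
  forall (T : finType) (E : {set {set T}})
    (X Z : {set T}) c (H : {set {set T}}),
  (forall t, #|X :\: nb E t| <= c) -> simple H -> within H Z -> #|H| = h ->
  #|edges F| %| h -> (forall t, r %| dg H t) -> 3 * r * c + #|Z| + C <= #|X| ->
  exists (A : {set {set T}}) (Z' : {set T}),
    [/\ A \subset E, Z \subset Z', #|Z'| <= #|Z| + C, fresh A Z Z' &
        dec F A /\ dec F (H :|: A)].
Proof.
have mono n m z x C C' : C <= C' -> 3 * n * m + z + C' <= x -> 3 * n * m + z + C <= x.
  by move=> CC h; apply: leq_trans h; rewrite leq_add2l.
elim=> [|n [C1 IH]].
  by have [C hC] := absorber rF r0 uv 0; exists C => h; rewrite leqn0 => /eqP ->.
have [C2 hC] := absorber rF r0 uv n.+1.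
exists (C1 + C2) => h; rewrite leq_eqVlt => /orP [/eqP ->|hn] T E X Z c H h1 h2 h3 h4 h5 h6 h7.
  have [|A [Z' [p1 p2 p3 p4 p5]]] := hC T E X Z c H h1 h2 h3 h4 h5 h6.
    by apply: mono h7; apply: leq_addl.
  by exists A, Z'; split=> //; apply: leq_trans p3 _; rewrite leq_add2l leq_addl.
have [|A [Z' [p1 p2 p3 p4 p5]]] := IH h hn T E X Z c H h1 h2 h3 h4 h5 h6.
  by apply: mono h7; apply: leq_addr.
by exists A, Z'; split=> //; apply: leq_trans p3 _; rewrite leq_add2l leq_addr.
Qed.

(** Each divisible graph on [U] gets its own absorber on fresh vertices. The absorber of the actual
    [H] takes [H] in, and all the others are decomposable without help. Graphs on [U] are sets of
    subsets of [U], hence the count [2 ^ (2 ^ m)]. *)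
Lemma absorber_all : forall m, exists C, forall (T : finType) (E : {set {set T}})
    (X U : {set T}) c,
  #|U| <= m -> (forall t, #|X :\: nb E t| <= c) -> 3 * r * c + #|U| + C <= #|X| ->
  exists (A : {set {set T}}) (Z' : {set T}),
    [/\ A \subset E, #|Z'| <= #|U| + C, fresh A U Z', dec F A &
      forall H, simple H -> within H U -> #|edges F| %| #|H| ->
        (forall t, r %| dg H t) -> dec F (H :|: A)].
Proof.
move=> m; have [C hC] := absorber_upto (2 ^ m).
exists (2 ^ (2 ^ m) * C) => T E X U c Um hc hX.
pose good (H : {set {set T}}) := [&& H \subset powerset U, #|edges F| %| #|H|, [forall t, r %| dg H t] &
  [forall e in H, #|e| == 2]].
suff key : forall J : {set {set {set T}}}, (forall H, H \in J -> good H) -> #|J| <= 2 ^ (2 ^ m) ->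
    exists (A : {set {set T}}) (Z' : {set T}),
    [/\ A \subset E, U \subset Z', #|Z'| <= #|U| + #|J| * C, fresh A U Z' &
      dec F A /\ forall H, H \in J -> dec F (H :|: A)].
  have [||A [Z' [p1 p2 p3 p4 [p5 p6]]]] := key [set H | good H].
  - by move=> H; rewrite inE.
  - apply: leq_trans (_ : #|powerset (powerset U)| <= _).
      by apply/subset_leq_card/subsetP => H; rewrite inE powersetE => /and4P [].
    by rewrite !card_powerset leq_exp2l // leq_exp2l.
  exists A, Z'; split=> //.
    apply: leq_trans p3 _; rewrite leq_add2l leq_mul2r; apply/orP; right.
    apply: leq_trans (_ : #|powerset (powerset U)| <= _).
      by apply/subset_leq_card/subsetP => H; rewrite inE powersetE => /and4P [].
    by rewrite !card_powerset leq_exp2l // leq_exp2l.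
  move=> H h1 h2 h3 h4; apply: p6; rewrite inE; apply/and4P; split=> //.
  - by apply/subsetP => e /h2; rewrite powersetE.
  - exact/forallP.
  - by apply/forall_inP => e /h1 ->.
move=> J; have [n] := ubnP #|J|; elim: n J => // n IH J sJ gJ cJ.
case: (set_0Vmem J) => [->|[H HJ]].
  exists set0, U; rewrite sub0set subxx leq_addr; split=> //.
    by move=> e; rewrite inE.
  by split=> [|H]; [apply: dec0|rewrite inE].
have eJ : #|J| = #|J :\ H|.+1 by rewrite (cardsD1 H) HJ.
have [|||A [Z1 [p1 p2 p3 p4 [p5 p6]]]] := IH (J :\ H).
- by rewrite -ltnS -eJ.
- by move=> H'; rewrite inE => /andP [_ /gJ].
- by apply: leq_trans cJ; rewrite eJ.
have /and4P [/subsetP g1 g2 /forallP g3 /forall_inP g4] := gJ _ HJ.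
have wH : within H U by move=> e /g1; rewrite powersetE.
have sH : simple H by move=> e /g4 /eqP.
have hH : #|H| <= 2 ^ m.
  apply: leq_trans (_ : #|powerset U| <= _); last by rewrite card_powerset leq_exp2l.
  exact/subset_leq_card/subsetP.
have [|A' [Z2 [q1 q2 q3 q4 [q5 q6]]]] :=
    hC _ hH T E X Z1 c H hc sH (withinS p2 wH) erefl g2 g3.
  apply: leq_trans hX; rewrite -!addnA leq_add2l.
  apply: leq_trans (_ : #|U| + (#|J :\ H| * C + C) <= _); first by rewrite addnA leq_add2r.
  by rewrite leq_add2l addnC -mulSn -eJ leq_mul2r cJ orbT.
have UZ2 : U \subset Z2 by apply: subset_trans q2.
have dAA' : [disjoint A & A'] by apply: fresh_disj (fresh_within p4) q4.
have dA (B : {set {set T}}) : within B U -> [disjoint B & A] by move=> w; apply: fresh_disj w p4.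
have dA' (B : {set {set T}}) : within B U -> [disjoint B & A'].
  by move=> w; apply: fresh_disj (withinS p2 w) q4.
exists (A :|: A'), Z2; split=> //.
- by rewrite subUset p1.
- by rewrite eJ mulSn; apply: leq_trans q3 _; rewrite addnCA addnC leq_add2l.
- by apply: freshU q4.
split; first exact: decU.
move=> H' H'J; case: (eqVneq H' H) => [->|nH].
  rewrite (setUC A) setUA; apply: decU => //.
  by rewrite disjointUl dA // disjoint_sym dAA'.
have H'J' : H' \in J :\ H by rewrite !inE nH.
have /and4P [/subsetP g1' _ _ _] := gJ _ H'J.
rewrite setUA; apply: decU => //; last exact: p6.
rewrite disjointUl dAA' andbT; apply: dA' => e /g1'; by rewrite powersetE.
Qed.

End AbsorbAll.

Import Order.TTheory GRing.Theory Num.Theory.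
Local Open Scope ring_scope.

(** * Random colourings *)

(** From [expR (- l) >= 1 - l] one gets [expR l <= 1 / (1 - l)], which is at most [1 + l + 2 l^2]
    for [l] up to [1/2]. *)
Lemma expR_quadratic (R : realType) (l : R) : 0 <= l -> l <= 1/2 ->
  expR l - 1 <= l + 2 * l ^+ 2.
Proof.
move=> l0 l1; have e0 := expR_gt0 l.
have h := expR_ge1Dx (- l); have hm : expR l * expR (- l) = 1 by rewrite expRN mulfV ?gt_eqF.
have h2 : expR l * (1 - l) <= 1 by rewrite -[X in _ <= X]hm ler_pM2l.
have h3 : expR l <= (1 + l + 2 * l ^+ 2) * 1.
  have h4 : expR l * (1 - l) <= (1 + l + 2 * l ^+ 2) * (1 - l).
    apply: (le_trans h2); nra.
  by rewrite mulr1 -(ler_pM2r (x := 1 - l)) //; lra.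
lra.
Qed.

(* The exponential moment method, averaging over all colourings. *)
Lemma coloring (R : realType) (T C I : finType) (V : {set T}) (M : I -> {set T}) (a : R) :
  0 < a -> a <= 1 -> (forall i, M i \subset V) -> (0 < #|C|)%N ->
  #|I|%:R * #|C|%:R * expR (- (a ^+ 2 * #|V|%:R / 8)) < 1 ->
  exists c : T -> C, forall i k,
    #|[set x in M i | c x == k]|%:R <= #|M i|%:R / #|C|%:R + a * #|V|%:R.
Proof.
move=> a0 a1 MV C0 hI.
(* With [l = a / 4] the terms linear in the mean cancel, and the remaining exponent
   [2 l^2 n - l a n] equals [- a^2 n / 8]. *)
pose K : R := #|C|%:R; pose n : R := #|V|%:R; pose l := a / 4.
have K1 : 1 <= K by rewrite /K ler1n.
have l0 : 0 < l by rewrite /l; lra.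
pose X (c : {ffun T -> C}) i k : R := #|[set x in M i | c x == k]|%:R.
pose th i : R := #|M i|%:R / K + a * n.
have mn i : (#|M i|%:R : R) <= n by rewrite ler_nat subset_leq_card.
have sumX i k : \sum_(c : {ffun T -> C}) expR (l * X c i k) <=
    K ^+ #|T| * expR ((expR l - 1) / K * #|M i|%:R).
  pose w x (k' : C) := if (x \in M i) && (k' == k) then expR l else 1 : R.
  have eX (c : {ffun T -> C}) : expR (l * X c i k) = \prod_x w x (c x).
    rewrite expRM_natr -big_mkcond /= prodr_const; congr (_ ^+ _).
    by apply: eq_card => x; rewrite !inE.
  rewrite (eq_bigr _ (fun c _ => eX c)) -(bigA_distr_bigA w) /=.
  pose p := (expR l - 1) / K.
  have p0 : 0 <= p.
    rewrite /p divr_ge0 ?ler0n // subr_ge0; have := expR_ge1Dx l; lra.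
  have sw x : \sum_k' w x k' <= K * (if x \in M i then expR p else 1).
    rewrite /w; case: (x \in M i) => /=; last by rewrite sumr_const mulr1.
    rewrite (bigD1 k) //= eqxx (eq_bigr (fun=> 1)); last by move=> j /negbTE ->.
    rewrite sumr_const.
    have -> : #|(fun j : C => j != k)| = #|C|.-1 by rewrite -(cardC1 k); apply: eq_card.
    have -> : (#|C|.-1)%:R = K - 1 :> R by rewrite /K -subn1 natrB.
    have h := expR_ge1Dx p; have : K * (1 + p) <= K * expR p by rewrite ler_pM2l //; lra.
    rewrite mulrDr mulr1 /p mulrC divfK; last by rewrite gt_eqF //; lra.
    lra.
  apply: le_trans (_ : \prod_(x : T) (K * (if x \in M i then expR p else 1)) <= _).
    apply: ler_prod => x _; rewrite sw andbT; apply: sumr_ge0 => k' _.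
    by rewrite /w; case: ifP => // _; apply/ltW/expR_gt0.
  rewrite big_split /= prodr_const -big_mkcond /= prodr_const expRM_natr.
  by rewrite (_ : #|[pred x | x \in T]| = #|T|).
have l2 : l <= 1/2 by rewrite /l; lra.
have n0 : 0 <= n by rewrite ler0n.
have bnd i k : \sum_(c : {ffun T -> C}) expR (l * X c i k - l * th i) <=
    K ^+ #|T| * expR (- (a ^+ 2 * n / 8)).
  rewrite (eq_bigr (fun c => expR (l * X c i k) * expR (- (l * th i)))); last first.
    by move=> c _; rewrite expRD.
  rewrite -big_distrl /=.
  apply: le_trans (_ : K ^+ #|T| * expR ((expR l - 1) / K * #|M i|%:R) * expR (- (l * th i)) <= _).
    by rewrite ler_pM2r ?expR_gt0.
  rewrite -mulrA -expRD ler_pM2l; last by rewrite exprn_gt0 //; lra.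
  rewrite ler_expR /th.
  have h1 := expR_quadratic (ltW l0) l2.
  pose q : R := #|M i|%:R / K.
  have q0 : 0 <= q by rewrite /q divr_ge0 ?ler0n.
  have qn : q <= n.
    rewrite /q ler_pdivrMr; last by lra.
    apply: le_trans (mn i) _; rewrite -[X in X <= _]mulr1; apply: ler_wpM2l => //.
  have -> : (expR l - 1) / K * #|M i|%:R = (expR l - 1) * q by rewrite /q mulrAC mulrA.
  rewrite -/q.
  have h2 : (expR l - 1) * q <= (l + 2 * l ^+ 2) * q by apply: ler_wpM2r.
  have h3 : 2 * l ^+ 2 * q <= 2 * l ^+ 2 * n by apply: ler_wpM2l => //; nra.
  have h4 : 2 * l ^+ 2 * n = a ^+ 2 * n / 8 by rewrite /l; field.
  have h5 : l * (a * n) = a ^+ 2 * n / 4 by rewrite /l; field.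
  nra.
have Kp : 0 < K ^+ #|T| by rewrite exprn_gt0 //; lra.
have tot : \sum_(c : {ffun T -> C}) \sum_(i : I) \sum_(k : C) expR (l * X c i k - l * th i)
    < K ^+ #|T|.
  rewrite exchange_big /=.
  apply: le_lt_trans (_ : \sum_(i : I) \sum_(k : C) K ^+ #|T| * expR (- (a ^+ 2 * n / 8)) < _).
    by apply: ler_sum => i _; rewrite exchange_big /=; apply: ler_sum => k _; apply: bnd.
  have cIT : #|(fun=> true) : pred I| = #|I| by apply: eq_card.
  have cCT : #|(fun=> true) : pred C| = #|C| by apply: eq_card.
  rewrite !sumr_const ?cIT ?cCT -mulrnA -[X in X < _]mulr_natr natrM -/K.
  move: hI; rewrite -/K -/n; move: (expR _) => y hy.
  rewrite -[X in _ < X]mulr1 -mulrA ltr_pM2l //.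
  by apply: le_lt_trans hy; rewrite le_eqVlt; apply/orP; left; apply/eqP; ring.
(* The total over all colourings is below their number [K ^ #|T|], so for some colouring the
   exponentials sum to less than 1; then every single exponent is negative. *)
have [c hc] : exists c : {ffun T -> C},
    \sum_(i : I) \sum_(k : C) expR (l * X c i k - l * th i) < 1.
  apply/existsP; apply: contraT; rewrite negb_exists => /forallP h.
  suff : K ^+ #|T| <= \sum_(c : {ffun T -> C}) \sum_(i : I) \sum_(k : C) expR (l * X c i k - l * th i).
    by rewrite leNgt tot.
  rewrite /K -natrX -card_ffun -sum1_card natr_sum; apply: ler_sum => c _.
  by rewrite leNgt.
exists c => i k.
have : expR (l * X c i k - l * th i) < 1.
  apply: le_lt_trans hc; rewrite (bigD1 i) //= (bigD1 k) //= -addrA lerDl addr_ge0 //.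
    by apply: sumr_ge0 => j _; apply/ltW/expR_gt0.
  by apply: sumr_ge0 => j _; apply: sumr_ge0 => j' _; apply/ltW/expR_gt0.
rewrite expR_lt1 subr_lt0 ltr_pM2l // => /ltW.
by rewrite /X /th.
Qed.

(** * Packing with real bounds, and balanced partitions *)

Section RealBounds.
Variable R : realType.

Lemma ex_nat_ge (y : R) : exists N : nat, forall n : nat, (N <= n)%N -> y <= n%:R.
Proof.
exists (Num.bound `|y|) => n h; apply: le_trans (ler_norm y) _.
by apply: le_trans (ltW (archi_boundP (normr_ge0 y))) _; rewrite ler_nat.
Qed.

(** A number at least 1 loses at most a factor 2 when rounded down; this causes the factor 4 in the
    hypotheses on [m * s] below. *)
Lemma truncn_mul (x y : R) (n : nat) : 1 <= x -> 1 <= y -> 4 * n%:R <= x * y ->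
  (n <= Num.truncn x * Num.truncn y)%N.
Proof.
move=> x1 y1 h.
have half (z : R) : 1 <= z -> z <= 2 * (Num.truncn z)%:R.
  move=> z1; have z0 : 0 <= z by lra.
  have /andP [h1 h2] := truncn_itv z0.
  have h3 : (1 <= Num.truncn z)%N by rewrite truncn_ge_nat.
  have : (1 : R) <= (Num.truncn z)%:R by rewrite ler1n.
  by rewrite -natr1 in h2; lra.
rewrite -(ler_nat R) natrM.
have := half x x1; have := half y y1; set a : R := (Num.truncn x)%:R; set b : R := (Num.truncn y)%:R.
move=> h1 h2; have : x * y <= (2 * a) * (2 * b) by apply: ler_pM => //; lra.
lra.
Qed.

Lemma card_le_truncn (T : finType) (A : {set T}) (x : R) :
  #|A|%:R <= x -> (#|A| <= Num.truncn x)%N.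
Proof. by move=> h; rewrite truncn_ge_nat //; apply: le_trans h. Qed.

Section Wrap.
Variables (F : sgraph) (r : nat) (u : F).
Hypothesis rF : regular r F.
Hypothesis r0 : (0 < r)%N.

Lemma pack_real (T I : finType) (J : {set I}) (L : I -> {set F}) (g : I -> F -> T)
    (X : I -> {set T}) (E : {set {set T}}) (c d s m : R) :
  (forall i, i \in J -> {in L i &, injective (g i)}) ->
  (forall i x, i \in J -> x \in bd (L i) -> #|X i :\: nb E (g i x)|%:R <= c) ->
  (forall i t, i \in J -> t \in X i -> #|X i :\: nb E t|%:R <= c) ->
  (forall t, #|[set i in J | t \in g i @: bd (L i)]|%:R <= d) ->
  0 <= c -> 0 <= d -> 1 <= s -> 1 <= m -> 4 * (#|J|%:R * #|F|%:R) <= m * s ->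
  (forall i, i \in J -> r%:R * (c + r%:R * (d + s)) + m + #|F|%:R <= #|X i|%:R) ->
  exists f : I -> F -> T,
    [/\ forall i, i \in J -> [/\ injective (f i), {in L i, f i =1 g i},
          forall w, w \notin L i -> f i w \in X i & newE (L i) (f i) \subset E],
        forall i j, i \in J -> j \in J -> i != j ->
          [disjoint newE (L i) (f i) & newE (L j) (f j)] &
        forall t, (dg (\bigcup_(i in J) newE (L i) (f i)) t)%:R <= r%:R * (d + s)].
Proof.
move=> h1 h2 h3 h4 c0 d0 s1 m1 hm hX.
have tr (x : R) : 0 <= x -> (Num.truncn x)%:R <= x by move=> x0; rewrite truncn_le.
have tS : (Num.truncn s)%:R <= s by apply: tr; lra.
have tM : (Num.truncn m)%:R <= m by apply: tr; lra.
have tC := tr c c0; have tD := tr d d0.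
have bnd : r%:R * (d + s) >= (r * (Num.truncn d + Num.truncn s))%:R.
  by rewrite natrM natrD; apply: ler_wpM2l; rewrite ?ler0n // lerD.
have [||||||f [f1 f2 f3]] := @pack F r rF T I J L g X E (Num.truncn c) (Num.truncn d)
  (Num.truncn s) (Num.truncn m) h1.
- by move=> i x iJ xb; apply: card_le_truncn; apply: h2.
- by move=> i t iJ tX; apply: card_le_truncn; apply: h3.
- by move=> t; apply: card_le_truncn; apply: h4.
- by rewrite truncn_ge_nat //; lra.
- by apply: truncn_mul => //; rewrite natrM.
- move=> i iJ; rewrite -(ler_nat R); apply: le_trans (hX i iJ).
  rewrite natrD natrD lerD2r lerD // natrM ler_wpM2l ?ler0n // natrD lerD //.
exists f; split=> // t; apply: le_trans bnd; rewrite ler_nat; exact: f3.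
Qed.

(** The three bounds separate what is lost at [x]: to non-neighbours, to similar centres, and to
    vertices contested by dissimilar centres. *)
Lemma star_cover_real (T : finType) (E : {set {set T}}) (C : {set T}) (L : T -> {set T})
    (sim : rel T) (X : {set T}) (b1 b2 b3 c d s m : R) :
  simple E ->
  (forall w, w \in C -> (r %| #|L w|)%N) ->
  (forall w w', w \in C -> w' \in C -> w \notin L w') ->
  [disjoint stars C L & E] ->
  (forall w x, w \in C -> x \in L w -> #|L w :\: nb E x|%:R <= b1) ->
  (forall w x, w \in C -> x \in L w ->
     #|[set w' in C | (x \in L w') && sim w w']|%:R <= b2) ->
  (forall w x, w \in C -> x \in L w ->
     #|[set y in L w | [exists w' in C, [&& ~~ sim w w', x \in L w' & y \in L w']]]|%:R <= b3) ->
  (forall w, w \in C -> 2 * r%:R * (b1 + r%:R * b2 + b3) <= #|L w|%:R) ->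
  (forall t, #|[set w in C | t \in L w]|%:R <= d) ->
  (forall w x, w \in C -> x \in L w -> #|X :\: nb E x|%:R <= c) ->
  (forall t, t \in X -> #|X :\: nb E t|%:R <= c) ->
  0 <= c -> 0 <= d -> 1 <= s -> 1 <= m ->
  4 * ((\sum_(w in C) #|L w|)%N%:R * #|F|%:R) <= m * s ->
  r%:R * (c + r%:R * d + r%:R * (d + s)) + m + #|F|%:R <= #|X|%:R ->
  exists D : {set {set T}}, [/\ dec F D, stars C L \subset D, D \subset stars C L :|: E &
     forall t, (dg (D :&: E) t)%:R <= r%:R * d + r%:R * (d + s)].
Proof.
move=> sE h1 h2 h3 hb1 hb2 hb3 hb hd hc1 hc2 c0 d0 s1 m1 hm hX.
have tr (x : R) : 0 <= x -> (Num.truncn x)%:R <= x by move=> x0; rewrite truncn_le.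
have tS : (Num.truncn s)%:R <= s by apply: tr; lra.
have tM : (Num.truncn m)%:R <= m by apply: tr; lra.
have tC := tr c c0; have tD := tr d d0.
have bnd : r%:R * d + r%:R * (d + s) >= (r * Num.truncn d + r * (Num.truncn d + Num.truncn s))%:R.
  by rewrite natrD !natrM natrD lerD // ler_wpM2l ?ler0n // lerD.
have [|||||||D [D1 D2 D3 D4]] := @star_cover F r u rF r0 T E C L sim X (Num.truncn c) (Num.truncn d)
  (Num.truncn s) (Num.truncn m) sE h1 h2 h3.
- move=> w x wC xL; rewrite -(ler_nat R) natrM natrM.
  apply: le_trans (hb w wC); rewrite ler_wpM2l ?mulr_ge0 ?ler0n //.
  rewrite !natrD lerD ?hb3 // lerD ?hb1 // natrM ler_wpM2l ?ler0n //; exact: hb2.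
- by move=> t; apply: card_le_truncn.
- by move=> w x wC xL; apply: card_le_truncn; apply: (hc1 w).
- by move=> t tX; apply: card_le_truncn; apply: hc2.
- by rewrite truncn_ge_nat //; lra.
- by apply: truncn_mul => //; rewrite natrM.
- rewrite -(ler_nat R); apply: le_trans hX.
  rewrite natrD natrD lerD2r lerD // natrM ler_wpM2l ?ler0n // natrD natrD !natrM natrD.
  by rewrite !lerD // ler_wpM2l ?ler0n // lerD.
exists D; split=> // t; apply: le_trans bnd; rewrite ler_nat; exact: D4.
Qed.

End Wrap.

(** The failure bound decays exponentially in [#|V|], while only linearly many sets have to be
    controlled. The lower bound on a class is what the upper bounds on the other classes leave
    over. *)
Lemma parts (C : finType) (w : R) (q : nat) : (0 < #|C|)%N -> 0 < w -> w <= 1 ->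
  exists n0 : nat, forall (T I : finType) (V : {set T}) (M : I -> {set T}),
  (n0 <= #|V|)%N -> (#|I| <= q * #|V|)%N -> (forall i, M i \subset V) ->
  exists col : T -> C, forall k,
   [/\ (1 - w) * (#|V|%:R / #|C|%:R) <= #|[set x in V | col x == k]|%:R,
       #|[set x in V | col x == k]|%:R <= (1 + w) * (#|V|%:R / #|C|%:R) &
       forall i, #|[set x in M i | col x == k]|%:R
         <= #|M i|%:R / #|C|%:R + w * (#|V|%:R / #|C|%:R)].
Proof.
move=> C0 w0 w1; pose K : R := #|C|%:R.
have K1 : 1 <= K by rewrite /K ler1n.
(* Deviations add up over the [K - 1] other classes; this choice keeps their sum below [w] times the
   average class size. *)
pose a := w / K ^+ 2.
have K2 : 0 < K ^+ 2 by rewrite exprn_gt0 //; lra.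
have a0 : 0 < a by rewrite divr_gt0.
have a1 : a <= 1.
  rewrite ler_pdivrMr // mul1r; apply: le_trans w1 _.
  by rewrite exprn_ege1.
have [n0 hn0] := ex_nat_ge (1 + 256 * ((q%:R + 1) * K) / a ^+ 4).
exists n0 => T I V M hV hI MV.
have hn := hn0 _ hV; set n : R := #|V|%:R in hn *.
have a4 : 0 < a ^+ 4 by rewrite exprn_gt0.
have n1 : 1 <= n.
  apply: le_trans hn; rewrite lerDl divr_ge0 ?(ltW a4) // !mulr_ge0 ?addr_ge0 ?ler0n //; lra.
(* The extra index [None] stands for [V] itself and yields the bounds on the class sizes. *)
have [|||c hc] := @coloring R T C (option I) V (fun o => oapp M V o) a a0 a1.
- by case.
- exact: C0.
- rewrite card_option -/K -/n.
  have y0 : 0 <= a ^+ 2 * n / 8.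
    have : 0 <= a ^+ 2 * n by rewrite mulr_ge0 ?exprn_ge0 ?(ltW a0) //; lra.
    by lra.
  rewrite expRN ltr_pdivrMr ?expR_gt0 // mul1r.
  apply: lt_le_trans (expR_ge1Dxn 1 y0).
  have hI' : (#|I|.+1)%:R <= q%:R * n + 1 :> R by rewrite -natr1 lerD2r -natrM ler_nat.
  have f2 : (2`!)%:R = 2 :> R by [].
  rewrite f2.
  have hx : 256 * ((q%:R + 1) * K) <= (n - 1) * a ^+ 4.
    by rewrite -ler_pdivrMr //; lra.
  have q0 : 0 <= q%:R :> R by rewrite ler0n.
  have e1 : (a ^+ 2 * n / 8) ^+ 2 / 2 = (a ^+ 4 * n) * n / 128 by field.
  rewrite e1.
  have h1 : (#|I|.+1)%:R * K <= (q%:R + 1) * n * K.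
    by rewrite ler_wpM2r ?ler0n //; apply: le_trans hI' _; nra.
  have h2 : (q%:R + 1) * n * K <= (n - 1) * a ^+ 4 * n / 256.
    have : ((q%:R + 1) * K) * n <= ((n - 1) * a ^+ 4 / 256) * n.
      by rewrite ler_wpM2r //; lra.
    by lra.
  have nn0 : 0 <= n by apply: le_trans n1.
  have p0 : 0 <= a ^+ 4 * n by rewrite mulr_ge0 // ltW.
  have h3 : 0 <= a ^+ 4 * n * n by rewrite mulr_ge0.
  have h4 : (n - 1) * a ^+ 4 * n <= a ^+ 4 * n * n.
    by move: p0; set A4 := a ^+ 4; clear; nra.
  move: h1 h2 h3 h4; clear; lra.
exists c => k.
have K0 : K != 0 by rewrite gt_eqF //; lra.
pose y := n / K.
have y0 : 0 <= y by rewrite /y divr_ge0 //; lra.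
have ean : a * n = w * y / K by rewrite /a /y; field.
have wy0 : 0 <= w * y by rewrite mulr_ge0 // ltW.
have an : a * n <= w * y.
  by rewrite ean ler_pdivrMr; [nra|lra].
have up k' : #|[set x in V | c x == k']|%:R <= y + a * n := hc None k'.
rewrite -/K -/y; split.
- have tot : n = \sum_(k' : C) #|[set x in V | c x == k']|%:R.
    rewrite -natr_sum /n -sum1_card; congr (_%:R).
    rewrite (partition_big c xpredT) //=; apply: eq_bigr => k' _.
    by rewrite -sum1_card; apply: eq_bigl => x; rewrite inE.
  rewrite (bigD1 k) //= in tot.
  have h : \sum_(i | i != k) (#|[set x in V | c x == i]|%:R : R) <= (K - 1) * (y + a * n).
    apply: le_trans (_ : \sum_(i | i != k) (y + a * n) <= _).
      by apply: ler_sum => k' _; apply: up.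
    rewrite sumr_const -[X in X <= _]mulr_natl.
    have -> : #|(fun j : C => j != k)| = #|C|.-1 by rewrite -(cardC1 k); apply: eq_card.
    by rewrite /K -subn1 natrB.
  have eKy : n = K * y by rewrite /y mulrC divfK.
  have eKa : K * (a * n) = w * y by rewrite ean mulrC divfK.
  have an0 : 0 <= a * n by rewrite mulr_ge0 //; lra.
  move: tot h; set S := \sum_(i | _) _; set z : R := #|_|%:R => tot h.
  have e2 : (K - 1) * (y + a * n) = K * y + K * (a * n) - y - a * n by ring.
  rewrite e2 eKa -eKy in h; lra.
- by have := up k; lra.
- by move=> i; have := hc (Some i) k; rewrite /= -/K => h; lra.
Qed.

End RealBounds.

(** * Decompositions with small leftover degrees *)

(** The only form in which the threshold is used. [S] is a subset of an ambient type so that the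
    property applies to blocks. The density is given by the proportion [kap] of non-neighbours,
    where a vertex counts as its own non-neighbour. *)
Definition approx_pack (R : realType) (F : sgraph) (eta kap : R) (n1 : nat) :=
  forall (T : finType) (E : {set {set T}}) (S : {set T}),
  simple E -> (forall e, e \in E -> e \subset S) -> (n1 <= #|S|)%N ->
  (forall v, v \in S -> #|S :\: nb E v|%:R <= kap * #|S|%:R) ->
  exists D : {set {set T}}, [/\ D \subset E, dec F D & #|E :\: D|%:R <= eta * #|S|%:R ^+ 2].

Section Block.
Variables (R : realType) (F : sgraph) (r : nat) (u : F).
Hypothesis rF : regular r F.
Hypothesis r0 : (0 < r)%N.

Lemma sub_card_dvd (T : finType) (A : {set T}) : exists B : {set T},
  [/\ B \subset A, (r %| #|B|)%N & (#|A| < #|B| + r)%N].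
Proof.
have h : (r * (#|A| %/ r) <= #|A|)%N by rewrite mulnC leq_trunc_div.
have [B] : exists B, B \in [set B : {set T} | B \subset A & #|B| == (r * (#|A| %/ r))%N].
  by apply/set0Pn; rewrite -card_gt0 cards_draws bin_gt0.
rewrite inE => /andP [sB /eqP cB]; exists B; split=> //.
  by rewrite cB dvdn_mulr.
by rewrite cB mulnC {1}(divn_eq #|A| r) ltn_add2l ltn_mod.
Qed.

(** The first inequality, for the tilings, is the decisive one: cliques are sought in a set of size
    about [(1 - k) N], so [(2r + 1) k <= 3 r k < 1] is used. The others give room for the
    completions, the density needed by the packing of the rest, and [s >= 1]. *)
Lemma block_arith (Rr f b k e N l : R) : 1 <= Rr -> 0 <= f -> 0 < b -> b <= 1 -> 0 <= k -> 0 < e ->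
  3 * Rr * (k + e) <= 1 -> (3 * Rr ^+ 2 + 4 * f + 1) * b <= 1/4 -> 4 * Rr ^+ 2 * b <= e ->
  0 <= N -> Rr + f + 1 <= b ^+ 2 * N ->
  (1 - k) * N - b ^+ 2 * N - Rr <= l ->
  [/\ 2 * Rr * (k * N + Rr * (b ^+ 2 * N) + 0) <= l,
      Rr * (k * N + Rr * (b ^+ 2 * N) + Rr * (b ^+ 2 * N + b * N)) + 4 * f * b * N + f
        <= (1 - b ^+ 2) * N,
      k * N + (Rr * (b ^+ 2 * N) + Rr * (b ^+ 2 * N + b * N)) <= (k + e) * ((1 - b ^+ 2) * N) &
      1 <= b * N].
Proof.
move=> r1 f0 b0 b1 k0 e0 h1 h2 h3 N0 hN hl.
have Rk : 0 <= Rr * k by rewrite mulr_ge0 //; lra.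
have bb : b ^+ 2 <= b by rewrite expr2; nra.
have bb0 : 0 <= b ^+ 2 by rewrite exprn_ge0 // ltW.
have Re : e <= Rr * e by nra.
have Rke : 3 * (Rr * k) + 3 * (Rr * e) <= 1 by lra.
have kRk : k <= Rr * k by nra.
have R2 : Rr <= Rr ^+ 2 by rewrite expr2; nra.
have R2b : Rr * b <= Rr ^+ 2 * b by rewrite ler_wpM2r // ltW.
have bR : b <= Rr * b by nra.
have fb : 0 <= f * b by rewrite mulr_ge0 // ltW.
have R2bb : Rr ^+ 2 * b ^+ 2 <= Rr ^+ 2 * b by rewrite ler_wpM2l // exprn_ge0 //; lra.
have Rbb : Rr * b ^+ 2 <= Rr * b by rewrite ler_wpM2l //; lra.
have bbN : b ^+ 2 * N <= b * N by rewrite ler_wpM2r.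
have q1 : (2 * Rr * k + 2 * Rr ^+ 2 * b ^+ 2 + k + 2 * b ^+ 2) * N <= 1 * N.
  apply: ler_wpM2r => //; lra.
have q2 : (Rr * k + 2 * Rr ^+ 2 * b ^+ 2 + Rr ^+ 2 * b + 4 * (f * b) + 2 * b ^+ 2) * N <= 1 * N.
  apply: ler_wpM2r => //; lra.
have kb : (k + e) * b ^+ 2 <= b / 3.
  have : (k + e) * b ^+ 2 <= 1/3 * b ^+ 2 by rewrite ler_wpM2r //; lra.
  lra.
have q3 : (k + 2 * (Rr * b ^+ 2) + Rr * b) * N <= (k + e - (k + e) * b ^+ 2) * N.
  apply: ler_wpM2r => //; lra.
split.
- apply: le_trans hl; clear -q1 hN f0; lra.
- clear -q2 hN f0 r1; lra.
- clear -q3; lra.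
- clear -hN f0 r1 bbN; lra.
Qed.

(* All edges at B are first covered by stars; the blackbox packing only sees S :\: B. *)
Lemma block_lemma (b k e eta : R) n1 (T : finType) (E : {set {set T}}) (S B : {set T}) :
  0 < b -> b <= 1 -> 0 <= k -> 0 < e -> 3 * r%:R * (k + e) <= 1 ->
  (3 * r%:R ^+ 2 + 4 * #|F|%:R + 1) * b <= 1/4 -> 4 * r%:R ^+ 2 * b <= e ->
  0 <= eta -> approx_pack F eta (k + e) n1 -> simple E ->
  (forall e, e \in E -> e \subset S) ->
  (forall v, v \in S -> #|S :\: nb E v|%:R <= k * #|S|%:R) ->
  B \subset S -> #|B|%:R <= b ^+ 2 * #|S|%:R ->
  r%:R + #|F|%:R + 1 <= b ^+ 2 * #|S|%:R -> (2 * n1)%:R <= (#|S|%:R : R) ->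
  exists D : {set {set T}}, [/\ D \subset E, dec F D,
    forall w, w \in B -> (dg (E :\: D) w)%:R <= 2 * b ^+ 2 * #|S|%:R &
    #|[set e in E :\: D | [disjoint e & B]]|%:R <= eta * #|S|%:R ^+ 2].
Proof.
move=> b0 b1 k0 e0 h1 h2 h3 eta0 AP sE wE mE BS cB hN hn1.
set N : R := #|S|%:R in mE cB hN hn1 *.
(* Neighbourhoods in [S :\: B] are trimmed to a size divisible by [r]. At [w] in [B] only fewer than
   [r] trimmed edges and the edges inside [B] stay uncovered, within [2 * b ^+ 2 * #|S|]. *)
have [L hL] : exists L : T -> {set T}, forall w, [/\ L w \subset nb E w :\: B,
    (r %| #|L w|)%N & (#|nb E w :\: B| < #|L w| + r)%N].
  exact: (fin_all_exists (fun w => sub_card_dvd (nb E w :\: B))).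
pose S' := S :\: B; pose E' := inside E S'.
have r1 : 1 <= r%:R :> R by rewrite ler1n.
have f0 : 0 <= #|F|%:R :> R by rewrite ler0n.
have f1 : 1 <= #|F|%:R :> R by rewrite ler1n; apply/card_gt0P; exists u.
have N0 : 0 <= N by rewrite ler0n.
have nbS w : nb E w \subset S.
  by apply/subsetP => x; rewrite in_nb => /wE; rewrite pr_sub => /andP [].
have LS w : L w \subset S'.
  by have [h _ _] := hL w; apply: subset_trans h _; apply: setSD.
have LB w w' : w \in B -> w \notin L w'.
  by move=> wB; apply/negP => /(subsetP (LS w')); rewrite inE wB.
have LE w x : x \in L w -> pr w x \in E.
  by have [h _ _] := hL w => /(subsetP h); rewrite inE in_nb => /andP [].
have cS' : (1 - b ^+ 2) * N <= #|S'|%:R.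
  have : #|S|%:R <= #|S'|%:R + #|B|%:R :> R.
    by rewrite -natrD ler_nat -(cardsID B S) addnC leq_add2l subset_leq_card // subsetIr.
  by rewrite -/N => h; clear -h cB; lra.
have cL w : w \in B -> (1 - k) * N - b ^+ 2 * N - r%:R <= #|L w|%:R.
  move=> wB; have [_ _ h] := hL w; have mw := mE w (subsetP BS _ wB).
  have h4 : #|S|%:R <= #|S :\: nb E w|%:R + #|nb E w|%:R :> R.
    by rewrite -natrD ler_nat -(cardsID (nb E w) S) addnC leq_add2l subset_leq_card // subsetIr.
  have h5 : #|nb E w|%:R <= #|nb E w :\: B|%:R + #|B|%:R :> R.
    by rewrite -natrD ler_nat -(cardsID B (nb E w)) addnC leq_add2l subset_leq_card // subsetIr.
  have h6 : #|nb E w :\: B|%:R <= #|L w|%:R + r%:R :> R by rewrite -natrD ler_nat ltnW.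
  rewrite -/N in h4; clear -h4 h5 h6 mw cB; lra.
have AR l := @block_arith r%:R #|F|%:R b k e N l r1 f0 b0 b1 k0 e0 h1 h2 h3 N0 hN.
have missE' (X : {set T}) v : X \subset S' -> v \in S' -> #|X :\: nb E' v|%:R <= k * N.
  move=> XS vS; apply: le_trans (mE v _); last by move: vS; rewrite inE => /andP [].
  rewrite ler_nat; apply/subset_leq_card/subsetP => x; rewrite !inE => /andP [h xX].
  have xS' := subsetP XS _ xX; have := xS'; rewrite inE => /andP [_ ->]; rewrite andbT.
  by apply: contra h => ->; rewrite pr_sub vS xS'.
(* All centres count as similar, since [B] is small. The choices [s = b N] and [m = 4 #|F| b N]
   match the total size of the stars, at most [b^2 N^2]. *)
have [|||||||||||||||||D1 [D1dec D1s D1sub D1dg]] :=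
  @star_cover_real R F r u rF r0 T E' B L (fun _ _ => true) S' (k * N) (b ^+ 2 * N) 0
    (k * N) (b ^+ 2 * N) (b * N) (4 * #|F|%:R * b * N).
- by apply: simpleS sE; apply: inside_sub.
- by move=> w _; have [] := hL w.
- by move=> w w' wB _; apply: LB.
- rewrite -setI_eq0; apply/eqP/setP => e'; rewrite in_setI in_set0; apply/negP.
  move=> /andP [/starsP [w [x [wB xL ->]]]]; rewrite inE pr_sub => /and3P [_].
  by rewrite inE wB.
- by move=> w x wB xL; apply: missE' => //; apply: (subsetP (LS w)).
- move=> w x wB xL; apply: le_trans cB; rewrite ler_nat; apply/subset_leq_card/subsetP => y.
  by rewrite inE => /andP [].
- move=> w x wB xL; rewrite (_ : [set y in _ | _] = set0) ?cards0 //.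
  apply/setP => y; rewrite in_set0 inE; apply/negP => /andP [_ /exists_inP [w' _]].
  by [].
- by move=> w wB; have [] := AR _ (cL w wB).
- move=> t; apply: le_trans cB; rewrite ler_nat; apply/subset_leq_card/subsetP => y.
  by rewrite inE => /andP [].
- by move=> w x wB xL; apply: missE' => //; apply: (subsetP (LS w)).
- by move=> t tS; apply: missE'.
- by rewrite mulr_ge0.
- by rewrite mulr_ge0 // exprn_ge0 // ltW.
- by have [] := AR _ (lexx _).
- have [_ _ _ h] := AR _ (lexx _); have : 1 * 1 <= #|F|%:R * (b * N) by apply: ler_pM.
  clear; lra.
- have hs : ((\sum_(w in B) #|L w|)%N)%:R <= b ^+ 2 * N * N.
    rewrite natr_sum; apply: le_trans (_ : \sum_(w in B) N <= _).
      apply: ler_sum => w _; rewrite ler_nat subset_leq_card //.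
      by apply: subset_trans (LS w) (subsetDl _ _).
    by rewrite sumr_const -mulr_natl ler_wpM2r.
  have := ler_wpM2r f0 hs; clear; set s := _%:R; lra.
- by apply: le_trans cS'; have [] := AR _ (lexx _).
pose E2 := E' :\: D1.
have [||||D2 [D2s D2dec D2c]] := AP T E2 S'.
- by apply: simpleS sE; apply: subset_trans (subsetDl _ _) (inside_sub _ _).
- by move=> e'; rewrite inE => /andP [_]; rewrite inE => /andP [].
- rewrite -(ler_nat R); apply: le_trans cS'.
  have bb : b ^+ 2 <= 1/2.
    have : b ^+ 2 <= b by rewrite expr2 -[X in _ <= X]mulr1 ler_wpM2l // ltW.
    have : b <= (3 * r%:R ^+ 2 + 4 * #|F|%:R + 1) * b.
      rewrite -[X in X <= _]mul1r ler_wpM2r ?(ltW b0) //.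
      have : 0 <= r%:R ^+ 2 :> R by rewrite exprn_ge0.
      lra.
    lra.
  have := ler_wpM2r N0 bb; rewrite natrM in hn1; clear -hn1; lra.
- move=> w wS'; have eD : E2 = E' :\: (D1 :&: E') by rewrite setDIr setDv setU0.
  rewrite eD.
  have m1 : #|S' :\: nb (E' :\: (D1 :&: E')) w|%:R <= k * N + (r%:R * (b ^+ 2 * N) + r%:R * (b ^+ 2 * N + b * N)).
    apply: le_trans (_ : (#|S' :\: nb E' w| + dg (D1 :&: E') w)%:R <= _); first by rewrite ler_nat missD.
    by rewrite natrD lerD // missE'.
  apply: le_trans m1 _; have [_ _ h _] := AR _ (lexx _); apply: le_trans h _.
  by rewrite ler_wpM2l //; clear -k0 e0; lra.
have D1E : D1 \subset E.
  apply/subsetP => e' /(subsetP D1sub) /setUP [/starsP [w [x [_ xL ->]]]|]; first exact: LE.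
  by rewrite inE => /andP [].
exists (D1 :|: D2); split.
- by rewrite subUset D1E; apply: subset_trans D2s (subset_trans (subsetDl _ _) (inside_sub _ _)).
- apply: decU => //; rewrite disjoint_sym; apply: disjointWl D2s _.
  by rewrite disjoints_subset; apply/subsetP => e'; rewrite !inE => /andP [].
- move=> w wB; have [_ _ h] := hL w.
  have h4 : (dg (E :\: (D1 :|: D2)) w <= r + #|B|)%N.
    apply: leq_trans (_ : #|((nb E w :\: B) :\: L w) :|: B| <= _)%N.
      apply/subset_leq_card/subsetP => y; rewrite in_nb => /setDP [yE].
      rewrite !in_setU negb_or => /andP [yD1 _]; rewrite in_setD in_setD in_nb yE andbT.
      case: (boolP (y \in B)) => yB; rewrite ?orbT // orbF /= andbT.
      apply: contra yD1 => yL; apply: (subsetP D1s); apply/starsP; exists w, y; split=> //.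
    apply: leq_trans (leq_card_setU _ _) _; rewrite leq_add2r.
    rewrite cardsD; have [/setIidPr -> _ _] := hL w; move: h; clear; lia.
  have h5 : (dg (E :\: (D1 :|: D2)) w)%:R <= r%:R + #|B|%:R :> R by rewrite -natrD ler_nat.
  apply: le_trans h5 _; clear -cB hN f0; lra.
- apply: le_trans (_ : eta * #|S'|%:R ^+ 2 <= _).
    apply: le_trans D2c; rewrite ler_nat; apply/subset_leq_card/subsetP => e'.
    rewrite !inE negb_or => /andP [/andP [/andP [-> ->] eE] dB]; rewrite eE /= .
    apply/subsetP => x xe; rewrite inE (subsetP (wE _ eE)) // andbT.
    by rewrite (disjointFr dB xe).
  by rewrite ler_wpM2l // lerXn2r ?nnegrE ?ler0n // ler_nat subset_leq_card // subsetDl.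
Qed.

End Block.

(** * A transversal design from the lines over a prime field *)

Section Design.
Variable p : nat.
Hypothesis pp : prime p.

(* The lines y = a x + b of the affine plane over F_p, completed by a value "at
   infinity" (the slope) so that any two distinct lines agree at exactly one x. *)
Definition line (l : 'F_p * 'F_p) (x : option 'F_p) : 'F_p :=
  if x is Some t then l.1 * t + l.2 else l.1.

Definition on_line (l : 'F_p * 'F_p) (P : option 'F_p * 'F_p) : bool := P.2 == line l P.1.

(** Parallel lines meet at infinity, in their common slope. The common point is what later lets an
    edge between two outside vertices be completed. *)
Lemma line_meet l l' : exists x, line l x = line l' x.
Proof.
case: l l' => [a b] [a' b']; case: (eqVneq a a') => [->|na]; first by exists None.
exists (Some ((b' - b) / (a - a'))) => /=.
have h : (a - a') * ((b' - b) / (a - a')) = b' - b by rewrite mulrC divfK // subr_eq0.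
apply/eqP; rewrite -subr_eq0; apply/eqP.
rewrite (_ : _ - _ = (a - a') * ((b' - b) / (a - a')) - (b' - b)); first by rewrite h subrr.
ring.
Qed.

Lemma line_uniq l l' x x' : x != x' -> line l x = line l' x -> line l x' = line l' x' -> l = l'.
Proof.
case: l l' => [a b] [a' b']; case: x => [x|]; case: x' => [x'|] //= nx.
- move=> h1 h2; have : (a - a') * (x - x') = 0.
    rewrite (_ : _ * _ = (a * x + b) - (a' * x + b') - ((a * x' + b) - (a' * x' + b'))); last by ring.
    by rewrite h1 h2 !subrr.
  have nx' : x - x' != 0 by rewrite subr_eq0; apply: contra nx => /eqP ->.
  move/eqP; rewrite mulf_eq0 (negbTE nx') orbF subr_eq0 => /eqP ea.
  by move: h1; rewrite ea => /addrI ->.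
- by move=> h1 h2; move: h1; rewrite h2 => /addrI ->.
- by move=> h1 h2; move: h2; rewrite h1 => /addrI ->.
Qed.

(** Interpolation. Points with different first coordinates thus share a block, whereas distinct
    points with the same first coordinate share none; the edges between these form a leftover of
    their own. *)
Lemma line_join x x' y y' : x != x' -> exists l, line l x = y /\ line l x' = y'.
Proof.
case: x => [x|]; case: x' => [x'|] //= nx.
- have nx' : x - x' != 0 by rewrite subr_eq0; apply: contra nx => /eqP ->.
  have h : (y - y') / (x - x') * (x - x') = y - y' by rewrite divfK.
  exists ((y - y') / (x - x'), y - (y - y') / (x - x') * x) => /=; split; first by ring.
  apply/eqP; rewrite -subr_eq0; apply/eqP.
  rewrite (_ : _ - _ = (y - y') - (y - y') / (x - x') * (x - x')); last by ring.
  by rewrite h subrr.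
- by exists (y', y - y' * x) => /=; split=> //; ring.
- by exists (y, y' - y * x') => /=; split=> //; ring.
Qed.

Lemma card_prime_Fp : #|'F_p| = p.
Proof. by rewrite card_Fp. Qed.

Lemma card_points : #|{: option 'F_p * 'F_p}| = (p.+1 * p)%N.
Proof. by rewrite card_prod card_option card_prime_Fp. Qed.

Lemma card_lines : #|{: 'F_p * 'F_p}| = (p * p)%N.
Proof. by rewrite card_prod card_prime_Fp. Qed.

Lemma card_on_line l : #|[set P | on_line l P]| = p.+1.
Proof.
have -> : [set P | on_line l P] = [set (x, line l x) | x : option 'F_p].
  apply/setP => -[x y]; rewrite inE /on_line /=; apply/eqP/imsetP => [->|[x' _ [-> ->]]] //.
  by exists x.
by rewrite card_imset ?card_option ?card_prime_Fp // => x x' [].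
Qed.

Lemma card_lines_through P : #|[set l | on_line l P]| = p.
Proof.
case: P => [[x|] y].
  have -> : [set l | on_line l (Some x, y)] = [set (a, y - a * x) | a : 'F_p].
    apply/setP => -[a b]; rewrite inE /on_line /=; apply/eqP/imsetP => [->|[a' _ [-> ->]]].
      by exists a => //; congr pair; ring.
    by ring.
  by rewrite card_imset ?card_prime_Fp // => a a' [].
have -> : [set l | on_line l (None, y)] = [set (y, b) | b : 'F_p].
  apply/setP => -[a b]; rewrite inE /on_line /=; apply/eqP/imsetP => [->|[b' _ [-> _]]] //.
  by exists b.
by rewrite card_imset ?card_prime_Fp // => a a' [].
Qed.

End Design.

(** * Small leftover degrees on the whole graph *)

Lemma card_touch (T : finType) (E : {set {set T}}) (B : {set T}) : simple E ->
  (#|E| <= #|[set e in E | [disjoint e & B]]| + \sum_(w in B) dg E w)%N.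
Proof.
move=> sE; pose A w := [set pr w y | y in nb E w].
apply: leq_trans (_ : #|[set e in E | [disjoint e & B]] :|: \bigcup_(w in B) A w| <= _)%N.
  apply/subset_leq_card/subsetP => e eE; rewrite !inE eE /=.
  case: (boolP [disjoint e & B]) => //=; rewrite -setI_eq0 => /set0Pn [w].
  rewrite inE => /andP [we wB]; apply/bigcupP; exists w => //.
  have [x [y [nxy ee]]] := simple_pr sE eE.
  move: we; rewrite ee in_pr => /orP [/eqP ->|/eqP ->].
    by apply: imset_f; rewrite in_nb -ee.
  by rewrite prC; apply: imset_f; rewrite in_nb prC -ee.
apply: leq_trans (leq_card_setU _ _) _; rewrite leq_add2l.
apply: leq_trans (leq_card_bigcup _ _) _; apply: leq_sum => w _.
exact: leq_imset_card.
Qed.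

Lemma card_col (T C : finType) (A : {set T}) (col : T -> C) (Q : pred C) :
  #|[set x in A | Q (col x)]| = (\sum_(k | Q k) #|[set x in A | col x == k]|)%N.
Proof.
rewrite -sum1_card (partition_big col Q) /=; last by move=> x; rewrite inE => /andP [].
apply: eq_bigr => k Qk; rewrite -sum1_card; apply: eq_bigl => x; rewrite !inE.
by case: eqP => [->|_]; rewrite ?Qk ?andbT // !andbF.
Qed.

Lemma card_col_le (R : realType) (T C : finType) (A : {set T}) (col : T -> C) (Q : pred C) (c : R) :
  (forall k, #|[set x in A | col x == k]|%:R <= c) ->
  #|[set x in A | Q (col x)]|%:R <= #|[set k | Q k]|%:R * c.
Proof.
move=> h; rewrite card_col natr_sum -sum1dep_card natr_sum mulr_suml.
by apply: ler_sum => k _; rewrite mul1r.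
Qed.

Lemma card_col_ge (R : realType) (T C : finType) (A : {set T}) (col : T -> C) (Q : pred C) (c : R) :
  (forall k, c <= #|[set x in A | col x == k]|%:R) ->
  #|[set k | Q k]|%:R * c <= #|[set x in A | Q (col x)]|%:R.
Proof.
move=> h; rewrite card_col natr_sum -sum1dep_card natr_sum mulr_suml.
by apply: ler_sum => k _; rewrite mul1r.
Qed.

(* The blocks S l are treated one after the other. A vertex whose leftover degree has
   become large is put into the set B of the block lemma for the blocks that follow. *)
Lemma approx_core (R : realType) (F : sgraph) (r : nat) (u : F) (p : nat) (e th b k : R) n1 :
  regular r F -> (0 < r)%N -> prime p -> 0 < b -> 0 < e -> 0 < th -> 0 <= k -> 3 * r%:R * (k + e) <= 1 ->
  (3 * r%:R ^+ 2 + 4 * #|F|%:R + 1) * b <= 1/4 -> 16 * r%:R ^+ 2 * b <= e ->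
  192 * p%:R * b ^+ 2 <= th -> 8 <= th * p%:R -> 16 <= e * p%:R ->
  approx_pack F (b ^+ 4) (k + e) n1 ->
  exists n2 : nat, forall (T : finType) (E : {set {set T}}) (V : {set T}),
   (n2 <= #|V|)%N -> simple E -> (forall e, e \in E -> e \subset V) ->
   (forall v, v \in V -> #|V :\: nb E v|%:R <= k * #|V|%:R) ->
   exists D : {set {set T}}, [/\ D \subset E, dec F D &
     forall v, (dg (E :\: D) v)%:R <= th * #|V|%:R].
Proof.
move=> rF r0 pp b0 e0 th0 k0 hk hb1 hb2 hb3 hp1 hp2 AP.
pose C := (option 'F_p * 'F_p)%type; pose Ln := ('F_p * 'F_p)%type.
have cC : #|{: C}| = (p.+1 * p)%N by apply: card_points.
have p1 : (0 < p)%N by apply: prime_gt0.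
pose P : R := p%:R.
have P1 : 1 <= P by rewrite /P ler1n.
have r1 : 1 <= r%:R :> R by rewrite ler1n.
have f0 : 0 <= #|F|%:R :> R by rewrite ler0n.
have rr1 : 1 <= r%:R ^+ 2 :> R by rewrite exprn_ege1.
have b16 : 16 * b <= e.
  apply: le_trans hb2; have := ler_wpM2r (ltW b0) rr1; clear; lra.
have rrb : r%:R ^+ 2 * b >= 0 by rewrite mulr_ge0 ?exprn_ge0 ?ler0n // ltW.
have b4 : b <= 1/4.
  have : b <= (3 * r%:R ^+ 2 + 4 * #|F|%:R + 1) * b.
    have h : 0 <= #|F|%:R * b by rewrite mulr_ge0 // ltW.
    by move: rrb h; clear; lra.
  move: hb1; clear; lra.
have bw : b <= 1 by move: b4; clear; lra.
have ke1 : k + e <= 1/3.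
  have : 3 * (k + e) <= 3 * r%:R * (k + e).
    have ke0 : 0 <= k + e by rewrite addr_ge0 // ltW.
    by have := ler_wpM2r ke0 r1; clear; lra.
  by move: hk; clear; lra.
have C0 : (0 < #|{: C}|)%N by rewrite cC muln_gt0 p1.
have [n0 parts0] := @parts R C b 1 C0 b0 bw.
have b20 : 0 < b ^+ 2 by rewrite exprn_gt0.
have [m0 hm0] := ex_nat_ge (2 * P * (r%:R + #|F|%:R + 1) / b ^+ 2 + 4 * P * n1%:R + 1).
exists (maxn n0 m0) => T E V; rewrite geq_max => /andP [hn0 hm0'] sE wE mE.
have hN := hm0 _ hm0'; set N : R := #|V|%:R in mE hN *.
have [||col hcol] := parts0 T 'I_#|V| V (fun i => V :\: nb E (enum_val i)) hn0.
- by rewrite card_ord mul1n.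
- by move=> i; apply: subsetDl.
pose K : R := #|{: C}|%:R; pose y := N / K.
have eK : K = (P + 1) * P by rewrite /K cC natrM -natr1.
have K0 : 0 < K by rewrite /K ltr0n.
have eN : N = K * y by rewrite /y mulrC divfK // gt_eqF.
have PV0 : 0 <= P * #|F|%:R by rewrite mulr_ge0 //; move: P1; clear; lra.
have x0 : 0 <= 2 * P * (r%:R + #|F|%:R + 1) / b ^+ 2.
  rewrite divr_ge0 ?(ltW b20) // !mulr_ge0 ?addr_ge0 //; move: P1 r1; clear; lra.
have x1 : 0 <= 4 * P * n1%:R by rewrite !mulr_ge0 //; move: P1; clear; lra.
have N1 : 1 <= N by move: x0 x1 hN; clear; lra.
have y0 : 0 <= y by rewrite /y divr_ge0 // ler0n.
pose s := (P + 1) * y.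
have eNs : N = P * s by rewrite eN eK /s; ring.
have s0 : 0 <= s by rewrite /s mulr_ge0 //; move: P1; clear; lra.
pose PP c := [set x in V | col x == c].
have PPl c : (1 - b) * y <= #|PP c|%:R by have [] := hcol c.
have PPu c : #|PP c|%:R <= (1 + b) * y by have [] := hcol c.
have PPm c v : v \in V -> #|[set x in V :\: nb E v | col x == c]|%:R <= (k + b) * y.
  move=> vV; have [_ _ /(_ (enum_rank_in vV v))] := hcol c.
  rewrite enum_rankK_in // => h; apply: le_trans h _.
  have h : #|V :\: nb E v|%:R / K <= k * y.
    by rewrite ler_pdivrMr // -mulrA [y * K]mulrC -eN; apply: mE.
  by move: h; rewrite -/K -/N -/y; clear; lra.
pose S (l : Ln) := [set x in V | on_line l (col x)].
have cL (l : Ln) : #|[set c | on_line l c]|%:R = P + 1 :> R by rewrite card_on_line // natr1.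
have Sl l : (1 - b) * s <= #|S l|%:R.
  have := card_col_ge (R := R) (on_line l) PPl; rewrite cL /s; clear; lra.
have Su l : #|S l|%:R <= (1 + b) * s.
  have := card_col_le (R := R) (on_line l) PPu; rewrite cL /s; clear; lra.
have Su2 l : #|S l|%:R <= 2 * s.
  have := Su l; have := ler_wpM2r s0 bw; clear; lra.
have Sl2 l : s / 2 <= #|S l|%:R.
  have := Sl l; have := ler_wpM2r s0 b4; clear -s0; lra.
(* Edges inside one colour class are omitted, as they would lie in several blocks; any other edge
   belongs to at most one block by [line_uniq]. *)
pose Es (l : Ln) := [set e in E | [exists x, [exists y,
   [&& e == pr x y, x \in S l, y \in S l & col x != col y]]]].
have EsP l x z : (pr x z \in Es l) = [&& pr x z \in E, x \in S l, z \in S l & col x != col z].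
  rewrite inE; case: (pr x z \in E) => //=; apply/existsP/idP => [[x' /existsP [z']]|h].
    case/and4P => /eqP /pr_eq [[-> ->]|[-> ->]] h1 h2 h3; rewrite h1 h2 //=.
    by rewrite eq_sym.
  by exists x; apply/existsP; exists z; rewrite eqxx.
have EsE l : Es l \subset E by apply/subsetP => e'; rewrite inE => /andP [].
have sEs l : simple (Es l) by apply: simpleS sE.
have EsS l e' : e' \in Es l -> e' \subset S l.
  move=> he; have [x [z [nxz ee]]] := simple_pr (sEs l) he.
  by move: he; rewrite ee EsP pr_sub => /and4P [_ -> ->].
have nbEsS l v : nb (Es l) v \subset S l.
  by apply/subsetP => x; rewrite in_nb => /EsS; rewrite pr_sub => /andP [].
have Sin l v x : x \in nb (Es l) v -> v \in S l.
  by rewrite in_nb => /EsS; rewrite pr_sub => /andP [].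
have disEs l l' : l != l' -> [disjoint Es l & Es l'].
  move=> nl; rewrite -setI_eq0; apply/eqP/setP => e'; rewrite in_setI in_set0.
  apply/negP => /andP [h1 h2]; have [x [z [nxz ee]]] := simple_pr (sEs l) h1.
  move: h1 h2; rewrite ee !EsP => /and4P [_ xl zl nc] /and4P [_ xl' zl' _].
  move: xl zl xl' zl'; rewrite !inE /on_line => /andP [_ /eqP a1] /andP [_ /eqP a2] /andP [_ /eqP a3] /andP [_ /eqP a4].
  case: (eqVneq (col x).1 (col z).1) => [ec|nec].
    move/negP: nc; apply; apply/eqP; apply: injective_projections => //.
    by rewrite a1 a2 ec.
  by move/eqP: nl; apply; apply: (line_uniq nec); rewrite -?a1 -?a2.
have missEs l v : v \in S l -> #|S l :\: nb (Es l) v|%:R <= (k + e / 2) * #|S l|%:R.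
  move=> vS; have vV : v \in V by move: vS; rewrite inE => /andP [].
  pose M1 := [set x in V :\: nb E v | on_line l (col x)].
  have h1 : #|S l :\: nb (Es l) v|%:R <= #|M1|%:R + #|PP (col v)|%:R :> R.
    rewrite -natrD ler_nat; apply: leq_trans (leq_card_setU _ _).
    apply/subset_leq_card/subsetP => x; rewrite in_setD in_nb EsP => /andP [h xS].
    move: h; rewrite vS xS /=; have := xS; rewrite inE => /andP [xV xl].
    rewrite negb_and negbK => /orP [h|/eqP h]; rewrite !inE xV xl h ?orbT //=.
    by rewrite eqxx orbT.
  have h2 := card_col_le (R := R) (on_line l) (fun c => PPm c v vV).
  rewrite cL -/M1 in h2.
  have h3 := PPu (col v).
  apply: le_trans h1 _; apply: le_trans (_ : (k + e / 2) * ((1 - b) * s) <= _); last first.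
    by rewrite ler_wpM2l //; move: k0 e0; clear; lra.
  apply: le_trans (_ : (k + b) * s + (1 + b) * y <= _).
    by move: h2 h3; rewrite /s; clear; lra.
  have hy : 8 * y <= e * s.
    have : 16 * y <= e * P * y by rewrite ler_wpM2r.
    have : 0 <= e * y by rewrite mulr_ge0 // ltW.
    by rewrite /s -mulrA; move: y0; clear; lra.
  have hyb : b * y <= y by rewrite -[X in _ <= X]mul1r ler_wpM2r.
  have hbs : 16 * (b * s) <= e * s by rewrite mulrA ler_wpM2r.
  have hkb : (k + e / 2) * (b * s) <= b * s.
    have bs0 : 0 <= b * s by rewrite mulr_ge0 // ltW.
    have ke2 : k + e / 2 <= 1 by move: ke1 k0 e0; clear; lra.
    by have := ler_wpM2r bs0 ke2; rewrite mul1r.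
  have es0 : 0 <= e * s by rewrite mulr_ge0 // ltW.
  move: hy hyb hbs hkb es0; clear; lra.
have hSb l : r%:R + #|F|%:R + 1 <= b ^+ 2 * #|S l|%:R.
  have h1 : 2 * P * (r%:R + #|F|%:R + 1) <= N * b ^+ 2.
    by rewrite -ler_pdivrMr //; move: hN x1; clear; lra.
  have h2 : (r%:R + #|F|%:R + 1) <= (s / 2) * b ^+ 2.
    rewrite -(ler_pM2l (x := 2 * P)); last by move: P1; clear; lra.
    by apply: le_trans h1 _; rewrite eNs; clear; lra.
  apply: le_trans h2 _; rewrite mulrC; apply: ler_wpM2l => //; exact: ltW.
have hSn l : (2 * n1)%:R <= #|S l|%:R :> R.
  apply: le_trans (Sl2 l); rewrite natrM.
  rewrite -(ler_pM2l (x := 2 * P)); last by move: P1; clear; lra.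
  by move: hN x0; rewrite eNs; clear; lra.
have b2s : 0 <= b ^+ 2 * s by rewrite mulr_ge0 // ltW.
have b4s2 : 0 <= b ^+ 4 * s ^+ 2 by rewrite mulr_ge0 // exprn_ge0 // ltW.
have bs0 : 0 <= 4 * b ^+ 2 * s by move: b2s; clear; lra.
have b4s : 0 <= 24 * b ^+ 4 * s ^+ 2 by move: b4s2; clear; lra.
have Pb0 : 0 <= P * (b ^+ 2 * s) by rewrite mulr_ge0 //; move: P1; clear; lra.
pose lam (D : Ln -> {set {set T}}) (J : {set Ln}) v := (\sum_(l in J) dg (Es l :\: D l) v)%N.
(* The degree bound: at most [th / 4 * N] until [v] is crowded, at most [2 * s] in the block where
   this happens, and [4 * b ^+ 2 * s] in each later block, where [v] lies in [B]. A block leaves at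
   most [3 b^4 |S l|^2 <= 12 b^4 s^2] edges; summing degrees doubles this to 24. *)
have inv : forall J : {set Ln}, exists D : Ln -> {set {set T}},
  [/\ forall l, l \in J -> D l \subset Es l /\ dec F (D l),
      forall v, (lam D J v)%:R <= th / 4 * N + 2 * s + #|[set l in J | v \in S l]|%:R * (4 * b ^+ 2 * s) &
      ((\sum_v lam D J v)%N)%:R <= #|J|%:R * (24 * b ^+ 4 * s ^+ 2)].
  move=> J; have [n] := ubnP #|J|; elim: n J => // n IH J sJ.
  have th4 : 0 <= th / 4 * N by move: (mulr_ge0 (ltW th0) (le_trans ler01 N1)); clear; lra.
  case: (set_0Vmem J) => [->|[l0 l0J]].
    exists (fun=> set0); split=> [l|v|]; rewrite ?inE //.
      rewrite /lam big_set0; set c : R := #|_|%:R.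
      have c0 : 0 <= c * (4 * b ^+ 2 * s) by rewrite mulr_ge0 // ler0n.
      by move: c0 th4 s0; clear; lra.
    by rewrite (eq_bigr (fun=> 0%N)) ?big1_eq ?cards0 ?mul0r // => v _; rewrite /lam big_set0.
  have [|D [D1 D2 D3]] := IH (J :\ l0).
    by move: sJ; rewrite (cardsD1 l0) l0J.
  pose B := [set v in S l0 | th / 4 * N < (lam D (J :\ l0) v)%:R].
  have BS : B \subset S l0 by apply/subsetP => v; rewrite inE => /andP [].
  have cJ : #|J :\ l0|%:R <= P * P :> R.
    by rewrite -natrM ler_nat -(card_lines pp); apply: max_card.
  (* Markov's inequality: the total leftover of at most [P * P] blocks allows few crowded vertices,
     and [192 * P * b ^+ 2 <= th] turns this into the bound required by [block_lemma]. *)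
  have cB : #|B|%:R <= b ^+ 2 * #|S l0|%:R.
    have h1 : #|B|%:R * (th / 4 * N) <= P * P * (24 * b ^+ 4 * s ^+ 2).
      apply: le_trans (_ : #|J :\ l0|%:R * (24 * b ^+ 4 * s ^+ 2) <= _); last by rewrite ler_wpM2r.
      apply: le_trans D3; rewrite -sumr_const natr_sum mulr_suml.
      apply: le_trans (_ : \sum_(v in B) (lam D (J :\ l0) v)%:R <= _).
        by apply: ler_sum => v; rewrite mul1r inE => /andP [_ /ltW].
      by rewrite [X in _ <= X](bigID (mem B)) /= lerDl; apply: sumr_ge0.
    have thN : 0 < th / 4 * N by rewrite mulr_gt0 //; [move: th0|move: N1]; clear; lra.
    rewrite -(ler_pM2r thN); apply: le_trans h1 _.
    apply: le_trans (_ : b ^+ 2 * (s / 2) * (th / 4 * N) <= _); last first.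
      by rewrite ler_wpM2r ?(ltW thN) // ler_wpM2l // ltW.
    rewrite eNs.
    have h2 : (192 * P * b ^+ 2) * (b ^+ 2 * P * s ^+ 2) <= th * (b ^+ 2 * P * s ^+ 2).
      rewrite ler_wpM2r // (_ : _ * _ * _ = P * (b ^+ 2 * s) * s); last by ring.
      exact: mulr_ge0.
    by move: h2; clear; lra.
  have [||||||D0 [D0E D0d D0B D0r]] := @block_lemma R F r u rF r0 b (k + e / 2) (e / 2) (b ^+ 4) n1 T
     (Es l0) (S l0) B b0 bw _ _ _ hb1 _ _ _ (sEs l0) (@EsS l0) (@missEs l0) BS cB (hSb l0) (hSn l0).
  - by move: k0 e0; clear; lra.
  - by move: e0; clear; lra.
  - by rewrite -addrA -splitr.
  - by move: hb2; set x := r%:R ^+ 2; have : 0 <= x * b by []; clear; lra.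
  - by rewrite exprn_ge0 // ltW.
  - by rewrite -addrA -splitr.
  pose D' l := if l == l0 then D0 else D l.
  have D'0 : D' l0 = D0 by rewrite /D' eqxx.
  have D'J l : l \in J :\ l0 -> D' l = D l by rewrite /D' !inE => /andP [/negbTE ->].
  have lamE v : lam D' J v = (dg (Es l0 :\: D0) v + lam D (J :\ l0) v)%N.
    rewrite /lam (big_setD1 l0) //= D'0; congr addn.
    by apply: eq_bigr => l /D'J ->.
  have cJ1 : #|J|%:R = 1 + #|J :\ l0|%:R :> R by rewrite (cardsD1 l0) l0J natrD.
  have cJv v : #|[set l in J | v \in S l]|%:R = (v \in S l0)%:R + #|[set l in J :\ l0 | v \in S l]|%:R :> R.
    rewrite (cardsD1 l0) inE l0J /= natrD; congr (_ + _%:R).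
    by apply: eq_card => l; rewrite !inE andbA.
  exists D'; split.
  - move=> l lJ; case: (eqVneq l l0) => [->|nl]; first by rewrite D'0.
    have h : l \in J :\ l0 by rewrite !inE nl.
    by rewrite D'J //; apply: D1.
  - move=> v; rewrite lamE natrD cJv.
    have := D2 v; set L := (lam _ _ _)%:R; set c := #|_|%:R => h.
    case: (boolP (v \in S l0)) => vS /=; last first.
      have -> : dg (Es l0 :\: D0) v = 0%N.
        apply/eqP; rewrite cards_eq0; apply/eqP/setP => x; rewrite in_set0.
        apply: contraNF vS => hx; apply: (Sin _ _ x).
        by apply: (subsetP (nbS v (subsetDl _ D0))).
      by rewrite !add0r.
    case: (boolP (v \in B)) => vB.
      have h2 := D0B v vB.
      have h3 : 2 * b ^+ 2 * #|S l0|%:R <= 4 * b ^+ 2 * s.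
        have := ler_wpM2l (ltW b20) (Su2 l0); clear; lra.
      by move: h h2 h3; clear; lra.
    have h2 : L <= th / 4 * N by move: vB; rewrite inE vS /= -leNgt.
    have h3 : (dg (Es l0 :\: D0) v)%:R <= 2 * s.
      apply: le_trans (Su2 l0); rewrite ler_nat; apply: leq_trans (dgS v (subsetDl _ _)) _.
      by apply/subset_leq_card/nbEsS.
    have h4 : 0 <= c * (4 * b ^+ 2 * s) by rewrite mulr_ge0 // ler0n.
    by move: h2 h3 h4 bs0; clear; lra.
  - rewrite (eq_bigr _ (fun v _ => lamE v)) big_split /= natrD cJ1 mulrDl mul1r lerD //.
    have sD : simple (Es l0 :\: D0) by apply: simpleS (sEs l0); apply: subsetDl.
    rewrite sum_dg // natrM.
    have h1 : #|Es l0 :\: D0|%:R <= b ^+ 4 * #|S l0|%:R ^+ 2 + #|B|%:R * (2 * b ^+ 2 * #|S l0|%:R).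
      apply: le_trans (_ : (#|[set e in Es l0 :\: D0 | [disjoint e & B]]| + \sum_(w in B) dg (Es l0 :\: D0) w)%N%:R <= _).
        by rewrite ler_nat card_touch.
      rewrite natrD lerD // natr_sum -sumr_const mulr_suml.
      by apply: ler_sum => w wB; rewrite mul1r; apply: D0B.
    set x : R := #|S l0|%:R in h1 cB.
    have x00 : 0 <= x by rewrite ler0n.
    have hx : x ^+ 2 <= 4 * s ^+ 2.
      have -> : 4 * s ^+ 2 = (2 * s) ^+ 2 by ring.
      by rewrite lerXn2r ?nnegrE //; [move: s0; clear; lra|apply: Su2].
    have h2 : #|B|%:R * (2 * b ^+ 2 * x) <= 2 * b ^+ 4 * x ^+ 2.
      have -> : 2 * b ^+ 4 * x ^+ 2 = (b ^+ 2 * x) * (2 * b ^+ 2 * x) by ring.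
      rewrite ler_wpM2r // -mulrA; have : 0 <= b ^+ 2 * x by rewrite mulr_ge0 // ltW.
      by clear; lra.
    have h3 : b ^+ 4 * x ^+ 2 <= b ^+ 4 * (4 * s ^+ 2) by rewrite ler_wpM2l // exprn_ge0 // ltW.
    by move: h1 h2 h3; clear; lra.
have [D [D1 D2 _]] := inv setT.
pose DD := \bigcup_(l in [set: Ln]) D l.
exists DD; split.
- by apply/bigcupsP => l _; have [h _] := D1 l (in_setT _); apply: subset_trans h (EsE l).
- apply: dec_bigcup => [l lT|l l' _ _ nl]; first by have [] := D1 l lT.
  have [h1 _] := D1 l (in_setT _); have [h2 _] := D1 l' (in_setT _).
  exact: disjointWl h1 (disjointWr h2 (disEs l l' nl)).
move=> v; case: (boolP (v \in V)) => vV; last first.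
  rewrite (_ : dg _ v = 0%N) ?mulr_ge0 ?(ltW th0) ?ler0n //.
  apply/eqP; rewrite cards_eq0; apply/eqP/setP => x; rewrite in_set0.
  apply: contraNF vV; rewrite in_nb inE => /andP [_ /wE]; by rewrite pr_sub => /andP [].
(* The vertices whose colour has the same first coordinate as that of [v]; by [line_join] the edges
   from [v] to all others lie in some block. *)
pose Gr := [set x in V | (col x).1 == (col v).1].
have h1 : (dg (E :\: DD) v <= lam D setT v + #|Gr|)%N.
  apply: leq_trans (_ : #|(\bigcup_(l in [set: Ln]) nb (Es l :\: D l) v) :|: Gr| <= _)%N.
    apply/subset_leq_card/subsetP => x; rewrite in_nb in_setD => /andP [xD xE].
    have xV : x \in V by have := wE _ xE; rewrite pr_sub => /andP [].
    rewrite in_setU inE xV /= orbC; case: eqP => //= /eqP nc.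
    have [l [l1 l2]] := line_join (col x).2 (col v).2 nc.
    apply/bigcupP; exists l; first by rewrite in_setT.
    rewrite in_nb in_setD EsP xE.
    have -> : v \in S l by rewrite inE vV /on_line l2 eqxx.
    have -> : x \in S l by rewrite inE xV /on_line l1 eqxx.
    apply/andP; split; first by apply: contra xD => h; apply/bigcupP; exists l; rewrite ?in_setT.
    by apply/andP; split=> //=; apply: contra nc => /eqP ->.
  apply: leq_trans (leq_card_setU _ _) _; rewrite leq_add2r.
  exact: leq_card_bigcup.
have h2 : #|Gr|%:R <= 2 * P * y.
  have := card_col_le (R := R) (fun c => c.1 == (col v).1) PPu.
  have -> : #|[set c : C | c.1 == (col v).1]|%:R = P :> R.
    rewrite (_ : [set c | _] = [set ((col v).1, z) | z : 'F_p]).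
      by rewrite card_imset ?card_prime_Fp // => z z' [].
    by apply/setP => -[x z]; rewrite inE /=; apply/eqP/imsetP => [->|[z' _ [-> _]]] //; exists z.
  have : P * ((1 + b) * y) <= P * (2 * y).
    have P0 : 0 <= P by move: P1; clear; lra.
    have b2 : 1 + b <= 2 by move: bw; clear; lra.
    exact: (ler_wpM2l P0 (ler_wpM2r y0 b2)).
  by move=> h3 h4; apply: le_trans h4 _; move: h3; clear; lra.
have h3 : #|[set l in [set: Ln] | v \in S l]|%:R <= P :> R.
  rewrite /P ler_nat; apply: leq_trans (_ : #|[set l : Ln | on_line l (col v)]| <= _)%N.
    apply/subset_leq_card/subsetP => l.
    by move=> /setIdP [_ /setIdP [_ h]]; rewrite inE.
  by rewrite (card_lines_through pp).
have h4 := D2 v.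
have h5 : (dg (E :\: DD) v)%:R <= (lam D setT v)%:R + #|Gr|%:R :> R by rewrite -natrD ler_nat.
apply: le_trans h5 _.
have h6 := ler_wpM2r bs0 h3.
(* th P >= 8 absorbs the two terms of order N / P *)
have h7 : 8 * s <= th * N by rewrite eNs mulrA ler_wpM2r.
have h8 : P * y <= s by rewrite /s mulrDl mul1r lerDl.
have h9 : P * (4 * b ^+ 2 * s) <= th / 4 * N.
  have : 192 * P * b ^+ 2 * s <= th * s by rewrite ler_wpM2r.
  have sN : s <= N by rewrite eNs -[X in X <= _]mul1r ler_wpM2r.
  move: Pb0.
  have := ler_wpM2l (ltW th0) sN.
  by clear; lra.
have := mulr_ge0 (ltW th0) (le_trans ler01 N1).
by move: h2 h4 h6 h7 h8 h9; clear; lra.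
Qed.

(** * Covering all edges outside a subset *)

Lemma card_edges_at (T : finType) (H : {set {set T}}) t : simple H ->
  (#|[set e in H | t \in e]| <= dg H t)%N.
Proof.
move=> sH; apply: leq_trans (_ : #|[set pr t y | y in nb H t]| <= _)%N; last exact: leq_imset_card.
apply/subset_leq_card/subsetP => e; rewrite inE => /andP [eH te].
have [x [y [nxy ee]]] := simple_pr sH eH.
move: te; rewrite ee in_pr => /orP [/eqP ->|/eqP ->].
  by apply: imset_f; rewrite in_nb -ee.
by rewrite prC; apply: imset_f; rewrite in_nb prC -ee.
Qed.

(* The inequalities behind the two greedy steps: M = |U|, N = |V|, y = |U_pt|. *)
Lemma cover_arith (R : realType) (r f P e w t t1 G k N M y s l : R) :
  1 <= r -> 1 <= f -> 1 <= P -> 0 < e -> 0 < w -> 0 < t -> 0 < t1 -> t1 <= 1 -> 1 <= G -> 0 <= k ->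
  3 * r * (k + e) <= 1 -> 16 * r * w <= e -> 1 <= P * t ^+ 2 -> 16 * r ^+ 2 * G <= e * P ->
  12 * r ^+ 2 * t1 * G * P <= e -> 64 * (r ^+ 2 + f) * t1 * G * (P * (P + 1)) <= 1 ->
  64 * (r ^+ 2 + f) * t * G <= 1 -> 0 <= y -> M = 2 * P * s -> s = (P + 1) * y -> 0 <= N ->
  N <= G * M -> 8 * f <= y -> 
  (1 - w) * s - (k + w) * s - 2 * r * t1 * N <= l ->
  [/\ r * ((k + w) * y + r * (t1 ^+ 2 * N + t1 * N)) + 4 * f * (t1 * N) + f <= (1 - w) * y,
      r * (t1 ^+ 2 * N + t1 * N) <= 2 * r * t1 * N,
      2 * r * (((k + w) * s + 2 * r * t1 * N) + r * (2 * N / P ^+ 2) + (1 + w) * y) <= l &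
      r * (((k + w) * (M / 2) + 2 * r * t1 * N) + r * (2 * N / P) + r * (2 * N / P + t * N)) + 4 * f * (t * N) + f
        <= (1 - w) * (M / 2)].
Proof.
move=> r1 f1 P1 e0 w0 t0 t10 t11 G1 k0 hk hw hPt hG ht1 ht1' ht y0 eM es N0 NG hf hl.
have P0 : 0 < P by apply: lt_le_trans P1.
have r0 : 0 < r by apply: lt_le_trans r1.
have Pn : P != 0 by rewrite gt_eqF.
have s0 : 0 <= s by rewrite es mulr_ge0 //; move: P1; clear; lra.
have M0 : 0 <= M by rewrite eM !mulr_ge0 // ltW.
have re : e <= r * e by rewrite -[X in X <= _]mul1r ler_wpM2r // ltW.
have rk : 3 * (r * k) + 3 * (r * e) <= 1 by move: hk; clear; lra.
have kr : k <= r * k by rewrite -[X in X <= _]mul1r ler_wpM2r.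
have rk0 : 0 <= r * k by rewrite mulr_ge0 // ltW.
have rw : w <= r * w by rewrite -[X in X <= _]mul1r ler_wpM2r // ltW.
have e3 : e <= 1/3 by move: rk re rk0; clear; lra.
have rr : r <= r ^+ 2 by rewrite expr2 -[X in X <= _]mul1r ler_wpM2r // ltW.
have r20 : 0 <= r ^+ 2 by rewrite exprn_ge0 // ltW.
have f0 : 0 <= f by apply: le_trans f1.
have t1N : 0 <= t1 * N by rewrite mulr_ge0 // ltW.
have t12 : t1 ^+ 2 * N <= t1 * N.
  by rewrite expr2 -mulrA -[X in _ <= X]mul1r ler_wpM2r.
have rt12 : r * (t1 ^+ 2 * N) <= r * (t1 * N) by rewrite ler_wpM2l // ltW.
have rrt12 : r ^+ 2 * (t1 ^+ 2 * N) <= r ^+ 2 * (t1 * N) by rewrite ler_wpM2l.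
have Ny : N <= 2 * G * (P * (P + 1)) * y by apply: le_trans NG _; rewrite eM es; clear; lra.
have Ns : N <= 2 * G * P * s by apply: le_trans NG _; rewrite eM; clear; lra.
have a1 : (r ^+ 2 + f) * t1 * N * 32 <= y.
  have h0 : 0 <= (r ^+ 2 + f) * t1 by rewrite mulr_ge0 ?addr_ge0 // ltW.
  have h1 := ler_wpM2l h0 Ny.
  have h2 := ler_wpM2r y0 ht1'.
  by move: h1 h2; clear; lra.
have rw' : 16 * (r * w) <= e by move: hw; clear; lra.
have rwy : r * w * y <= y / 48.
  have : r * w <= 1/48 by move: rw' e3; clear; lra.
  by move=> h; have := ler_wpM2r y0 h; clear; lra.
have wy : w * y <= r * w * y by rewrite ler_wpM2r.
have rky : r * k * y <= y / 3.
  have : r * k <= 1/3 by move: rk re e0; clear; lra.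
  by move=> h; have := ler_wpM2r y0 h; clear; lra.
have ft1N : 0 <= f * (t1 * N) by rewrite mulr_ge0.
have rt1N : 0 <= r ^+ 2 * (t1 * N) by rewrite mulr_ge0.
split.
- by move: a1 rwy wy rky rrt12 ft1N rt1N hf; clear; lra.
- by move: rt12; clear; lra.
- apply: le_trans hl.
  have b1 : 6 * (r ^+ 2 * (t1 * N)) <= e * s.
    have h0 : 0 <= r ^+ 2 * t1 by rewrite mulr_ge0 // ltW.
    have h1 := ler_wpM2l h0 Ns; have h2 := ler_wpM2r s0 ht1.
    by move: h1 h2; clear; lra.
  have rt1 : r * (t1 * N) <= r ^+ 2 * (t1 * N) by rewrite ler_wpM2r.
  have b2 : 4 * (r ^+ 2 * (N / P ^+ 2)) <= e * s / 2.
    have e4 : N / P ^+ 2 = N / P / P by field.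
    have h1 : N / P / P <= 2 * G * s / P.
      rewrite ler_pM2r ?invr_gt0 // ler_pdivrMr //; apply: le_trans Ns _; clear; lra.
    have h2 : r ^+ 2 * (2 * G * s / P) <= e * s / 8.
      rewrite mulrA ler_pdivrMr //.
      by have := ler_wpM2r s0 hG; clear; lra.
    rewrite e4; have := ler_wpM2l r20 h1; move: h2; clear; lra.
  have b3 : 2 * (r * y) * 8 <= e * s.
    have h1 : 16 * r * y <= e * P * y.
      rewrite ler_wpM2r //; apply: le_trans hG.
      have : r ^+ 2 <= r ^+ 2 * G by rewrite -[X in X <= _]mulr1 ler_wpM2l.
      by move: rr; clear; lra.
    have : 0 <= e * y by rewrite mulr_ge0 // ltW.
    by rewrite es; move: h1; clear; lra.
  have rwy' : r * (w * y) <= r * y.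
    rewrite ler_wpM2l ?(ltW r0) // -[X in _ <= X]mul1r ler_wpM2r //.
    by move: rw rw' e3; clear; lra.
  have b4 : 16 * (r * w * s) <= e * s by rewrite mulrA ler_wpM2r.
  have ws : w * s <= r * w * s by rewrite ler_wpM2r.
  have b5 : 3 * (r * k * s) + 3 * (r * e * s) <= s.
    have := ler_wpM2r s0 rk; clear; lra.
  have ks : k * s <= r * k * s by rewrite ler_wpM2r.
  have es' : e * s <= r * e * s by rewrite ler_wpM2r.
  have ess0 : 0 <= e * s by rewrite mulr_ge0 // ltW.
  move: b1 rt1 b2 b3 rwy' b4 ws b5 ks es' ess0 rt1N; clear; lra.
- have fM : 8 * f <= M.
    apply: le_trans hf _; rewrite eM es.
    have h0 : 1 * 1 <= P * (P + 1) by apply: ler_pM => //; move: P1; clear; lra.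
    have := ler_wpM2r y0 h0; move: y0; clear; lra.
  have c1 : 32 * (r ^+ 2 * (t1 * N)) <= M / 2.
    have h0 : 0 <= (r ^+ 2 + f) * t1 * G by rewrite !mulr_ge0 ?addr_ge0 ?(ltW t10) //; move: G1; clear; lra.
    have h1 : 1 * 2 <= P * (P + 1) by apply: ler_pM => //; move: P1; clear; lra.
    have h2 := ler_wpM2l h0 h1; have h3 : (r ^+ 2 + f) * t1 * G * 128 <= 1 by move: h2 ht1'; clear; lra.
    have h4 := ler_wpM2r M0 h3.
    have h5 : r ^+ 2 * (t1 * N) <= r ^+ 2 * (t1 * (G * M)).
      by rewrite ler_wpM2l // ler_wpM2l // ltW.
    have h6 : 0 <= f * (t1 * (G * M)).
      by rewrite mulr_ge0 // mulr_ge0 ?(ltW t10) // mulr_ge0 //; move: G1; clear; lra.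
    by move: h4 h5 h6 M0; clear; lra.
  have c2 : 16 * (r ^+ 2 * (N / P)) <= e * M.
    have h1 : N / P <= G * M / P by rewrite ler_pM2r ?invr_gt0.
    have h2 : 16 * r ^+ 2 * (G * M / P) <= e * M.
      rewrite mulrA ler_pdivrMr //; have := ler_wpM2r M0 hG; clear; lra.
    have := ler_wpM2l r20 h1; move: h2; clear; lra.
  have eM3 : e * M <= M / 3 by have := ler_wpM2r M0 e3; clear; lra.
  have c3 : (r ^+ 2 + f) * (t * N) * 64 <= M.
    have h0 : 0 <= (r ^+ 2 + f) * t by rewrite mulr_ge0 ?addr_ge0 // ltW.
    have h1 := ler_wpM2l h0 NG; have h2 := ler_wpM2r M0 ht.
    by move: h1 h2; clear; lra.
  have rt0 : 0 <= r ^+ 2 * (t * N) by rewrite mulr_ge0 // mulr_ge0 // ltW.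
  have rwM : r * w * M <= M / 48.
    have : r * w <= 1/48 by move: rw' e3; clear; lra.
    by move=> h; have := ler_wpM2r M0 h; clear; lra.
  have wM : w * M <= r * w * M by rewrite ler_wpM2r.
  have rkM : r * k * M <= M / 3.
    have : r * k <= 1/3 by move: rk re e0; clear; lra.
    by move=> h; have := ler_wpM2r M0 h; clear; lra.
  have rt1 : r * (t1 * N) <= r ^+ 2 * (t1 * N) by rewrite ler_wpM2r.
  move: fM c1 c2 c3 rt0 rwM wM rkM rt1 eM3 M0 rt1N; clear; lra.
Qed.

(* Outside vertices w are assigned lines, and the vertices of half of U are assigned points;
   the edges from w to the points on its line are kept in reserve. The other edges not
   inside U are packed up to a sparse leftover, and a leftover edge a b is extended to a
   copy of F through the class of a common point of the lines of a and b. The reserved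
   edges that remain at w are covered by stars, completed in the other half of U. *)
Lemma cover_down_core (R : realType) (F : sgraph) (r : nat) (u : F) (p : nat)
    (e w t t1 G mu k : R) (n2 : nat) :
  regular r F -> (0 < r)%N -> prime p ->
  0 < e -> 0 < w -> 0 < t -> 0 < t1 -> t1 <= 1 -> 1 <= G -> 0 <= k ->
  3 * r%:R * (k + e) <= 1 -> 16 * r%:R * w <= e -> 8 <= e * p%:R -> 1 <= p%:R * t ^+ 2 ->
  16 * r%:R ^+ 2 * G <= e * p%:R ->
  12 * r%:R ^+ 2 * t1 * G * p%:R <= e ->
  64 * (r%:R ^+ 2 + #|F|%:R) * t1 * G * (p%:R * (p%:R + 1)) <= 1 ->
  64 * (r%:R ^+ 2 + #|F|%:R) * t * G <= 1 ->
  (2 * r%:R * t1 + r%:R * t) * G * p%:R + 4 * r%:R * G <= mu * p%:R ->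
  (forall (T : finType) (E : {set {set T}}) (V : {set T}),
   (n2 <= #|V|)%N -> simple E -> (forall e, e \in E -> e \subset V) ->
   (forall v, v \in V -> #|V :\: nb E v|%:R <= (k + e / 2) * #|V|%:R) ->
   exists D : {set {set T}}, [/\ D \subset E, dec F D &
     forall v, (dg (E :\: D) v)%:R <= t1 ^+ 2 * #|V|%:R]) ->
  exists n3 : nat, forall (T : finType) (E : {set {set T}}) (V U : {set T}),
   (n3 <= #|V|)%N -> simple E -> (forall e, e \in E -> e \subset V) -> U \subset V ->
   #|V|%:R <= G * #|U|%:R -> 4 * #|U|%:R <= e * #|V|%:R ->
   (forall v, v \in V -> #|V :\: nb E v|%:R <= k * #|V|%:R) ->
   (forall v, v \in V -> #|U :\: nb E v|%:R <= k * #|U|%:R) ->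
   (forall v, v \in V :\: U -> (r %| dg E v)%N) ->
   exists D : {set {set T}}, [/\ D \subset E, dec F D,
     forall e, e \in E :\: D -> e \subset U &
     forall v, (dg (inside D U) v)%:R <= mu * #|U|%:R].
Proof.
move=> rF r0 pp e0 w0 t0 t10 t11 G1 k0 hk hw he8 hPt hG ht1 ht1' ht hmu AL.
pose Pt := (option 'F_p * 'F_p)%type; pose Ln := ('F_p * 'F_p)%type.
(* The boolean halves [U]: the classes with [true] carry the reserve and complete single leftover
   edges, those with [false] complete the stars. *)
pose C := (bool * Pt)%type.
pose P : R := p%:R.
have P1 : 1 <= P by rewrite /P ler1n prime_gt0.
have r1 : 1 <= r%:R :> R by rewrite ler1n.
have f1 : 1 <= #|F|%:R :> R by rewrite ler1n; apply/card_gt0P; exists u.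
have e3 : e <= 1/3.
  have h1 : 0 <= r%:R * k by rewrite mulr_ge0 // ler0n.
  have h2 : e <= r%:R * e by rewrite -[X in X <= _]mul1r ler_wpM2r // ltW.
  by move: hk h1 h2; clear; lra.
have w1 : w <= 1.
  have h2 : w <= r%:R * w by rewrite -[X in X <= _]mul1r ler_wpM2r // ltW.
  by move: hw h2 e3 w0; clear; lra.
have C0 : (0 < #|{: C}|)%N by apply/card_gt0P; exists (true, (None, 0)).
have L0 : (0 < #|{: Ln}|)%N by apply/card_gt0P; exists (0, 0).
have [q hq] := ex_nat_ge G; have {hq} Gq := hq q (leqnn q).
have [nU partU] := parts q C0 w0 w1.
have [nW partW] := parts 1 L0 w0 w1.
have cC : #|{: C}|%:R = 2 * P * (P + 1) :> R.
  by rewrite card_prod card_bool card_points // !natrM -natr1 -/P; clear; lra.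
pose K : R := 2 * P * (P + 1).
have K0 : 0 < K by rewrite /K !mulr_gt0 //; move: P1; clear; lra.
have [n3 hn3] := ex_nat_ge (n2%:R + G * nU%:R + 2 * nW%:R + t1^-1 + t^-1 + G * K * (8 * #|F|%:R) + 1).
exists n3 => T E V U hV sE wE UV NG MN mV mU rdv.
have hN := hn3 _ hV; clear hn3.
set N : R := #|V|%:R in NG MN mV hN; set M : R := #|U|%:R in NG MN mU *.
have G0 : 0 < G by apply: lt_le_trans G1.
have q1 : 0 <= n2%:R :> R by rewrite ler0n.
have q2 : 0 <= G * nU%:R by rewrite mulr_ge0 ?ler0n // ltW.
have q3 : 0 <= 2 * nW%:R :> R by rewrite mulr_ge0 ?ler0n.
have q4 : 0 <= t1^-1 by rewrite invr_ge0 ltW.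
have q5 : 0 <= t^-1 by rewrite invr_ge0 ltW.
have q6 : 0 <= G * K * (8 * #|F|%:R).
  by apply: mulr_ge0; [apply: mulr_ge0; apply: ltW|rewrite mulr_ge0 ?ler0n].
have N1 : 1 <= N by move: q1 q2 q3 q4 q5 q6 hN; clear; lra.
have N0 : 0 <= N by move: N1; clear; lra.
have hn2 : (n2 <= #|V|)%N by rewrite -(ler_nat R) -/N; move: q1 q2 q3 q4 q5 q6 hN; clear; lra.
have hnU : (nU <= #|U|)%N.
  rewrite -(ler_nat R) -/M -(ler_pM2l G0); apply: le_trans NG; move: q1 q2 q3 q4 q5 q6 hN; clear; lra.
pose W := V :\: U.
have WV : W \subset V by apply: subsetDl.
have M2N : 12 * M <= N by have := ler_wpM2r N0 e3; move: MN; clear; lra.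
have M0 : 0 <= M by rewrite ler0n.
have cW : #|W|%:R = N - M :> R.
  rewrite cardsD (setIidPr UV) natrB //; exact: subset_leq_card.
have hnW : (nW <= #|W|)%N.
  rewrite -(ler_nat R) cW; move: q1 q2 q3 q4 q5 q6 hN M2N M0; clear; lra.
have t1N : 1 <= t1 * N.
  rewrite mulrC -ler_pdivrMr // mul1r; move: q1 q2 q3 q4 q5 q6 hN; clear; lra.
have tN : 1 <= t * N.
  rewrite mulrC -ler_pdivrMr // mul1r; move: q1 q2 q3 q4 q5 q6 hN; clear; lra.
pose y := M / K; pose s := (P + 1) * y.
have y0 : 0 <= y by rewrite /y divr_ge0 // ltW.
have hy8 : 8 * #|F|%:R <= y.
  rewrite /y ler_pdivlMr // -(ler_pM2l G0); apply: le_trans NG.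
  apply: le_trans (_ : G * K * (8 * #|F|%:R) <= _); first by rewrite le_eqVlt; apply/orP; left; apply/eqP; ring.
  move: q1 q2 q3 q4 q5 q6 hN; clear; lra.
have eM : M = 2 * P * s.
  by rewrite /s /y /K; field; apply/andP; split; rewrite gt_eqF //; move: P1; clear; lra.
clear q1 q2 q3 q4 q5 q6 hN.
have [||i|col hcol] := partU T 'I_#|V| U (fun i => U :\: nb E (enum_val i)).
- exact: hnU.
- rewrite card_ord -(ler_nat R) natrM; apply: le_trans NG _; rewrite ler_wpM2r //.
- exact: subsetDl.
have [||//|colW hcolW] := partW T void W (fun=> set0).
- exact: hnW.
- by rewrite card_void.
rewrite cC -/K -/M -/y in hcol; clear partU partW.
have [v0 v0V] : exists v, v \in V.
  by apply/card_gt0P; rewrite -(ltr_nat R) -/N; move: N1; clear; lra.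
pose PP c := [set x in U | col x == c].
have PPl c : (1 - w) * y <= #|PP c|%:R by have [] := hcol c.
have PPu c : #|PP c|%:R <= (1 + w) * y by have [] := hcol c.
have PPm c v : v \in V -> #|[set x in U :\: nb E v | col x == c]|%:R <= (k + w) * y.
  move=> vV; have [_ _ /(_ (enum_rank_in vV v))] := hcol c.
  rewrite enum_rankK_in // => h; apply: le_trans h _.
  have h : #|U :\: nb E v|%:R / K <= k * y by rewrite /y mulrA ler_wpM2r ?invr_ge0 ?(ltW K0) //; apply: mU.
  by move: h; clear; lra.
have P20 : 0 < P ^+ 2 by rewrite exprn_gt0 //; move: P1; clear; lra.
have cLn : #|{: Ln}|%:R = P ^+ 2 :> R by rewrite card_lines // natrM expr2.
have QQ l : #|[set x in W | colW x == l]|%:R <= 2 * N / P ^+ 2.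
  have [_ h _] := hcolW l; apply: le_trans h _; rewrite cLn cW mulrA ler_pM2r ?invr_gt0 //.
  by apply: ler_pM => //; move: w0 w1 M2N M0; clear; lra.
pose onY (l : Ln) (c : C) := c.1 && on_line l c.2.
pose Y (l : Ln) := [set x in U | onY l (col x)].
have cY l : #|[set c | onY l c]|%:R = P + 1 :> R.
  rewrite natr1 -(card_on_line pp l); congr _%:R.
  rewrite -(card_imset [set P | on_line l P] (f := pair true)) => [|z z' [//]].
  apply: eq_card => -[b z]; rewrite inE /onY /=; apply/andP/imsetP => [[bT h]|[z' h [-> ->]]].
    by exists z; rewrite ?inE //; case: b bT.
  by rewrite inE in h.
have YU l : Y l \subset U by apply/subsetP => x; rewrite inE => /andP [].
have Yl l : (1 - w) * s <= #|Y l|%:R.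
  have := card_col_ge (R := R) (onY l) PPl; rewrite cY /s; clear; lra.
have Ym l v : v \in V -> #|Y l :\: nb E v|%:R <= (k + w) * s.
  move=> vV; have := card_col_le (R := R) (onY l) (fun c => PPm c v vV).
  rewrite cY /s (_ : [set x in _ | _] = Y l :\: nb E v).
    by clear; lra.
  by apply/setP => x; rewrite !inE andbA.
pose X := [set x in U | ~~ (col x).1].
have XU : X \subset U by apply/subsetP => x; rewrite inE => /andP [].
have cX : #|[set c : C | ~~ c.1]|%:R * y = M / 2.
  have -> : #|[set c : C | ~~ c.1]|%:R = (P + 1) * P :> R.
    rewrite natr1 -natrM -(card_points pp) -(card_imset {: Pt} (f := pair false)) => [|z z' [//]].
    congr _%:R; apply: eq_card => -[b z]; rewrite inE /=; apply/idP/imsetP => [|[z' _ [-> _]]] //.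
    by case: b => // _; exists z.
  by rewrite eM /s; field.
have Xl : (1 - w) * (M / 2) <= #|X|%:R.
  have := card_col_ge (R := R) (fun c : C => ~~ c.1) PPl.
  by rewrite mulrCA cX.
have Xm v : v \in V -> #|X :\: nb E v|%:R <= (k + w) * (M / 2).
  move=> vV; have := card_col_le (R := R) (fun c : C => ~~ c.1) (fun c => PPm c v vV).
  rewrite mulrCA cX (_ : [set x in _ | _] = X :\: nb E v) //.
  by apply/setP => x; rewrite !inE andbA.
have dY v : #|[set x in W | v \in Y (colW x)]|%:R <= 2 * N / P.
  have h : [set x in W | v \in Y (colW x)] \subset [set x in W | on_line (colW x) (col v).2].
    by apply/subsetP => x /setIdP [xW /setIdP [_ /andP [_ h]]]; apply/setIdP.
  have := card_col_le (R := R) (fun l : Ln => on_line l (col v).2) QQ.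
  rewrite card_lines_through // -/P => h1.
  apply: le_trans (_ : P * (2 * N / P ^+ 2) <= _).
    by apply: le_trans h1; rewrite ler_nat subset_leq_card.
  by rewrite le_eqVlt; apply/orP; left; apply/eqP; field; rewrite gt_eqF //; move: P1; clear; lra.
have UW x : x \in U -> x \notin W by move=> xU; rewrite inE xU.
pose RE := stars W (fun x => Y (colW x)) :&: E.
have REE : RE \subset E by apply: subsetIr.
have REP x z : x \in W -> (pr x z \in RE) = (z \in Y (colW x)) && (pr x z \in E).
  move=> xW; rewrite in_setI; congr andb; apply/starsP/idP => [[x' [z' [xW' zY /pr_eq [[-> ->]|[ex ez]]]]]|h] //.
    by have := UW _ (subsetP (YU _) _ zY); rewrite -ex xW.
  by exists x, z.
have REU e' : e' \in RE -> ~~ (e' \subset U).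
  rewrite in_setI => /andP [/starsP [x [z [xW _ ->]]] _]; rewrite pr_sub negb_and.
  by move: xW; rewrite inE => /andP [->].
pose EU := inside E U.
have EUE : EU \subset E by apply: inside_sub.
pose Es := (E :\: RE) :\: EU.
have EsE : Es \subset E by apply: subset_trans (subsetDl _ _) (subsetDl _ _).
have [|||D1 [D1E D1d D1b]] := AL T Es V hn2.
- exact: simpleS EsE sE.
- by move=> e' he; apply: wE; apply: (subsetP EsE).
- move=> v vV.
  have h1 : (#|V :\: nb Es v| <= #|V :\: nb E v| + #|U| + #|[set x in W | v \in Y (colW x)]|)%N.
    apply: leq_trans (_ : #|(V :\: nb E v) :|: U :|: [set x in W | v \in Y (colW x)]| <= _)%N.
      apply/subset_leq_card/subsetP => x; rewrite in_setD in_nb => /andP [h xV].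
      rewrite !in_setU in_setD in_nb xV andbT.
      case: (boolP (x \in U)) => xU; first by rewrite orbT.
      have xW : x \in W by rewrite inE xU.
      case: (boolP (pr v x \in E)) => vxE //=.
      rewrite inE xW /=; move: h; rewrite !in_setD insideP vxE pr_sub (negbTE xU) andbF /= andbT negbK.
      by rewrite prC REP // => /andP [].
    by apply: leq_trans (leq_card_setU _ _) _; rewrite leq_add2r leq_card_setU.
  have h2 : #|V :\: nb Es v|%:R <= #|V :\: nb E v|%:R + M + #|[set x in W | v \in Y (colW x)]|%:R.
    by rewrite -!natrD ler_nat.
  apply: le_trans h2 _.
  have h3 : 2 * N / P <= e * N / 4.
    rewrite ler_pdivrMr; last by move: P1; clear; lra.
    by have := ler_wpM2r N0 he8; rewrite -/P; clear; lra.
  by have := mV v vV; have := dY v; move: h3 MN; clear; lra.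
pose H := Es :\: D1.
have HE : H \subset E by apply: subset_trans EsE; apply: subsetDl.
have sH : simple H := simpleS HE sE.
have HEs : H \subset Es by apply: subsetDl.
have HnR e' : e' \in H -> e' \notin RE.
  by move=> /(subsetP HEs); rewrite !in_setD => /and3P [].
have HnU e' : e' \in H -> ~~ (e' \subset U).
  by move=> he; have := subsetP HEs _ he; rewrite !in_setD insideP (subsetP HE _ he) => /andP [].
(* For each leftover edge an orientation with [a] outside [U] and a point are chosen. By [line_meet]
   the lines of two outside ends have a common point; if [b] is in [U], any point on the line of [a]
   will do. *)
have [tk htk] : exists tk : {set T} -> T * T * Pt, forall e', e' \in H ->
   let: (a, b, c) := tk e' in [/\ e' = pr a b, a != b, a \in W, on_line (colW a) c &
      (b \in U) \/ (b \in W /\ on_line (colW b) c)].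
  apply: (@fin_all_exists _ (fun=> T * T * Pt)%type (fun e' tk => e' \in H ->
   let: (a, b, c) := tk in [/\ e' = pr a b, a != b, a \in W, on_line (colW a) c &
      (b \in U) \/ (b \in W /\ on_line (colW b) c)])) => e'.
  have dH : e' \in H \/ ~ e' \in H by case: (e' \in H); [left|right].
  case: dH => he; last by exists (v0, v0, (None, 0)).
  have [a [b [ab ee]]] := simple_pr sH he.
  have wlg a' b' : e' = pr a' b' -> a' != b' -> a' \in W -> exists tk : T * T * Pt, e' \in H ->
     let: (a, b, c) := tk in [/\ e' = pr a b, a != b, a \in W, on_line (colW a) c &
      (b \in U) \/ (b \in W /\ on_line (colW b) c)].
    move=> ee' ab' aW; have [x hx] := line_meet (colW a') (colW b').
    exists (a', b', (x, line (colW a') x)) => _; split=> //; first by rewrite /on_line eqxx.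
    case: (boolP (b' \in U)) => bU; [by left|right]; split; last by rewrite /on_line /= hx.
    by rewrite inE bU; move: (wE _ (subsetP HE _ he)); rewrite ee' pr_sub => /andP [].
  have h1 := HnU _ he; have := wE _ (subsetP HE _ he); rewrite ee !pr_sub in h1 *; move: h1.
  rewrite negb_and => /orP [h|h] /andP [aV bV]; rewrite -ee.
    by apply: (wlg a b) => //; rewrite inE h.
  by apply: (wlg b a); rewrite ?inE ?h // 1?eq_sym // prC.
have [u' uu'] : exists u', adj u u'.
  have : (0 < #|neighbors u|)%N by move: (rF u); rewrite /degree => ->.
  by case/card_gt0P => x; rewrite inE; exists x.
have nuu' := adj_neq uu'.
pose L := pr u u'.
pose g e' (x : F) := if x == u then (tk e').1.1 else (tk e').1.2.
pose XX e' := PP (true, (tk e').2).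
(* Completions use the reserve and the edges inside [U]. The edges from an outside vertex to the
   class of a point on its line are all reserved, so nothing is lost by this restriction. *)
pose EA := RE :|: EU.
have gP e' x : e' \in H -> g e' x \in e'.
  move=> he; have := htk _ he; rewrite /g; case: (tk e') => [[a b] c] [-> _ _ _ _] /=.
  by case: ifP; rewrite in_pr eqxx ?orbT.
have HV e' x : e' \in H -> x \in e' -> x \in V.
  by move=> he; apply: (subsetP (wE _ (subsetP HE _ he))).
pose c1 := (k + w) * y.
have c10 : 0 <= c1 by rewrite mulr_ge0 // addr_ge0 // ltW.
have missU t' c : t' \in U -> #|PP c :\: nb EA t'|%:R <= c1.
  move=> tU; have tV := subsetP UV _ tU.
  apply: le_trans (PPm c t' tV); rewrite ler_nat; apply/subset_leq_card/subsetP => x.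
  rewrite in_setD in_nb => /andP [h /setIdP [xU xc]]; apply/setIdP; split=> //; rewrite in_setD xU andbT.
  by apply: contra h; rewrite in_nb in_setU insideP pr_sub tU xU => ->; rewrite orbT.
have missW t' c : t' \in W -> on_line (colW t') c -> #|PP (true, c) :\: nb EA t'|%:R <= c1.
  move=> tW hc; have tV := subsetP WV _ tW.
  apply: le_trans (PPm (true, c) t' tV); rewrite ler_nat; apply/subset_leq_card/subsetP => x.
  rewrite in_setD in_nb => /andP [h /setIdP [xU xc]]; apply/setIdP; split=> //; rewrite in_setD xU andbT.
  apply: contra h; rewrite in_nb in_setU REP // => ->.
  by rewrite inE xU (eqP xc) /onY hc.
have [cv1 cv2 cv3 cv4] : [/\ r%:R * (c1 + r%:R * (t1 ^+ 2 * N + t1 * N)) + 4 * #|F|%:R * (t1 * N) + #|F|%:R <= (1 - w) * y,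
      r%:R * (t1 ^+ 2 * N + t1 * N) <= 2 * r%:R * t1 * N,
      2 * r%:R * (((k + w) * s + 2 * r%:R * t1 * N) + r%:R * (2 * N / P ^+ 2) + (1 + w) * y) <=
         (1 - w) * s - (k + w) * s - 2 * r%:R * t1 * N &
      r%:R * (((k + w) * (M / 2) + 2 * r%:R * t1 * N) + r%:R * (2 * N / P) + r%:R * (2 * N / P + t * N)) + 4 * #|F|%:R * (t * N) + #|F|%:R
        <= (1 - w) * (M / 2)].
  exact: (@cover_arith R _ _ P e w t t1 G k N M y s).
have cH : #|H|%:R <= t1 ^+ 2 * N * N.
  have h1 := card_touch V sH.
  rewrite (_ : [set e' in H | [disjoint e' & V]] = set0) ?cards0 ?add0n in h1; last first.
    apply/setP => e'; rewrite in_set0; apply/negP => /setIdP [he /pred0P h].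
    have [a [b [_ ee]]] := simple_pr sH he; have := h a => /=.
    have ae : a \in e' by rewrite ee in_pr eqxx.
    by rewrite ae (HV e').
  apply: le_trans (_ : (\sum_(v in V) dg H v)%N%:R <= _); first by rewrite ler_nat.
  have -> : t1 ^+ 2 * N * N = \sum_(v in V) t1 ^+ 2 * N by rewrite sumr_const -mulr_natr.
  by rewrite natr_sum; apply: ler_sum => v _; apply: D1b.
(* [H] has at most [t1^2 N^2] edges and degrees at most [t1^2 N], whence [s = t1 N] and
   [m = 4 #|F| t1 N]. *)
have [||||||||||f [f1' f2' f3']] := @pack_real R F r rF T _ H (fun=> L) g XX EA c1 (t1 ^+ 2 * N) (t1 * N) (4 * #|F|%:R * (t1 * N)).
- move=> e' he x z; rewrite !in_pr /g; have := htk _ he; case: (tk e') => [[a b] c] [_ nab _ _ _] /=.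
  by case/orP => /eqP -> /orP [] /eqP -> //; rewrite eqxx [u' == u]eq_sym (negbTE nuu') => h; move: nab; rewrite h eqxx.
- move=> e' x he _; have := htk _ he; rewrite /XX /g; case: (tk e') => [[a b] c] [_ _ aW ac hb] /=.
  case: ifP => _; first exact: missW.
  by case: hb => [bU|[bW bc]]; [apply: missU|apply: missW].
- by move=> e' t' he; rewrite inE => /andP [tU _]; apply: missU.
- move=> t'; apply: le_trans (D1b t'); rewrite ler_nat; apply: leq_trans (card_edges_at t' sH).
  apply/subset_leq_card/subsetP => e' /setIdP [he /imsetP [x _ ->]].
  by apply/setIdP; split; rewrite ?gP.
- exact: c10.
- by rewrite mulr_ge0 // exprn_ge0 // ltW.
- exact: t1N.
- have := ler_pM ler01 ler01 f1 t1N; clear; lra.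
- have h0 : 0 <= 4 * #|F|%:R :> R by rewrite mulr_ge0 ?ler0n.
  have := ler_wpM2l h0 cH; clear; lra.
- by move=> e' he; apply: le_trans (PPl _).
pose N2 := \bigcup_(e' in H) newE L (f e').
have N2EA : N2 \subset EA by apply/bigcupsP => e' he; have [_ _ _ h] := f1' e' he.
have N2b v : (dg N2 v)%:R <= 2 * r%:R * t1 * N by apply: le_trans (f3' v) _.
pose D2 := H :|: N2.
have HEA : [disjoint H & EA].
  rewrite disjoint_subset; apply/subsetP => e' he.
  by rewrite inE in_setU negb_or HnR // insideP negb_and HnU // orbT.
have EsEA : [disjoint Es & EA].
  rewrite disjoint_subset; apply/subsetP => e'; rewrite !in_setD => /and3P [h1 h2 _].
  by rewrite inE in_setU negb_or h2 h1.
have newEA e' : e' \in H -> newE L (f e') \subset EA by move=> he; have [] := f1' e' he.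
have fE e' : e' \in H -> e' = pr (f e' u) (f e' u').
  move=> he; have [_ fg _ _] := f1' e' he.
  rewrite !fg ?in_pr ?eqxx ?orbT // /g eqxx [u' == u]eq_sym (negbTE nuu').
  by have := htk _ he; case: (tk e') => [[a b] c] [].
have imgf e' : e' \in H -> img (f e') = e' |: newE L (f e').
  move=> he; apply/setP => e''; rewrite in_setU1; apply/imgP/orP => [[x [z [xz ->]]]|[/eqP ->|]].
  - case: (boolP (x \in L)) => xL; last by right; apply/newEP; exists x, z.
    case: (boolP (z \in L)) => zL; last by right; apply/newEP; exists z, x; rewrite prC adj_sym.
    left; rewrite [X in _ == X](fE e' he); have := adj_neq xz.
    move: xL zL; rewrite !in_pr => /orP [] /eqP -> /orP [] /eqP ->; rewrite ?eqxx //.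
    by rewrite prC.
  - by exists u, u'; rewrite uu' -fE.
  - by move=> /(subsetP (newE_img _ _)) /imgP.
have D2E : D2 = \bigcup_(e' in H) img (f e').
  apply/setP => e'; rewrite in_setU; apply/orP/bigcupP => [[he|/bigcupP [i iH h]]|[i iH]].
  - by exists e'; rewrite // imgf // setU11.
  - by exists i; rewrite // imgf // in_setU1 h orbT.
  - rewrite imgf // in_setU1 => /orP [/eqP ->|h]; [by left|right].
    by apply/bigcupP; exists i.
have D2d : dec F D2.
  rewrite D2E; apply: dec_bigcup => [i iH|i j iH jH nij].
    by apply: dec_img; [apply: edges_gt0 rF r0|have [] := f1' i iH].
  have HN i' j' : i' \in H -> j' \in H -> i' \notin newE L (f j').
    by move=> hi hj; apply: (contraTN _ hi) => /(subsetP (newEA _ hj)) h; rewrite (disjointFl HEA).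
  rewrite !imgf // disjointUl !disjointUr !disjoints1 in_set1 nij disjoint_sym disjoints1 !HN //=.
  exact: f2'.
have D1EA : [disjoint D1 & EA] := disjointWl D1E EsEA.
have N2E : N2 \subset E by apply: subset_trans N2EA _; rewrite subUset REE EUE.
have D2sE : D2 \subset E by rewrite subUset HE N2E.
have D12 : [disjoint D1 & D2].
  rewrite disjointUr (disjointWr N2EA D1EA) andbT disjoint_sym.
  by rewrite disjoint_subset; apply/subsetP => e'; rewrite inE in_setD => /andP [].
have D12d : dec F (D1 :|: D2) by apply: decU.
have D12E : D1 :|: D2 \subset E by rewrite subUset D2sE andbT; apply: subset_trans EsE.
pose Lw w := nb (RE :\: N2) w.
have LwE x z : x \in W -> (z \in Lw x) = [&& z \in Y (colW x), pr x z \in E & pr x z \notin N2].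
  by move=> xW; rewrite in_nb in_setD REP // andbC andbA.
have LwU x : x \in W -> Lw x \subset U.
  by move=> xW; apply/subsetP => z; rewrite LwE // => /and3P [/(subsetP (YU _))].
have starE : stars W Lw = RE :\: N2.
  apply/setP => e'; apply/starsP/idP => [[x [z [xW h ->]]]|]; first by rewrite -in_nb.
  move=> h; have := h; rewrite in_setD in_setI => /and3P [_ /starsP [x [z [xW _ ee]]] _].
  by exists x, z; split=> //; rewrite in_nb -ee.
pose E4 := EU :\: N2.
(* At an outside vertex every edge except a remaining reserved one is now covered. As [r] divides
   both the original degree and the covered part, it divides [#|Lw v|]. *)
have restE v : v \in W -> nb (E :\: (D1 :|: D2)) v = Lw v.
  move=> vW; apply/setP => x; rewrite !in_nb.
  have vU : v \notin U by move: vW; rewrite inE => /andP [].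
  have nEU : pr v x \notin EU by rewrite insideP pr_sub (negbTE vU) andbF.
  apply/idP/idP; rewrite !in_setD !in_setU !negb_or.
    move=> /andP [/and3P [nD1 nH nN2] xE]; rewrite nN2 /=.
    move: nH; rewrite !in_setD nD1 nEU xE /= andbT negbK //.
  move=> /andP [nN2 xRE]; rewrite nN2 (subsetP REE _ xRE) !andbT.
  have nEs : pr v x \notin Es by rewrite !in_setD xRE /= andbF.
  by rewrite (contra (subsetP D1E _) nEs) (contra (subsetP HEs _) nEs).
have missN v (Q : {set T}) (b : R) : #|Q :\: nb E v|%:R <= b -> #|Q :\: nb (E :\: N2) v|%:R <= b + 2 * r%:R * t1 * N.
  move=> h; apply: le_trans (_ : (#|Q :\: nb E v| + dg N2 v)%N%:R <= _); first by rewrite ler_nat missD.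
  by rewrite natrD lerD.
have missE4 v (Q : {set T}) (b : R) : v \in U -> Q \subset U -> #|Q :\: nb E v|%:R <= b ->
    #|Q :\: nb E4 v|%:R <= b + 2 * r%:R * t1 * N.
  move=> vU QU /missN h; apply: le_trans h; rewrite ler_nat; apply/subset_leq_card/subsetP => x.
  rewrite !in_setD !in_nb => /andP [h xQ]; rewrite xQ andbT; apply: contra h.
  by rewrite !in_setD insideP pr_sub vU (subsetP QU _ xQ) /= andbT.
have P0 : 0 < P by apply: lt_le_trans P1.
have rt1N0 : 0 <= 2 * r%:R * t1 * N.
  by rewrite mulr_ge0 // mulr_ge0 ?(ltW t10) // mulr_ge0 ?ler0n.
have NP0 : 0 <= 2 * N / P by rewrite divr_ge0 ?mulr_ge0 // ltW.
have sE4 : simple E4 by apply: simpleS sE; apply: subset_trans (subsetDl _ _) EUE.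
have dLw v : #|[set w' in W | v \in Lw w']|%:R <= 2 * N / P.
  apply: le_trans (dY v); rewrite ler_nat; apply/subset_leq_card/subsetP => x /setIdP [xW].
  by rewrite LwE // => /and3P [h _ _]; apply/setIdP.
have LwUx x z : x \in W -> z \in Lw x -> z \in U by move=> xW; apply: (subsetP (LwU _ xW)).
(* Centres are similar when they have the same line, which holds for at most [2 * N / P ^+ 2] of
   them at a time. Distinct lines share only one point, so what dissimilar centres contest at a
   vertex lies in the class of that vertex, of size at most [(1 + w) * y]. *)
have [||||||||||||||||D3 [D3d D3s D3E D3b]] := @star_cover_real R F r u rF r0 T E4 W Lw
   (fun x z => colW x == colW z) X ((k + w) * s + 2 * r%:R * t1 * N) (2 * N / P ^+ 2) ((1 + w) * y)
   ((k + w) * (M / 2) + 2 * r%:R * t1 * N) (2 * N / P) (t * N) (4 * #|F|%:R * (t * N)) sE4.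
- move=> x xW; rewrite -restE //; have : (r %| dg E x)%N by apply: rdv.
  rewrite -/(dg _ x) dgD // => h; rewrite dvdn_sub //; exact: dec_dg rF D12d.
- by move=> x z xW zW; apply: contraTN xW => /(LwUx _ _ zW) /UW.
- rewrite disjoint_subset; apply/subsetP => e' /starsP [x [z [xW _ ->]]].
  by rewrite inE in_setD insideP pr_sub !negb_and; move: xW; rewrite inE => /andP [-> _]; rewrite !orbT.
- move=> x z xW zL; have zU := LwUx _ _ xW zL.
  apply: le_trans (missE4 z (Y (colW x)) _ zU (YU _) (Ym _ _ (subsetP UV _ zU))).
  rewrite ler_nat; apply/subset_leq_card/setSD/subsetP => z'.
  by rewrite LwE // => /and3P [].
- move=> x z xW zL; apply: le_trans (QQ (colW x)); rewrite ler_nat; apply/subset_leq_card/subsetP => z'.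
  by move=> /setIdP [h1 /andP [_ /eqP h2]]; apply/setIdP; rewrite h1 h2.
- move=> x z xW zL; apply: le_trans (PPu (col z)); rewrite ler_nat; apply/subset_leq_card/subsetP => z'.
  move=> /setIdP [z'L /existsP [x' /and4P [x'W nx zL' z'L']]].
  have getY a b : a \in W -> b \in Lw a -> [/\ b \in U, (col b).1 & on_line (colW a) (col b).2].
    by move=> aW; rewrite LwE // => /and3P [/setIdP [h1 /andP [h2 h3]] _ _].
  have [zU z1 z2] := getY _ _ xW zL; have [_ _ z3] := getY _ _ x'W zL'.
  have [z'U z'1 z'2] := getY _ _ xW z'L; have [_ _ z'3] := getY _ _ x'W z'L'.
  apply/setIdP; split=> //; move: z2 z3 z'2 z'3; rewrite /on_line => /eqP z2 /eqP z3 /eqP z'2 /eqP z'3.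
  have ec : (col z').2.1 = (col z).2.1.
    apply/eqP; case: eqP => // /eqP nc; case/negP: nx; apply/eqP.
    by apply: (line_uniq nc); rewrite -?z2 -?z'2.
  apply/eqP; apply: injective_projections; first by rewrite z1 z'1.
  by apply: injective_projections => //; rewrite z2 z'2 ec.
- move=> x xW; apply: le_trans cv3 _; have xV := subsetP WV _ xW.
  have h1 := missN x (Y (colW x)) _ (Ym (colW x) x xV).
  have h2 : #|Y (colW x)|%:R <= #|Y (colW x) :\: nb (E :\: N2) x|%:R + #|Lw x|%:R :> R.
    rewrite -natrD ler_nat -(cardsID (nb (E :\: N2) x)) addnC leq_add2l; apply/subset_leq_card/subsetP => z.
    by rewrite in_setI in_nb in_setD LwE // => /and3P [-> -> ->].
  by move: h1 h2 (Yl (colW x)); clear; lra.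
- exact: dLw.
- by move=> x z xW /(LwUx _ _ xW) zU; apply: missE4 => //; apply: Xm; apply: (subsetP UV).
- by move=> x /(subsetP XU) xU; apply: missE4 => //; apply: Xm; apply: (subsetP UV).
- by rewrite addr_ge0 // mulr_ge0 ?divr_ge0 ?addr_ge0 // ltW.
- exact: NP0.
- exact: tN.
- have := ler_pM ler01 ler01 f1 tN; clear; lra.
- have h1 : (\sum_(w' in W) #|Lw w'|)%N%:R <= M * (2 * N / P).
    have -> : (\sum_(w' in W) #|Lw w'| = \sum_(v in U) #|[set w' in W | v \in Lw w']|)%N.
      under eq_bigr do rewrite -sum1_card.
      under [RHS]eq_bigr do rewrite -sum1_card.
      rewrite (exchange_big_dep (mem U)) /=; last by move=> x z xW; apply: LwUx.
      by apply: eq_bigr => v _; apply: eq_bigl => x; rewrite inE.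
    have -> : M * (2 * N / P) = \sum_(v in U) (2 * N / P) by rewrite sumr_const -[RHS]mulr_natl.
    by rewrite natr_sum; apply: ler_sum => v _.
  have h2 : M * (2 * N / P) <= (t * N) ^+ 2.
    rewrite mulrA ler_pdivrMr //.
    have N20 : 0 <= N ^+ 2 by rewrite exprn_ge0.
    have := ler_wpM2r N20 hPt; rewrite -/P.
    have := ler_wpM2r N0 M2N; have : 0 <= N * N by rewrite mulr_ge0.
    by clear; lra.
  have f0 : 0 <= 4 * #|F|%:R :> R by rewrite mulr_ge0 ?ler0n.
  have := ler_wpM2l f0 (le_trans h1 h2); clear; lra.
- by apply: le_trans Xl.
have D3sub : D3 \subset (RE :\: N2) :|: (EU :\: N2) by rewrite -starE.
have D3N : D3 \subset EA :\: N2 by rewrite setDUl.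
have D3EE : D3 \subset E.
  by apply: subset_trans D3N _; apply: subset_trans (subsetDl _ _) _; rewrite subUset REE EUE.
have D123 : [disjoint D1 :|: D2 & D3].
  rewrite !disjointUl; apply/and3P; split.
  - by apply: disjointWr D1EA; apply: subset_trans D3N (subsetDl _ _).
  - by apply: disjointWr HEA; apply: subset_trans D3N (subsetDl _ _).
  - apply: disjointWr D3N _; rewrite disjoint_sym disjoint_subset; apply/subsetP => e'.
    by rewrite in_setD => /andP [].
exists ((D1 :|: D2) :|: D3); split.
- by rewrite subUset D12E.
- exact: decU.
- move=> e'; rewrite in_setD !in_setU !negb_or => /andP [/andP [/and3P [n1 nH nN2] n3'] eE].
  case: (boolP (e' \in RE)) => eR.
    by case/negP: n3'; apply: (subsetP D3s); rewrite starE in_setD nN2.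
  case: (boolP (e' \in EU)) => eU; first by move: eU; rewrite insideP => /andP [].
  by case/negP: nH; rewrite !in_setD n1 eU eR.
move=> v.
have h1 : (dg (inside ((D1 :|: D2) :|: D3) U) v <= dg N2 v + dg (D3 :&: E4) v)%N.
  apply: leq_trans (dgU N2 (D3 :&: E4) v); apply: dgS; apply/subsetP => e'.
  rewrite insideP !in_setU => /andP [/orP [/or3P [h|h|h]|h] eU].
  - have := subsetP D1E _ h; rewrite !in_setD insideP eU andbT => /and3P [h1 _ h2].
    by rewrite h2 in h1.
  - by have := HnU _ h; rewrite eU.
  - by rewrite h.
  - rewrite in_setI h; have := subsetP D3sub _ h; rewrite in_setU => /orP [|-> //]; last by rewrite orbT.
    by rewrite in_setD => /andP [_ /REU]; rewrite eU.
apply: le_trans (_ : (dg N2 v + dg (D3 :&: E4) v)%N%:R <= _); first by rewrite ler_nat.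
rewrite natrD; have := D3b v; have := N2b v.
have h2 : (2 * r%:R * t1 + r%:R * t) * N + 4 * r%:R * N / P <= mu * M.
  have c0 : 0 <= 2 * r%:R * t1 + r%:R * t by rewrite addr_ge0 ?mulr_ge0 ?ler0n ?ltW.
  have c1' : 0 <= 4 * r%:R :> R by rewrite mulr_ge0 ?ler0n.
  have g1 := ler_wpM2l c0 NG.
  have g2 : 4 * r%:R * N / P <= 4 * r%:R * (G * M) / P.
    by rewrite ler_wpM2r ?invr_ge0 ?(ltW P0) // ler_wpM2l.
  apply: le_trans (lerD g1 g2) _; rewrite -(ler_pM2r P0) mulrDl divfK ?gt_eqF //.
  by have := ler_wpM2r M0 hmu; rewrite -/P; clear; lra.
by move: h2; clear; lra.
Qed.

Lemma ex_small (R : realType) (a b c : R) : 0 <= a -> 0 <= b -> 0 <= c ->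
  exists t : R, [/\ 0 < t, t <= 1, a * t <= 1, b * t <= 1 & c * t <= 1].
Proof.
move=> a0 b0 c0; have d0 : 0 < 1 + a + b + c by move: a0 b0 c0; clear; lra.
exists (1 + a + b + c)^-1; split; rewrite ?invr_gt0 // ?ler_pdivrMr ?invf_le1 //;
  move: a0 b0 c0; clear; lra.
Qed.

Lemma ex_prime (R : realType) (x : R) : exists2 p : nat, prime p & x <= p%:R.
Proof.
have [N hN] := ex_nat_ge x; have [p Np pp] := prime_above N.
by exists p => //; apply: hN; apply: ltnW.
Qed.

Definition covers_down (R : realType) (F : sgraph) (r : nat) (G e mu k : R) (n : nat) :=
  forall (T : finType) (E : {set {set T}}) (V U : {set T}),
   (n <= #|V|)%N -> simple E -> (forall e, e \in E -> e \subset V) -> U \subset V ->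
   #|V|%:R <= G * #|U|%:R -> 4 * #|U|%:R <= e * #|V|%:R ->
   (forall v, v \in V -> #|V :\: nb E v|%:R <= k * #|V|%:R) ->
   (forall v, v \in V -> #|U :\: nb E v|%:R <= k * #|U|%:R) ->
   (forall v, v \in V :\: U -> (r %| dg E v)%N) ->
   exists D : {set {set T}}, [/\ D \subset E, dec F D,
     forall e, e \in E :\: D -> e \subset U &
     forall v, (dg (inside D U) v)%:R <= mu * #|U|%:R].

(** The constants are found in the order [w], [t], the prime [p], [t1], a second prime [p'] for the
    blocks, [b], and finally [eta = b^4]. None depends on [k] or [n1], which become known only after
    the threshold for [eta]. *)
Lemma cover_down (R : realType) (F : sgraph) (r : nat) (u : F) (G e mu : R) :
  regular r F -> (0 < r)%N -> 0 < e -> 1 <= G -> 0 < mu ->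
  exists2 eta : R, 0 < eta & forall k n1, 0 <= k -> 3 * r%:R * (k + e) <= 1 ->
    approx_pack F eta (k + e) n1 -> exists n3, covers_down F r G e mu k n3.
Proof.
move=> rF r0 e0 G1 mu0.
have r1 : 1 <= r%:R :> R by rewrite ler1n.
have r00 : 0 <= r%:R :> R by rewrite ler0n.
have f0 : 0 <= #|F|%:R :> R by rewrite ler0n.
have G0 : 0 <= G by move: G1; clear; lra.
have r2 : 0 <= r%:R ^+ 2 :> R by rewrite exprn_ge0.
have [w [w0 _ hw _ _]] := @ex_small R (16 * r%:R / e) 0 0 (divr_ge0 (mulr_ge0 (ler0n R 16) r00) (ltW e0)) (lexx 0) (lexx 0).
have A0 : 0 <= 64 * (r%:R ^+ 2 + #|F|%:R) * G by rewrite !mulr_ge0 ?addr_ge0.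
have B0 : 0 <= 4 * r%:R * G / mu by rewrite divr_ge0 ?mulr_ge0 // ltW.
have [t [t0 _ ht ht' _]] := @ex_small R _ _ 0 A0 B0 (lexx 0).
have t2 : 0 < t ^+ 2 by rewrite exprn_gt0.
have [p pp hp] := @ex_prime R ((t ^+ 2)^-1 + 8 / e + 16 * r%:R ^+ 2 * G / e + 16 * r%:R * G / mu).
set P : R := p%:R in hp.
have P1 : 1 <= P by rewrite ler1n prime_gt0.
have P0 : 0 <= P by move: P1; clear; lra.
have x1 : 0 <= (t ^+ 2)^-1 by rewrite invr_ge0 ltW.
have x2 : 0 <= 8 / e by rewrite divr_ge0 // ltW.
have x3 : 0 <= 16 * r%:R ^+ 2 * G / e by rewrite divr_ge0 ?mulr_ge0 // ltW.
have x4 : 0 <= 16 * r%:R * G / mu by rewrite divr_ge0 ?mulr_ge0 // ltW.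
have p1 : 1 <= P * t ^+ 2 by rewrite -ler_pdivrMr // mul1r; move: x1 x2 x3 x4 hp; clear; lra.
have p2 : 8 <= e * P by rewrite mulrC -ler_pdivrMr //; move: x1 x2 x3 x4 hp; clear; lra.
have p3 : 16 * r%:R ^+ 2 * G <= e * P by rewrite [e * P]mulrC -ler_pdivrMr //; move: x1 x2 x3 x4 hp; clear; lra.
have p4 : 16 * r%:R * G <= mu * P by rewrite [mu * P]mulrC -ler_pdivrMr //; move: x1 x2 x3 x4 hp; clear; lra.
have A1 : 0 <= 12 * r%:R ^+ 2 * G * P / e by rewrite divr_ge0 ?mulr_ge0 // ltW.
have B1 : 0 <= 64 * (r%:R ^+ 2 + #|F|%:R) * G * (P * (P + 1)).
  by rewrite mulr_ge0 // mulr_ge0 // addr_ge0.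
have C1 : 0 <= 8 * r%:R * G / mu by rewrite divr_ge0 ?mulr_ge0 // ltW.
have [t1 [t10 t11 h1 h2 h3]] := ex_small A1 B1 C1.
have t12 : 0 < t1 ^+ 2 by rewrite exprn_gt0.
have [p' pp' hp'] := @ex_prime R (8 / t1 ^+ 2 + 32 / e).
set P' : R := p'%:R in hp'.
have P'0 : 0 <= P' by rewrite ler0n.
have y1 : 0 <= 8 / t1 ^+ 2 by rewrite divr_ge0 // ltW.
have y2 : 0 <= 32 / e by rewrite divr_ge0 // ltW.
have p'1 : 8 <= t1 ^+ 2 * P' by rewrite mulrC -ler_pdivrMr //; move: y1 y2 hp'; clear; lra.
have p'2 : 16 <= e / 2 * P'.
  have : 32 <= P' * e by rewrite -ler_pdivrMr //; move: y1 y2 hp'; clear; lra.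
  by clear; lra.
have A2 : 0 <= 4 * (3 * r%:R ^+ 2 + 4 * #|F|%:R + 1) :> R by move: r2 f0; clear; lra.
have B2 : 0 <= 32 * r%:R ^+ 2 / e by rewrite divr_ge0 ?mulr_ge0 // ltW.
have C2 : 0 <= 192 * P' / t1 ^+ 2 by rewrite divr_ge0 ?mulr_ge0 // ltW.
have [b [b0 b1 g1 g2 g3]] := ex_small A2 B2 C2.
exists (b ^+ 4) => [|k n1 k0 hk AP]; first by rewrite exprn_gt0.
have hk' : 3 * r%:R * (k + e / 2 + e / 2) <= 1 by rewrite -addrA -splitr.
have [||||||||n2 AL] := @approx_core R F r u p' (e / 2) (t1 ^+ 2) b (k + e / 2) n1 rF r0 pp' b0 _ t12 _ hk'.
- by move: e0; clear; lra.
- by move: e0 k0; clear; lra.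
- by move: g1; clear; lra.
- move: g2; rewrite mulrAC ler_pdivrMr //; clear; lra.
- move: g3; rewrite mulrAC ler_pdivrMr // mul1r => g3; apply: le_trans g3; rewrite -/P' expr2 mulrA.
  by rewrite -[X in _ <= X]mulr1 ler_wpM2l // !mulr_ge0 // ltW.
- exact: p'1.
- exact: p'2.
- by rewrite -addrA -splitr.
apply: (@cover_down_core R F r u p e w t t1 G mu k n2) => //.
- by move: hw; rewrite mulrAC ler_pdivrMr // mul1r.
- by move: h1; rewrite mulrAC ler_pdivrMr // -/P; clear; lra.
- by move: h2; rewrite -/P; clear; lra.
- by move: ht; clear; lra.
rewrite -/P.
move: ht'; rewrite mulrAC ler_pdivrMr // => ht'.
move: h3; rewrite mulrAC ler_pdivrMr // => h3.
have := mulr_ge0 (ltW mu0) P0; have := ler_wpM2r P0 ht'; have := ler_wpM2r P0 h3; move: p4; clear; lra.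
Qed.

(** * Vortices *)

(** The set is one class of a colouring with [K] colours and error [a = 1 / s], where [s] is the
    fourth root of [#|U|]. Then [a^2 #|U| = s^2] is large enough for the exponential bound, while
    densities lose only a multiple of [1 / s]. *)
Lemma vortex_step (R : realType) (K : nat) (T : finType) (E : {set {set T}}) (U : {set T}) (k s : R) :
  (1 < K)%N -> s ^+ 4 = #|U|%:R -> 6144 * K%:R + 2 * K%:R ^+ 2 + 1 <= s -> 0 <= k -> k <= 1 ->
  (forall v, v \in U -> #|U :\: nb E v|%:R <= k * #|U|%:R) ->
  exists U' : {set T}, [/\ U' \subset U, #|U|%:R <= 2 * K%:R * #|U'|%:R :> R,
    K%:R * #|U'|%:R <= 2 * #|U|%:R :> R &
    forall v, v \in U -> #|U' :\: nb E v|%:R <= (k + 2 * K%:R * (K%:R + 1) / s) * #|U'|%:R].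
Proof.
case: K => // K' K1; set K := K'.+1 in K1 *; set KR : R := K%:R.
have KR2 : 2 <= KR by rewrite ler_nat.
move=> s4 hs k0 k1 mU; set n : R := #|U|%:R in s4 mU *.
have KK : 0 <= KR ^+ 2 by rewrite exprn_ge0 //; move: KR2; clear; lra.
have s1 : 1 <= s by move: hs KK KR2; clear; lra.
have s0 : 0 < s by apply: lt_le_trans s1.
have sn : s != 0 by rewrite gt_eqF.
have n1 : 1 <= n by rewrite -s4 exprn_ege1.
have n0 : 0 <= n by apply: le_trans n1.
pose a := s^-1.
have a0 : 0 < a by rewrite invr_gt0.
have a1 : a <= 1 by rewrite invf_le1.
have [|||c hc] := @coloring R T 'I_K (option 'I_#|U|) U
    (fun o => oapp (fun i => U :\: nb E (enum_val i)) U o) a a0 a1.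
- by case=> [i|] //=; apply: subsetDl.
- by rewrite card_ord.
- rewrite card_option !card_ord -/KR -/n.
  have -> : a ^+ 2 * n / 8 = s ^+ 2 / 8 by rewrite -s4 /a; field.
  have y0 : 0 <= s ^+ 2 / 8 by rewrite divr_ge0 // exprn_ge0 // ltW.
  rewrite expRN ltr_pdivrMr ?expR_gt0 // mul1r.
  (* The cubic term of the exponential series gives [s^6 / 3072], which beats [s^4 + 1] sets times
     [K] colours. *)
  apply: lt_le_trans (expR_ge1Dxn 2 y0).
  have -> : (3`!)%:R = 6 :> R by [].
  rewrite -natr1 -/n -s4.
  have e1 : (s ^+ 2 / 8) ^+ 3 / 6 = s ^+ 4 * (s * s) / 3072 by field.
  rewrite e1.
  have h1 : s ^+ 4 * (6144 * KR) <= s ^+ 4 * (s * s).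
    rewrite ler_wpM2l ?exprn_ge0 ?(ltW s0) // -[X in X <= _]mulr1.
    by apply: ler_pM => //; move: hs KK KR2; clear; lra.
  have h2 : 1 * KR <= s ^+ 4 * KR.
    by rewrite ler_wpM2r ?s4 //; move: KR2; clear; lra.
  by move: h1 h2; clear; lra.
pose U' := [set x in U | c x == ord0].
have an : a * n <= n / (2 * KR ^+ 2).
  rewrite mulrC ler_wpM2l // lef_pV2 ?posrE //; last by rewrite mulr_gt0 // exprn_gt0 //; move: KR2; clear; lra.
  by move: hs KR2; clear; lra.
have KR0 : 0 < KR by move: KR2; clear; lra.
have KRn : KR != 0 by rewrite gt_eqF.
have anK : KR * (a * n) <= n / (2 * KR).
  apply: le_trans (ler_wpM2l (ltW KR0) an) _; rewrite le_eqVlt; apply/orP; left; apply/eqP; field.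
  by rewrite KRn.
have an0 : 0 <= a * n by rewrite mulr_ge0 // ltW.
have up i : #|[set x in U | c x == i]|%:R <= n / KR + a * n.
  by have := hc None i; rewrite /= card_ord.
have lo2 : n / KR <= #|U'|%:R + KR * (a * n).
  have tot : n = \sum_(i : 'I_K) #|[set x in U | c x == i]|%:R.
    have := card_col U c predT => /(congr1 (fun m => m%:R : R)).
    rewrite natr_sum => <-; congr _%:R; apply: eq_card => x; rewrite inE andbT //.
  rewrite (bigD1 ord0) //= in tot.
  have h : \sum_(i : 'I_K | i != ord0) (#|[set x in U | c x == i]|%:R : R) <= (KR - 1) * (n / KR + a * n).
    apply: le_trans (_ : \sum_(i : 'I_K | i != ord0) (n / KR + a * n) <= _).
      by apply: ler_sum => i _.
    rewrite sumr_const -[X in X <= _]mulr_natl.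
    have -> : #|(fun j : 'I_K => j != ord0)| = K.-1.
      by rewrite -[in RHS](card_ord K) -(cardC1 (ord0 : 'I_K)); apply: eq_card.
    by rewrite /KR -natr1 addrK.
  have e2 : (KR - 1) * (n / KR + a * n) = n - n / KR + KR * (a * n) - a * n.
    by field.
  by move: tot h; rewrite e2 -/U'; move: an0; clear; lra.
have lo : n / (2 * KR) <= #|U'|%:R.
  have e3 : n / KR = 2 * (n / (2 * KR)) by field.
  by move: lo2 anK e3; clear; lra.
have lo' : n <= 2 * KR * #|U'|%:R.
  by move: lo; rewrite ler_pdivrMr ?mulr_gt0 // mulrC.
exists U'; split=> //.
- by apply/subsetP => x; rewrite inE => /andP [].
- have h1 := ler_wpM2l (ltW KR0) (up ord0); rewrite mulrDr mulrCA mulfV // mulr1 -/U' in h1.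
  have : n / (2 * KR) <= n / 1 by rewrite ler_wpM2l // lef_pV2 ?posrE ?mulr_gt0 //; move: KR2; clear; lra.
  by move: h1 anK; clear; lra.
- move=> v vU; have := hc (Some (enum_rank_in vU v)) ord0.
  rewrite /= enum_rankK_in // card_ord -/KR => h.
  have -> : U' :\: nb E v = [set x in U :\: nb E v | c x == ord0].
    by apply/setP => x; rewrite !inE andbA.
  apply: le_trans h _.
  have h1 : #|U :\: nb E v|%:R / KR <= k * (n / KR).
    by rewrite mulrA ler_wpM2r ?invr_ge0 ?(ltW KR0) //; apply: mU.
  have h3 := ler_wpM2l k0 lo2.
  have Kan0 : 0 <= KR * (a * n) by rewrite mulr_ge0 // ltW.
  have h4 : k * (KR * (a * n)) <= KR * (a * n) by rewrite -[X in _ <= X]mul1r ler_wpM2r.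
  have h5 : (KR + 1) * (a * n) <= 2 * KR * (KR + 1) / s * #|U'|%:R.
    have c0 : 0 <= (KR + 1) * a by rewrite mulr_ge0 ?addr_ge0 // ltW.
    by have := ler_wpM2l c0 lo'; rewrite /a; clear; lra.
  by move: h1 h3 h4 h5; clear; lra.
Qed.

(** Degrees into [U'] are prescribed for all vertices of the preceding set [U], because a step
    covers the edges at the vertices of [U] outside [U']. *)
Fixpoint chain (R : realType) (T : finType) (E : {set {set T}}) (K : nat) (k : R) (n : nat)
    (U : {set T}) (c : seq {set T}) : Prop :=
  if c is U' :: c' then
    [/\ (n <= #|U|)%N, U' \subset U, #|U|%:R <= 2 * K%:R * #|U'|%:R :> R,
      K%:R * #|U'|%:R <= 2 * #|U|%:R :> R &
      forall v, v \in U -> #|U' :\: nb E v|%:R <= k * #|U'|%:R] /\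
    chain E K k n U' c'
  else True.

(* A step costs O(|U| ^ (-1/4)) in the density; these errors form a geometric series
   dominated by its last term. *)
Lemma vortex (R : realType) (K n : nat) (d : R) : (32 <= K)%N -> 0 < d ->
  exists m : nat, forall (T : finType) (E : {set {set T}}) (U : {set T}) (k : R),
  0 <= k -> k + d <= 1 -> (forall v, v \in U -> #|U :\: nb E v|%:R <= k * #|U|%:R) ->
  exists c, chain E K (k + d) n U c /\ (#|last U c| <= m)%N.
Proof.
move=> K32 d0; set KR : R := K%:R.
have KR32 : 32 <= KR by rewrite ler_nat.
have K1 : (1 < K)%N by apply: leq_trans K32.
pose c := 2 * KR * (KR + 1).
have c0 : 0 <= c by rewrite /c !mulr_ge0 //; move: KR32; clear; lra.
have KK : 0 <= KR ^+ 2 by rewrite exprn_ge0 //; move: KR32; clear; lra.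
pose s0 := 6144 * KR + 2 * KR ^+ 2 + 1 + 3 * c / d.
have cd0 : 0 <= 3 * c / d by rewrite divr_ge0 ?(ltW d0) // mulr_ge0.
have s00 : 0 < s0 by rewrite /s0; move: KK cd0 KR32; clear; lra.
have [m0 hm0] := @ex_nat_ge R (s0 ^+ 4 + n%:R).
exists m0 => T E U k k0 kd mU.
(* The loss so far is at most [2 c / s], twice the loss of the next step. This is preserved since
   [s] at least halves, and the term [3 * c / d] in [s0] keeps the total below [d]. *)
suff key : forall (N : nat) (W : {set T}) (s : R), (#|W| < N)%N -> 0 < s -> s ^+ 4 = #|W|%:R ->
    (forall v, v \in W -> #|W :\: nb E v|%:R <= (k + 2 * c / s) * #|W|%:R) ->
    exists cc, chain E K (k + d) n W cc /\ (#|last W cc| <= m0)%N.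
  case: (set_0Vmem U) => [->|[x xU]]; first by exists [::]; rewrite /= cards0.
  have U0 : 0 < (#|U|%:R : R) by rewrite ltr0n; apply/card_gt0P; exists x.
  pose s := Num.sqrt (Num.sqrt (#|U|%:R : R)).
  have s1 : 0 < s by rewrite !sqrtr_gt0.
  have s4 : s ^+ 4 = #|U|%:R by rewrite (exprM s 2 2) !sqr_sqrtr ?sqrtr_ge0 ?ler0n.
  apply: (key _ U s (leqnn _) s1 s4) => v vU; apply: le_trans (mU v vU) _.
  by rewrite ler_wpM2r ?ler0n // lerDl divr_ge0 ?(ltW s1) // mulr_ge0.
elim=> // N IH W s WN s1 s4 mW.
case: (leqP #|W| m0) => [h|h]; first by exists [::].
have hW : s0 ^+ 4 + n%:R <= #|W|%:R by apply: hm0; apply: ltnW.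
have s04 : 0 <= s0 ^+ 4 by rewrite exprn_ge0 // ltW.
have ss : s0 <= s.
  rewrite -(@ler_pXn2r _ 4) ?nnegrE ?(ltW s00) ?(ltW s1) // s4.
  by move: hW (ler0n R n); clear; lra.
have nW : (n <= #|W|)%N by rewrite -(ler_nat R); move: hW s04; clear; lra.
have cs : 3 * (c / s) <= d.
  rewrite mulrA ler_pdivrMr // [d * s]mulrC -ler_pdivrMr //; apply: le_trans ss.
  by rewrite /s0; move: KK KR32; clear; lra.
have cs0 : 0 <= c / s by rewrite divr_ge0 // ltW.
have [||||W' [W'W NW MW mW']] := @vortex_step R K T E W (k + 2 * c / s) s K1 s4.
- by apply: le_trans ss; rewrite /s0 -/KR; move: cd0; clear; lra.
- by move: cs0 k0; clear; lra.
- by move: cs cs0 kd; clear; lra.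
- exact: mW.
have W0 : 0 < (#|W|%:R : R) by rewrite -s4 exprn_gt0.
have W'0 : 0 < (#|W'|%:R : R).
  rewrite ltr0n lt0n; apply/negP => /eqP h0; rewrite h0 mulr0 in NW.
  by move: NW W0; clear; lra.
(* Here [K >= 32] is used: passing to at most a sixteenth of the vertices halves the fourth root. *)
have hW' : 16 * #|W'|%:R <= (#|W|%:R : R).
  have := ler_wpM2r (ltW W'0) KR32; rewrite -/KR in MW; move: MW; clear; lra.
pose s' := Num.sqrt (Num.sqrt (#|W'|%:R : R)).
have s'1 : 0 < s' by rewrite !sqrtr_gt0.
have s'4 : s' ^+ 4 = #|W'|%:R by rewrite (exprM s' 2 2) !sqr_sqrtr ?sqrtr_ge0 ?ler0n.
have s's : 2 * s' <= s.
  rewrite -(@ler_pXn2r _ 4) ?nnegrE ?(ltW s1) // ?mulr_ge0 ?(ltW s'1) // exprMn s4 s'4.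
  by move: hW'; clear; lra.
have cs' : 2 * (c / s) <= c / s'.
  rewrite ler_pdivlMr // mulrA mulrAC ler_pdivrMr //.
  by have := ler_wpM2l c0 s's; clear; lra.
have kk : k + 2 * c / s + c / s <= k + 2 * c / s' by move: cs' cs0; clear; lra.
have mW2 v : v \in W -> #|W' :\: nb E v|%:R <= (k + 3 * (c / s)) * #|W'|%:R.
  by move=> vW; apply: le_trans (mW' v vW) _; rewrite -/KR -/c; clear; lra.
have [|v vW'|cc [h1 h2]] := IH W' s' _ s'1 s'4.
- apply: leq_trans (_ : #|W'| < #|W|)%N _ => //; rewrite -(ltr_nat R); move: hW' W'0; clear; lra.
- apply: le_trans (mW2 v (subsetP W'W v vW')) _; rewrite ler_wpM2r ?ler0n //.
  by move: kk; clear; lra.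
exists (W' :: cc); split=> //; split=> //; split=> // v vW; apply: le_trans (mW2 v vW) _.
by rewrite ler_wpM2r ?ler0n // lerD2l.
Qed.

(* The edges inside the next but one set of the chain are withheld from each step, so that
   they are all still available one step later. *)
Lemma descend (R : realType) (F : sgraph) (r K n : nat) (e mu k g : R) :
  regular r F -> (1 < K)%N -> 0 <= mu -> 8 <= e * K%:R -> 2 * K%:R ^+ 2 * mu + 2 <= g * K%:R ->
  covers_down F r (2 * K%:R) e mu (k + g) n ->
  forall (T : finType) (E0 : {set {set T}}), simple E0 ->
  forall (c : seq {set T}) (U : {set T}) (E : {set {set T}}),
    chain E0 K k n U c -> (forall v, v \in U -> #|U :\: nb E0 v|%:R <= k * #|U|%:R) ->
    E \subset inside E0 U -> inside E0 (head set0 c) \subset E ->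
    (forall v, (dg (inside E0 U :\: E) v)%:R <= mu * #|U|%:R) ->
    (forall v, (r %| dg E v)%N) ->
    exists D : {set {set T}}, [/\ D \subset E, dec F D & forall e, e \in E :\: D -> e \subset last U c].
Proof.
move=> rF K1 mu0 heK hg CD T E0 sE0; elim=> [|U' c IH] U E.
  move=> _ _ EU _ _ _; exists set0; split; [exact: sub0set|exact: dec0|] => e'.
  by rewrite in_setD => /andP [_ /(subsetP EU)]; rewrite insideP => /andP [].
case=> [[nU U'U hU1 hU2 mU'] hc] mU EU hE hmu rE.
set KR : R := K%:R in hU1 hU2 heK hg CD.
have K2 : 2 <= KR by rewrite ler_nat.
have K0 : 0 < KR by move: K2; clear; lra.
(* At the end of the chain the default [set0] means that nothing is withheld. *)
pose U2 : {set T} := head set0 c.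
have [U2U' hU2'] : U2 \subset U' /\ KR * #|U2|%:R <= 2 * #|U'|%:R.
  rewrite /U2; case: (c) hc => [|V c'] /=; first by rewrite sub0set cards0 mulr0 mulr_ge0 ?ler0n.
  by case=> [[_ h1 _ h2 _] _].
pose E1 := E :\: inside E0 U2.
have sE : simple E by apply: simpleS sE0; apply: subset_trans EU (inside_sub _ _).
have mE1 (Q : {set T}) v : v \in U -> Q \subset U ->
    #|Q :\: nb E1 v|%:R <= #|Q :\: nb E0 v|%:R + mu * #|U|%:R + #|U2|%:R.
  move=> vU QU.
  have h : (#|Q :\: nb E1 v| <= #|Q :\: nb E0 v| + dg (inside E0 U :\: E) v + #|U2|)%N.
    apply: leq_trans (_ : #|(Q :\: nb E0 v) :|: nb (inside E0 U :\: E) v :|: U2| <= _)%N.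
      apply/subset_leq_card/subsetP => x; rewrite !in_setU !in_setD !in_nb => /andP [h xQ].
      rewrite xQ andbT in_setD !insideP pr_sub vU (subsetP QU _ xQ) andbT.
      move: h; rewrite in_setD insideP pr_sub.
      by case: (pr v x \in E0) => //=; case: (pr v x \in E) => //=; rewrite andbT negbK => /andP [].
    by apply: leq_trans (leq_card_setU _ _) _; rewrite leq_add2r leq_card_setU.
  apply: le_trans (_ : (#|Q :\: nb E0 v| + dg (inside E0 U :\: E) v + #|U2|)%N%:R <= _).
    by rewrite ler_nat.
  by rewrite !natrD lerD2r lerD2l.
have g0 : 0 <= #|U|%:R :> R by rewrite ler0n.
have g1 : 0 <= #|U'|%:R :> R by rewrite ler0n.
have g2 : 0 <= #|U2|%:R :> R by rewrite ler0n.
have muK : 2 * KR * (KR * mu) + 2 <= g * KR by move: hg; rewrite expr2; clear; lra.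
have m0 : 0 <= KR * mu by rewrite mulr_ge0 // ltW.
have b1 : mu * #|U|%:R + #|U2|%:R <= g * #|U'|%:R.
  rewrite -(ler_pM2l K0).
  have h1 := ler_wpM2l m0 hU1; have h2 := ler_wpM2r g1 muK.
  by move: h1 h2 hU2'; clear; lra.
have UU : #|U'|%:R <= #|U|%:R :> R by rewrite ler_nat subset_leq_card.
have gg : 0 <= g.
  rewrite -(pmulr_lge0 _ K0); apply: le_trans muK; have := mulr_ge0 (ltW K0) m0; clear; lra.
have b2 : mu * #|U|%:R + #|U2|%:R <= g * #|U|%:R.
  by apply: le_trans b1 _; rewrite ler_wpM2l.
have E1E : E1 \subset E by apply: subsetDl.
have [||||||||D [DE DD Dout Dmu]] := CD T E1 U U' nU.
- exact: simpleS sE.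
- by move=> e' /(subsetP E1E) /(subsetP EU); rewrite insideP => /andP [].
- exact: U'U.
- exact: hU1.
- rewrite -(ler_pM2l K0); have := ler_wpM2r g0 heK; move: hU2; clear; lra.
- move=> v vU; have := mE1 U v vU (subxx _); have := mU v vU; move: b2; clear; lra.
- move=> v vU; have := mE1 U' v vU U'U; have := mU' v vU; move: b1; clear; lra.
- move=> v; rewrite in_setD => /andP [vU' _].
  have -> : dg E1 v = dg E v.
    apply: eq_card => x; rewrite !in_nb in_setD insideP pr_sub.
    by rewrite (contraNF (subsetP U2U' v) vU') andbF.
  exact: rE.
have DE' : D \subset E by apply: subset_trans DE E1E.

have [|||||D' [D'E D'D D'out]] := IH U' (E :\: D) hc.
- by move=> v vU'; apply: mU'; apply: (subsetP U'U).
- apply/subsetP => e'; rewrite in_setD => /andP [eD eE]; rewrite insideP.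
  have := subsetP EU _ eE; rewrite insideP => /andP [-> _] /=.
  case: (boolP (e' \in inside E0 U2)) => h; last by apply: Dout; rewrite !in_setD eD h.
  by move: h; rewrite insideP => /andP [_ h]; apply: subset_trans h U2U'.
- apply/subsetP => e' h; rewrite in_setD; apply/andP; split.
    by apply/negP => /(subsetP DE); rewrite in_setD h.
  by apply: (subsetP hE); move: h; rewrite !insideP => /andP [-> h]; apply: subset_trans h U2U'.
(* Before this step all edges inside [U'] were available, so what is missing there now was taken by
   [D] alone. *)
- move=> v; apply: le_trans (Dmu v); rewrite ler_nat; apply: dgS; apply/subsetP => e'.
  rewrite !in_setD => /andP [h e'U']; rewrite (subsetP hE _ e'U') andbT negbK in h.
  by move: e'U'; rewrite !insideP h => /andP [_ ->].
- by move=> v; rewrite dgD // dvdn_sub //; apply: dec_dg rF DD.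
exists (D :|: D'); split.
- by rewrite subUset DE'; apply: subset_trans D'E (subsetDl _ _).
- apply: decU => //; rewrite disjoint_sym disjoint_subset; apply/subsetP => e' /(subsetP D'E).
  by rewrite in_setD => /andP [].
- move=> e'; rewrite in_setD in_setU negb_or => /andP [/andP [h1 h2] h3].
  by apply: D'out; rewrite !in_setD h2 h1.
Qed.

Lemma chain_last_sub (R : realType) (T : finType) (E : {set {set T}}) K (k : R) n c U :
  chain E K k n U c -> last U c \subset U.
Proof.
elim: c U => [|U' c IH] U //= [[_ h _ _ _] /IH h']; exact: subset_trans h' h.
Qed.

(** * Assembling the iterative absorption *)

(** The gap [eps] is spent as [eps / 4] on the vortex, [eps / 4] on edges missing during the descent
    and [eps / 2] on covering down. With [mu = 1 / K^2] the descent needs [4 <= (eps / 4) K], whence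
    the choice of [K]. *)
Lemma dense_dec (R : realType) (F : sgraph) (r : nat) (u : F) (eps : R) :
  regular r F -> (0 < r)%N -> 0 < eps ->
  exists2 eta : R, 0 < eta & forall (kap : R) n1, 0 <= kap -> 3 * r%:R * (kap + eps) <= 1 ->
    approx_pack F eta (kap + eps) n1 ->
    exists n0, forall (T : finType) (E : {set {set T}}), simple E -> (n0 <= #|T|)%N ->
      (forall v, #|~: nb E v|%:R <= kap * #|T|%:R) ->
      (forall v, (r %| dg E v)%N) -> (#|edges F| %| #|E|)%N -> dec F E.
Proof.
move=> rF r0 e0.
have r1 : 1 <= r%:R :> R by rewrite ler1n.
have [K hK] := ex_nat_ge (32 + 16 / eps); have {hK} := hK K (leqnn K).
set KR : R := K%:R => hK.
have x1 : 0 <= 16 / eps by rewrite divr_ge0 // ltW.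
have K32 : 32 <= KR by move: hK x1; clear; lra.
have heK : 16 <= eps * KR by rewrite mulrC -ler_pdivrMr //; move: hK x1; clear; lra.
have K32' : (32 <= K)%N by rewrite -(ler_nat R).
have K1 : (1 < K)%N by apply: leq_trans K32'.
have K0 : 0 < KR by move: K32; clear; lra.
pose mu := (KR ^+ 2)^-1.
have mu0 : 0 < mu by rewrite invr_gt0 exprn_gt0.
have e2 : 0 < eps / 2 by move: e0; clear; lra.
have e4 : 0 < eps / 4 by move: e0; clear; lra.
have G1 : 1 <= 2 * KR by move: K32; clear; lra.
have [eta eta0 CD] := @cover_down R F r u (2 * KR) (eps / 2) mu rF r0 e2 G1 mu0.
exists eta => // kap n1 k0 hk AP.
have ee : kap + eps / 4 + eps / 4 + eps / 2 = kap + eps by field.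
have [|||n3 CD3] := CD (kap + eps / 4 + eps / 4) n1.
- by move: k0 e4; clear; lra.
- by rewrite ee.
- by rewrite ee.
have [m hm] := @vortex R K n3 (eps / 4) K32' e4.
have [u' uu'] : exists u', adj u u'.
  have : (0 < #|neighbors u|)%N by move: (rF u); rewrite /degree => ->.
  by case/card_gt0P => x; rewrite inE; exists x.
have [C hC] := @absorber_all F r u u' rF r0 uu' m.
have [n0 hn0] := ex_nat_ge (m%:R + 1 + (m + C)%:R / mu + (m + C)%:R / eps).
exists n0 => T E sE hT mE rE fE.
have hN := hn0 _ hT; set N : R := #|T|%:R in hN mE.
have y1 : 0 <= m%:R :> R by rewrite ler0n.
have y2 : 0 <= (m + C)%:R / mu by rewrite divr_ge0 ?ler0n // ltW.
have y3 : 0 <= (m + C)%:R / eps by rewrite divr_ge0 ?ler0n // ltW.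
have N0 : 0 <= N by rewrite ler0n.
have Nm : (m < #|[set: T]|)%N by rewrite cardsT -(ltr_nat R) -/N; move: hN y1 y2 y3; clear; lra.
have Nmu : (m + C)%:R <= mu * N by rewrite mulrC -ler_pdivrMr //; move: hN y1 y2 y3; clear; lra.
have Neps : (m + C)%:R <= eps * N by rewrite mulrC -ler_pdivrMr //; move: hN y1 y2 y3; clear; lra.
have rk : kap <= r%:R * kap by rewrite -[X in X <= _]mul1r ler_wpM2r.
have re : eps <= r%:R * eps by rewrite -[X in X <= _]mul1r ler_wpM2r // ltW.
have mE' v : v \in [set: T] -> #|[set: T] :\: nb E v|%:R <= kap * #|[set: T]|%:R.
  by rewrite setTD cardsT.
(* As [#|T|] exceeds [m], the chain has at least one step, which provides the set [U] that the
   absorber has to avoid. *)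
have [|[|U c] [hc lc]] := hm T E setT kap k0 _ mE'.
- by move: hk rk re k0 e0; clear; lra.
- by move: Nm; rewrite ltnNge lc.
have [[_ _ _ hU _] hc'] := hc.
set Ul := last setT (U :: c) in lc.
have UlU : Ul \subset U := chain_last_sub hc'.
(* Edges inside [U] are kept from the absorber, since the descent starts with all of them
   available. *)
pose EA := E :\: inside E U.
have EAE : EA \subset E by apply: subsetDl.
have cU : KR * #|U|%:R <= 2 * N by move: hU; rewrite cardsT.
pose cc := Num.truncn (kap * N).
have kN0 : 0 <= kap * N by rewrite mulr_ge0.
have [t||A [Z' [AE cZ fA dA absA]]] := hC T EA (~: U) Ul cc lc.
- apply: card_le_truncn; apply: le_trans (mE t); rewrite ler_nat; apply/subset_leq_card/subsetP => x.
  rewrite in_setD [x \in ~: U]in_setC [x \in ~: _]in_setC !in_nb => /andP [h xU].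
  by apply: contra h => h; rewrite in_setD insideP pr_sub (negbTE xU) !andbF.
- have : (3 * r * cc + #|Ul| + C)%N%:R <= #|~: U|%:R :> R.
    have cUC : #|~: U|%:R = N - #|U|%:R :> R.
      by rewrite /N -(cardsC U) natrD [X in _ = X - _]addrC addrK.
    rewrite cUC -addnA natrD natrM.
    have h1 : cc%:R <= kap * N by rewrite truncn_le.
    have h2 : (#|Ul| + C)%N%:R <= (m + C)%:R :> R by rewrite ler_nat leq_add2r.
    have h3 : (3 * r)%:R * cc%:R <= 3 * r%:R * kap * N.
      by rewrite natrM -mulrA -mulrA -[X in _ <= X]mulrA !ler_wpM2l.
    have h4 := ler_wpM2r N0 hk; have h5 := ler_wpM2r N0 re.
    have h6 : 8 * #|U|%:R <= eps * N.
      rewrite -(ler_pM2l K0); have := ler_wpM2r N0 heK; move: cU; clear; lra.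
    have eN : 0 <= eps * N by rewrite mulr_ge0 // ltW.
    by move: h2 h3 h4 h5 h6 Neps eN; clear; lra.
  by rewrite ler_nat.
have AsE : A \subset E by apply: subset_trans AE EAE.
pose E' := E :\: A.
have E'E : E' \subset E by apply: subsetDl.
have [|||||||D [DE DD Dout]] := @descend R F r K n3 (eps / 2) mu (kap + eps / 4) (eps / 4) rF K1 (ltW mu0) _ _ CD3 T E sE (U :: c) setT E' hc.
- by rewrite -/KR; move: heK; clear; lra.
- have -> : 2 * KR ^+ 2 * mu = 2 by rewrite -mulrA /mu mulfV ?mulr1 // gt_eqF // exprn_gt0.
  by rewrite -/KR; move: heK; clear; lra.
- move=> v vT; apply: le_trans (mE' v vT) _; rewrite ler_wpM2r ?ler0n // lerDl; exact: ltW.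
- by apply/subsetP => e' /(subsetP E'E) h; rewrite insideP h subsetT.
- apply/subsetP => e' h; rewrite in_setD (subsetP (inside_sub _ _) _ h) andbT.
  by apply/negP => /(subsetP AE); rewrite in_setD h.
(* The absorber lives on boundedly many vertices, so the degrees it removes are below [mu * N]. *)
- move=> v; rewrite cardsT; apply: le_trans Nmu; rewrite ler_nat; apply: leq_trans (_ : #|Z'| <= _)%N.
    apply/subset_leq_card/subsetP => x; rewrite in_nb in_setD insideP => /andP [h /andP [h1 _]].
    move: h; rewrite in_setD h1 andbT negbK => /fA [].
    by rewrite pr_sub => /andP [].
  by apply: leq_trans cZ _; rewrite leq_add2r.
- by move=> v; rewrite dgD // dvdn_sub //; apply: dec_dg rF dA.
pose H := E' :\: D.
have HE' : H \subset E' by apply: subsetDl.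
have AH : [disjoint H & A].
  rewrite disjoint_subset; apply/subsetP => e' /(subsetP HE').
  by rewrite in_setD inE => /andP [].
have dHA : dec F (H :|: A).
  apply: absA.
  - by apply: simpleS sE; apply: subset_trans HE' E'E.
  - exact: Dout.
  - rewrite cardsD (setIidPr DE) cardsD (setIidPr AsE) !dvdn_sub //; exact: dec_card.
  - move=> t; rewrite dgD // dvdn_sub ?(dec_dg t rF DD) // dgD // dvdn_sub //.
    exact: dec_dg rF dA.
have -> : E = D :|: (H :|: A).
  apply/setP => e'; rewrite !in_setU !in_setD; apply/idP/or3P => [eE|[h|/andP [_ /andP [_ ->]]|h]] //.
  - case: (boolP (e' \in D)) => eD; first by constructor 1.
    case: (boolP (e' \in A)) => eA; first by constructor 3.
    by constructor 2; rewrite eE.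
  - by apply: (subsetP E'E); apply: (subsetP DE).
  - exact: (subsetP AsE).
apply: decU => //; rewrite disjointUr; apply/andP; split.
  by rewrite disjoint_sym disjoint_subset; apply/subsetP => e'; rewrite in_setD inE => /andP [].
rewrite disjoint_subset; apply/subsetP => e' /(subsetP DE).
by rewrite in_setD inE => /andP [].
Qed.

(** * From edge sets back to graphs *)

Lemma min_degree_le (G : sgraph) (x : G) : (min_degree G <= degree x)%N.
Proof.
rewrite /min_degree; have: x \in index_enum G by rewrite mem_index_enum.
elim: (index_enum G) => // y s IH; rewrite in_cons big_cons geq_min => /orP [/eqP ->|/IH ->].
  by rewrite leqnn.
by rewrite orbT.
Qed.

Lemma min_degree_ge (R : realType) (G : sgraph) (d : R) : d <= #|G|%:R ->
  (forall x : G, d <= (degree x)%:R) -> d <= (min_degree G)%:R.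
Proof.
move=> h1 h2; rewrite /min_degree; apply: (big_ind (fun m : nat => d <= m%:R)) => // a b ha hb.
by rewrite /minn; case: ifP.
Qed.

Lemma dvd_degree_gcd (G : sgraph) (x : G) : (degree_gcd G %| degree x)%N.
Proof.
rewrite /degree_gcd; have: x \in index_enum G by rewrite mem_index_enum.
elim: (index_enum G) => // y s IH; rewrite in_cons big_cons => /orP [/eqP ->|/IH h].
  exact: dvdn_gcdl.
exact: dvdn_trans (dvdn_gcdr _ _) h.
Qed.

Lemma degree_gcd_regular (F : sgraph) (r : nat) (u : F) : regular r F -> degree_gcd F = r.
Proof.
move=> rF; apply/eqP; rewrite eqn_dvd -{1}(rF u) dvd_degree_gcd /=.
rewrite /degree_gcd; apply: (big_ind (fun m : nat => r %| m)%N) => [|a b ha hb|x _].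
- exact: dvdn0.
- by rewrite dvdn_gcd ha.
- by rewrite rF.
Qed.

(** The copies cover exactly the edges of [G], so every edge of a copy is one of [G] and the maps
    are embeddings. *)
Lemma dec_has_decomposition (F G : sgraph) : dec F (edges G) -> has_decomposition F G.
Proof.
case=> P hP hc; exists P => // C CP; have [f fi CE] := hc C CP.
exists f => //; split=> // x y xy; rewrite -in_edges.
by rewrite -(cover_partition hP); apply/bigcupP; exists C; rewrite // CE mem_img.
Qed.

Section Induced.
Variables (T : finType) (E : {set {set T}}) (S : {set T}).
Hypothesis sE : simple E.
Hypothesis ES : forall e, e \in E -> e \subset S.

(** The threshold speaks of graphs on their whole vertex type, so an edge set on [S] is carried over
    to the type of elements of [S]. *)
Definition sub_adj : rel {x | x \in S} := fun x y => pr (val x) (val y) \in E.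

Lemma sub_adj_sym : symmetric sub_adj.
Proof. by move=> x y; rewrite /sub_adj prC. Qed.

Lemma sub_adj_irr : irreflexive sub_adj.
Proof. by move=> x; apply/negP => /(simple_neq sE); rewrite eqxx. Qed.

Definition sub_graph : sgraph := SGraph sub_adj_sym sub_adj_irr.

Lemma card_sub_graph : #|sub_graph| = #|S|.
Proof. by rewrite /= card_sig; apply: eq_card => x; rewrite inE. Qed.

Lemma degree_sub_graph (x : sub_graph) : degree x = dg E (val x).
Proof.
rewrite /degree /dg -(card_imset _ val_inj); apply: eq_card => y; rewrite in_nb.
apply/imsetP/idP => [[z]|h]; first by rewrite inE => h ->.
have yS : y \in S by have := ES h; rewrite pr_sub => /andP [].
by exists (exist _ y yS) => //; rewrite inE.
Qed.

Lemma lift_family (F : sgraph) (P : {set {set {set sub_graph}}}) :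
  (0 < #|edges F|)%N -> trivIset P -> (forall C, C \in P -> copy_edges F C) ->
  exists D : {set {set T}}, [/\ D \subset E, dec F D & (#|E :\: D| <= #|edges sub_graph :\: cover P|)%N].
Proof.
move=> F0 tP hP.
pose v (e : {set sub_graph}) : {set T} := val @: e.
have vi : injective v by apply: imset_inj; apply: val_inj.
have vE : v @: edges sub_graph = E.
  apply/setP => e; apply/imsetP/idP => [[e' /edgesP [x [y [xy ->]]] ->]|eE].
    by rewrite /v imset_pr.
  have [x [y [_ ee]]] := simple_pr sE eE.
  have := ES eE; rewrite ee pr_sub => /andP [xS yS].
  exists (pr (exist _ x xS : sub_graph) (exist _ y yS)); last by rewrite /v imset_pr.
  by rewrite in_edges /= /sub_adj /= -ee.
pose D := \bigcup_(C in P) v @: C.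
have CE C : C \in P -> C \subset edges sub_graph.
  move=> CP; have [f [fi fa] ->] := hP C CP; apply/subsetP => e /imgP [x [y [xy ->]]].
  by rewrite in_edges; apply: fa.
exists D; split.
- by apply/bigcupsP => C CP; rewrite -vE imsetS // CE.
- apply: dec_bigcup => [C CP|C C' CP C'P nC].
    apply: dec_copy => //; have [f [fi _] ->] := hP C CP.
    exists (val \o f); first exact: inj_comp val_inj fi.
    rewrite /img -imset_comp; apply: eq_imset => e.
    by rewrite /v /= -imset_comp.
  by rewrite imset_disjoint //; apply: (trivIsetP tP).
rewrite -(card_imset _ vi); apply/subset_leq_card/subsetP => e; rewrite in_setD -{1}vE.
move=> /andP [eD /imsetP [e' e'E ee]]; apply/imsetP; exists e' => //.
rewrite in_setD e'E andbT; apply: contra eD => /bigcupP [C CP e'C].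
by apply/bigcupP; exists C => //; rewrite ee imset_f.
Qed.

End Induced.

(* Applying the threshold *)
From mathcomp Require Import all_classical all_reals all_analysis.
Import Order.TTheory GRing.Theory Num.Theory.

(** Neither the limit superior nor the infimum need be attained, which costs the slack [e]: from
    some [n1] on the threshold at [n] is below [d + e], hence so is some admissible [d']. *)
Lemma threshold_approx_pack (R : realType) (F : sgraph) (eta d e : R) :
  (0 < #|edges F|)%N -> 0 < e -> (approx_threshold eta F <= d%:E)%E ->
  exists n1, approx_pack F eta (1 - d - e) n1.
Proof.
move=> F0 e0 hd.
have : (limn_esup (approx_threshold_at eta F) < (d + e)%:E)%E.
  by apply: le_lt_trans hd _; rewrite lte_fin ltrDl.
move=> /ereal_inf_lt [_ [V [N _ hN] <-] hV].
exists N => T E S sE ES NS mE.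
pose G := sub_graph S sE.
have cG : #|G| = #|S| by apply: card_sub_graph.
have : (approx_threshold_at eta F #|S| < (d + e)%:E)%E.
  apply: le_lt_trans hV; apply: ereal_sup_ubound.
  by exists #|S| => //; apply: hN.
move=> /ereal_inf_lt [_ [d' hd' <-]]; rewrite lte_fin => d'd.
have deg (x : G) : d' * #|S|%:R <= (degree x)%:R.
  rewrite (degree_sub_graph ES).
  have xS : val x \in S := valP x.
  have h1 := mE _ xS.
  have h2 : #|S|%:R <= #|S :\: nb E (val x)|%:R + (dg E (val x))%:R :> R.
    rewrite -natrD ler_nat -(cardsID (nb E (val x)) S) addnC leq_add2l.
    by apply/subset_leq_card/subsetIr.
  have := ler_wpM2r (ler0n R #|S|) (ltW d'd); move: h1 h2; clear; lra.
have md : d' * #|S|%:R <= (min_degree G)%:R.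
  apply: min_degree_ge => //; rewrite cG.
  case: (pickP (mem S)) => [x xS|S0]; last by rewrite eq_card0 // mulr0.
  apply: le_trans (deg (exist _ x xS)) _; rewrite ler_nat -cG; exact: max_card.
have [P [tP hP cP]] := hd' G cG md.
have [D [DE dD cD]] := lift_family ES F0 tP hP.
exists D; split=> //; apply: le_trans (_ : _ <= #|edges G :\: finset.cover P|%:R) _; first by rewrite ler_nat.
by rewrite -cG.
Qed.

Theorem theorem1p3 (R : realType) (r : nat) (F : sgraph) :
  (1 <= r)%N -> regular r F ->
  forall eps : R, 0 < eps ->
  exists (n0 : nat) (eta : R), 0 < eta /\
    let delta : \bar R :=
      maxe (approx_threshold eta F) (1 - (3 * r)%:R^-1)%:E in
    forall (n : nat) (G : sgraph), (n0 <= n)%N -> #|G| = n ->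
      divisible F G ->
      ((delta + eps%:E) * n%:R%:E <= (min_degree G)%:R%:E)%E ->
      has_decomposition F G.
Proof.
move=> r0 rF eps e0.
(* Without vertices [F] has no edges, and divisibility forces [G] to have none. *)
case: (pickP (mem F)) => [u _|F0]; last first.
  exists 0, 1; split=> // delta n G _ _ [hd _] _.
  have F00 : num_edges F = 0.
    apply/eqP; rewrite cards_eq0; apply/eqP/setP => e; rewrite finset.in_set0.
    by apply/negP => /edgesP [x _]; have := F0 x.
  apply: dec_has_decomposition; move: hd; rewrite F00 dvd0n /num_edges finset.cards_eq0 => /eqP ->.
  exact: dec0.
have e2 : 0 < eps / 2 by rewrite divr_gt0.
(* Here [eta] is fixed from [eps] and [F]; the value of [delta], and then [n0], depend on it. *)
have [eta eta0 key] := @dense_dec R F r u (eps / 2) rF r0 e2.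
pose delta := maxe (approx_threshold eta F) (1 - (3 * r)%:R^-1)%:E.
have h1 : (approx_threshold eta F <= delta)%E by rewrite le_max lexx.
have h2 : ((1 - (3 * r)%:R^-1)%:E <= delta)%E by rewrite le_max lexx orbT.
suff [n0 hn0] : exists n0, forall (n : nat) (G : sgraph), (n0 <= n)%N -> #|G| = n ->
      divisible F G -> ((delta + eps%:E) * n%:R%:E <= (min_degree G)%:R%:E)%E ->
      has_decomposition F G.
  by exists n0, eta.
(* The maximum with a real number excludes [-oo]; for [+oo] the degree hypothesis fails as soon as
   [n >= 1]. *)
case: delta h1 h2 => [d| |] h1 h2.
- have r00 : 0 < (3 * r)%:R :> R by rewrite ltr0n muln_gt0.
  have hd : (3 * r)%:R * (1 - d) <= 1.
    by rewrite -ler_pdivlMl // mulr1; move: h2; rewrite lee_fin; clear; lra.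
  have F0 : (0 < #|edges F|)%N by apply: edges_gt0 rF r0.
  have [n1 AP] := threshold_approx_pack F0 e2 h1.
  (* If [d + eps] exceeds 1, the required degree exceeds [n], which no graph with a vertex can
     have. *)
  have [kap0|kap0] := leP 0 (1 - d - eps); last first.
    exists 1%N => n G n1' cG _; rewrite -EFinD -EFinM lee_fin => hm.
    have [x _] : exists x, x \in G by apply/card_gt0P; rewrite cG.
    have : (min_degree G)%:R <= n%:R :> R.
      by rewrite ler_nat -cG; apply: leq_trans (min_degree_le x) (max_card _).
    have : 1 <= n%:R :> R by rewrite ler1n.
    by move: hm kap0; clear; nra.
  have ee : 1 - d - eps + eps / 2 = 1 - d - eps / 2 by field.
  have [||n0 hn0] := key (1 - d - eps) n1 kap0.
  - rewrite ee; move: hd; rewrite natrM => hd.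
    have : 0 <= 3 * r%:R * eps by rewrite !mulr_ge0 ?ler0n // ltW.
    by move: hd; clear; lra.
  - by rewrite ee.
  exists n0 => n G nn cG [hdE hdg]; rewrite -EFinD -EFinM lee_fin => hm.
  apply: dec_has_decomposition; apply: hn0 => //.
  - exact: simple_edges.
  - by rewrite cG.
  - move=> v; rewrite nb_edges.
    have hv : (min_degree G)%:R <= #|neighbors v|%:R :> R by rewrite ler_nat; apply: min_degree_le.
    have : #|neighbors v|%:R + #|finset.setC (neighbors v)|%:R = n%:R :> R by rewrite -natrD cardsC cG.
    by rewrite cG; move: hv hm; clear; lra.
  - move=> v; rewrite /dg nb_edges -(degree_gcd_regular u rF); apply: dvdn_trans hdg _.
    exact: dvd_degree_gcd.
- exists 1%N => n G n1' cG _; rewrite addye // mulr_infty gtr0_sg ?ltr0n // mul1e.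
  by rewrite leye_eq.
- by move: h2; rewrite leeNy_eq.
Qed.
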